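(* Let $n\geq 1$ be an integer, let $b\in L^1([0,\infty))$ be a nonnegative function, and let $R>0$. Let $(u_0,u_1,v_0,v_1)\in \big(W^{1,1}_{\mathrm{loc}}(\mathbb{R}^n)\times L^1_{\mathrm{loc}}(\mathbb{R}^n)\big)^2$ be such that each of $u_0,u_1,v_0,v_1$ is nonnegative and nontrivial (not a.e. zero) and has support contained in $B_R$. Let $p,q>1$ be such that $$\Gamma(n,p,q,0) \doteq \max \left\{\frac{2+p^{-1}}{pq-1}-\frac{n-1}{2},\ \frac{q+2}{pq-1}-n+1,\ \frac{2p+1}{pq-1}-n\right\}>0 .$$ Then there exist $\varepsilon_0=\varepsilon_0(n,b,p,q,R,u_0,u_1,v_0,v_1)>0$ and a constant $C>0$ independent of $\varepsilon$ such that for any $\varepsilon\in(0,\varepsilon_0]$ the following holds: if $(u,v)$ is a local (in time) weak solution on $[0,T(\varepsilon))$ of $$\begin{cases} \partial_t^2u-\Delta u+\partial_tu=\vert v\vert^p, & t>0, \ x\in \mathbb{R}^n,\\ \partial_t^2v-\Delta v+b(t)\partial_tv=\vert u\vert^q, & t>0, \ x\in \mathbb{R}^n,\\ (u,\partial_tu,v,\partial_tv)(0,x)=\varepsilon(u_0,u_1,v_0,v_1)(x), &x\in\mathbb{R}^n, \end{cases}$$ then $(u,v)$ blows up in finite time (i.e. $T(\varepsilon)<\infty$) and $$T(\varepsilon)\leq C\, \varepsilon^{-\frac{1}{\Gamma(n,p,q,0)}} .$$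
   Context: Notation: $B_\varrho=\{x\in\mathbb{R}^n:|x|\leq \varrho\}$ for $\varrho>0$. Weak solution. Let $\varepsilon>0$, $p,q>1$, and let the data $(u_0,u_1,v_0,v_1)\in\big(W^{1,1}_{\mathrm{loc}}(\mathbb{R}^n)\times L^1_{\mathrm{loc}}(\mathbb{R}^n)\big)^2$ have supports contained in $B_R$. A pair $(u,v)$ is a weak solution of the Cauchy problem on $[0,T)$, $0<T\leq\infty$, if $$u\in \mathcal{C}\big([0,T),W^{1,1}_{\mathrm{loc}}(\mathbb{R}^n)\big)\cap \mathcal{C}^1\big([0,T),L^1_{\mathrm{loc}}(\mathbb{R}^n)\big)\cap L^q_{\mathrm{loc}}([0,T)\times\mathbb{R}^n),$$ $$v\in \mathcal{C}\big([0,T),W^{1,1}_{\mathrm{loc}}(\mathbb{R}^n)\big)\cap \mathcal{C}^1\big([0,T),L^1_{\mathrm{loc}}(\mathbb{R}^n)\big)\cap L^p_{\mathrm{loc}}([0,T)\times\mathbb{R}^n),$$ $\mathrm{supp}\,(u,v)(t,\cdot)\subset B_{R+t}$ for any $t\in(0,T)$, $u(0,\cdot)=\varepsilon u_0$ and $v(0,\cdot)=\varepsilon v_0$ in $L^1_{\mathrm{loc}}(\mathbb{R}^n)$, and for any $\phi,\psi\in\mathcal{C}_0^\infty([0,T)\times\mathbb{R}^n)$ and any $t\in(0,T)$ $$\int_0^t\!\int_{\mathbb{R}^n}\big(-\partial_su\,\partial_s\phi+\partial_su\,\phi+\nabla u\cdot\nabla\phi\big)\,dx\,ds+\int_{\mathbb{R}^n}\partial_tu(t,x)\phi(t,x)\,dx=\varepsilon\int_{\mathbb{R}^n}u_1(x)\phi(0,x)\,dx+\int_0^t\!\int_{\mathbb{R}^n}|v|^p\phi\,dx\,ds,$$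 $$\int_0^t\!\int_{\mathbb{R}^n}\big(-\partial_sv\,\partial_s\psi+\nabla v\cdot\nabla\psi+b(s)\partial_sv\,\psi\big)\,dx\,ds+\int_{\mathbb{R}^n}\partial_tv(t,x)\psi(t,x)\,dx=\varepsilon\int_{\mathbb{R}^n}v_1(x)\psi(0,x)\,dx+\int_0^t\!\int_{\mathbb{R}^n}|u|^q\psi\,dx\,ds.$$ Here ''blows up in finite time'' means that the solution cannot exist for all times: any $T(\varepsilon)$ for which a weak solution on $[0,T(\varepsilon))$ exists is finite. *)

(* Defs.v *)
From HB Require Import structures.
From mathcomp Require Import all_boot all_order all_algebra.
From mathcomp Require Import all_classical all_reals all_analysis.

Set Implicit Arguments.
Unset Strict Implicit.
Unset Printing Implicit Defensive.

Import Order.TTheory GRing.Theory Num.Theory.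
Import numFieldNormedType.Exports.

Local Open Scope classical_set_scope.
Local Open Scope ring_scope.

Definition rV_display : measure_display.
Proof. exact: default_measure_display. Qed.

Section measurable_rV.
Context {R : realType} (n : nat).

Let coords : 'I_n -> 'rV[R]_n -> R := fun i x => x ord0 i.

Let rV_set0 : g_sigma_preimage coords set0.
Proof. exact: sigma_algebra0. Qed.

Let rV_setC A : g_sigma_preimage coords A -> g_sigma_preimage coords (~` A).
Proof. exact: sigma_algebraC. Qed.

Let rV_bigcup (F : (set 'rV[R]_n)^nat) :
  (forall i, g_sigma_preimage coords (F i)) ->
  g_sigma_preimage coords (\bigcup_i (F i)).
Proof. exact: sigma_algebra_bigcup. Qed.

HB.instance Definition _ := @isMeasurable.Build rV_display
  'rV[R]_n (g_sigma_preimage coords) rV_set0 rV_setC rV_bigcup.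

Lemma measurable_coord (i : 'I_n) :
  measurable_fun [set: 'rV[R]_n] (fun x => x ord0 i).
Proof.
move=> _ Y mY; rewrite setTI; apply: sub_sigma_algebra => /=.
rewrite -bigcup_seq/=; exists i => /=; first by rewrite mem_index_enum.
by exists Y => //; rewrite setTI.
Qed.

Lemma measurable_fun_rV d (T : measurableType d) (f : T -> 'rV[R]_n) :
  (forall i, measurable_fun [set: T] (fun t => f t ord0 i)) ->
  measurable_fun [set: T] f.
Proof.
move=> mf _ A mA; rewrite setTI.
suff : g_sigma_preimage coords `<=` [set B | measurable (f @^-1` B)] by exact.
apply: smallest_sub; first split => /=.
- by rewrite preimage_set0.
- by move=> B mB; rewrite setTD preimage_setC; exact: measurableC.
- by move=> F mF; rewrite preimage_bigcup; exact: bigcup_measurable.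
- move=> B; rewrite -bigcup_seq/= => -[i _ [Y mY <-]] /=.
  by rewrite setTI; have := mf i measurableT Y mY; rewrite setTI.
Qed.

End measurable_rV.

Section lebesgue_rV.
Context {R : realType}.

Definition cons_rV n (z : measurableTypeR R * 'rV[R]_n) : 'rV[R]_n.+1 :=
  \row_i oapp (fun j => z.2 ord0 j) z.1 (unlift ord0 i).

Definition uncons_rV n (x : 'rV[R]_n.+1) : measurableTypeR R * 'rV[R]_n :=
  (x ord0 ord0, \row_j x ord0 (lift ord0 j)).

Lemma cons_rVK n : cancel (@cons_rV n) (@uncons_rV n).
Proof.
move=> [a v]; rewrite /uncons_rV /cons_rV mxE unlift_none /=; congr pair.
by apply/rowP => j; rewrite !mxE liftK.
Qed.

Lemma measurable_cons_rV n : measurable_fun setT (@cons_rV n).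
Proof.
apply: measurable_fun_rV => i; rewrite /cons_rV.
under eq_fun do rewrite mxE.
case: (unlift ord0 i) => [j|] /=; last exact: measurable_fst.
have h := @measurable_snd _ _ (measurableTypeR R) 'rV[R]_n.
exact: (measurableT_comp (@measurable_coord R n j) h).
Qed.

Lemma measurable_uncons_rV n : measurable_fun setT (@uncons_rV n).
Proof.
apply: measurable_fun_pair; first exact: (@measurable_coord R n.+1 ord0).
apply: measurable_fun_rV => j; under eq_fun do rewrite mxE.
exact: measurable_coord.
Qed.

Definition consrV_measure n (mu : {sigma_finite_measure set 'rV[R]_n -> \bar R}) :
  set 'rV[R]_n.+1 -> \bar R :=
  pushforward (lebesgue_measure \x mu)%E (@cons_rV n).

Section consrV_measure.
Variables (n : nat) (mu : {sigma_finite_measure set 'rV[R]_n -> \bar R}).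
Local Notation nu := (consrV_measure mu).

Let nu0 : nu set0 = 0%E.
Proof. by rewrite /consrV_measure /pushforward preimage_set0 measure0. Qed.

Let nu_ge0 A : (0 <= nu A)%E. 
Proof. by rewrite /consrV_measure /pushforward; apply: measure_ge0. Qed.

Let nu_sigma_additive : semi_sigma_additive nu.
Proof.
move=> F mF tF mUF; rewrite /consrV_measure /pushforward preimage_bigcup.
apply: measure_semi_sigma_additive.
- by move=> k; rewrite -[X in measurable X]setTI; exact: measurable_cons_rV.
- apply/trivIsetP => /= i j _ _ ij; rewrite -preimage_setI.
  by move/trivIsetP : tF => /(_ _ _ _ _ ij) ->//; rewrite preimage_set0.
- by rewrite -preimage_bigcup -[X in measurable X]setTI;
    exact: measurable_cons_rV.
Qed.

HB.instance Definition _ := isMeasure.Build _ _ _ nu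
  nu0 nu_ge0 nu_sigma_additive.

Let nu_sigma_finite : sigma_finite setT nu.
Proof.
have /sigma_finiteP[F [TF ndF Foo]] := sigma_finiteT (@lebesgue_measure R).
have /sigma_finiteP[G [TG ndG Goo]] := sigma_finiteT mu.
exists (fun k => @uncons_rV n @^-1` (F k `*` G k)).
  rewrite predeqE => x; split => // _.
  have [i _ Fi] : (\bigcup_k F k) (uncons_rV x).1 by rewrite -TF.
  have [j _ Gj] : (\bigcup_k G k) (uncons_rV x).2 by rewrite -TG.
  exists (maxn i j) => //; split => /=.
    by move: Fi; exact/subsetPset/ndF/leq_maxl.
  by move: Gj; exact/subsetPset/ndG/leq_maxr.
move=> k; have [? ?] := Foo k; have [? ?] := Goo k; split.
  by rewrite -[X in measurable X]setTI; apply: measurable_uncons_rV => //;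
    exact: measurableX.
rewrite /consrV_measure /pushforward -comp_preimage.
have -> : @uncons_rV n \o @cons_rV n = id by apply/funext; exact: cons_rVK.
by rewrite preimage_id product_measure1E// lte_mul_pinfty// ge0_fin_numE.
Qed.

HB.instance Definition _ := Measure_isSigmaFinite.Build _ _ _ nu
  nu_sigma_finite.

End consrV_measure.

Fixpoint lebesgue_rV n : {sigma_finite_measure set 'rV[R]_n -> \bar R} :=
  match n with
  | 0 => \d_(0 : 'rV[R]_0)
  | n'.+1 => consrV_measure (lebesgue_rV n')
  end.

Lemma lebesgue_rV_box n (A : 'I_n -> set R) :
  (forall i, measurable (A i)) ->
  lebesgue_rV n [set x | forall i, A i (x ord0 i)] =
  (\prod_(i < n) lebesgue_measure (A i))%E.
Proof.
elim: n A => [|n IH] A mA /=.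
  by rewrite big_ord0 diracE mem_set//= => -[].
rewrite /consrV_measure /pushforward big_ord_recl -IH//.
rewrite -product_measure1E; last 2 first.
- exact: mA.
- rewrite [X in measurable X](_ : _ = \bigcap_(i in [set: 'I_n])
      ((fun x : 'rV[R]_n => x ord0 i) @^-1` A (lift ord0 i))).
    apply: fin_bigcap_measurable => // i _; rewrite -[X in measurable X]setTI.
    exact: measurable_coord.
  by rewrite predeqE => x; split => [h i _|h i]; [exact: h|exact: (h i)].
congr (product_measure1 _ _ _); rewrite predeqE => -[a v]; split => [h|[/= ha hv] i].
- split => [|j] /=; first by have := h ord0; rewrite mxE unlift_none.
  by have := h (lift ord0 j); rewrite mxE liftK.
- by rewrite mxE; case: unliftP => [j ->|->].
Qed.

End lebesgue_rV.
Arguments lebesgue_rV : clear implicits.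

Section smooth.
Context {R : realType} {V : normedModType R}.

(* C^infinity functions: on a finite-dimensional V it amounts to the same to  *)
(* let the directions of the iterated derivatives range over a basis.         *)
Definition iter_derive (s : seq V) (f : V -> R) : V -> R :=
  foldr (fun v (g : V -> R) => 'D_v g) f s.

Definition smooth (f : V -> R) :=
  forall s : seq V, continuous (iter_derive s f) /\
    forall x v, derivable (iter_derive s f) x v.

Definition tsupp (f : V -> R) : set V := closure [set x | f x != 0].

End smooth.

Section local_spaces.
Context {R : realType} {n : nat}.
Local Notation Rn := ('rV[R]_n).
Local Notation leb := (lebesgue_rV R n).

Definition eball (rho : R) : set Rn :=
  [set x | Num.sqrt (\sum_(i < n) x ord0 i ^+ 2) <= rho].

(* Support of a class modulo a.e. equality: the complement of the largest     *)
(* open set on which f vanishes almost everywhere.                            *)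
Definition ess_supp {V : nmodType} (f : Rn -> V) : set Rn :=
  ~` \bigcup_(U in [set U | open U /\ {ae leb, forall x, U x -> f x = 0}]) U.

Definition L1loc (f : Rn -> R) :=
  measurable_fun [set: Rn] f /\
  forall K, compact K -> leb.-integrable K (EFin \o f).

Definition unit_rV (i : 'I_n) : Rn := delta_mx ord0 i.

Definition weak_partial (i : 'I_n) (f g : Rn -> R) :=
  forall phi : Rn -> R, smooth phi -> compact (tsupp phi) ->
    \int[leb]_x (f x * 'D_(unit_rV i) phi x) = - \int[leb]_x (g x * phi x).

Definition weak_gradient (f : Rn -> R) (Df : 'I_n -> Rn -> R) :=
  forall i, L1loc (Df i) /\ weak_partial i f (Df i).

Definition W11loc (f : Rn -> R) :=
  L1loc f /\ exists Df : 'I_n -> Rn -> R, weak_gradient f Df.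

Definition cvg_L1loc (F : set_system R) (f : R -> Rn -> R) (g : Rn -> R) :=
  forall K, compact K ->
    (\int[leb]_(x in K) `|f t x - g x|%:E)%E @[t --> F] --> 0%E.

End local_spaces.

Section weak_solution.
Context {R : realType} {n : nat}.
Local Notation Rn := ('rV[R]_n).
Local Notation leb := (lebesgue_rV R n).
Local Notation spacetime := (measurableTypeR R * Rn)%type.

Definition time_itv (T : \bar R) : set R := [set t | 0 <= t /\ (t%:E < T)%E].

Definition C_L1loc (T : \bar R) (f : R -> Rn -> R) :=
  (forall t, time_itv T t -> L1loc (f t)) /\
  (forall t, time_itv T t -> cvg_L1loc (within (time_itv T) (nbhs t)) f (f t)).

(* Df t i is the i-th weak partial derivative of f t. *)
Definition C_W11loc (T : \bar R) (f : R -> Rn -> R) (Df : R -> 'I_n -> Rn -> R) :=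
  [/\ C_L1loc T f,
      forall t, time_itv T t -> weak_gradient (f t) (Df t) &
      forall i, C_L1loc T (fun t => Df t i)].

(* df is the derivative of f, one-sided at t = 0. *)
Definition C1_L1loc (T : \bar R) (f df : R -> Rn -> R) :=
  [/\ C_L1loc T f, C_L1loc T df &
      forall t, time_itv T t ->
        cvg_L1loc (within (time_itv T `\ t) (nbhs t))
          (fun s x => (f s x - f t x) / (s - t)) (df t)].

(* An element of C([0, T), L^1_loc) has a representative f that is jointly    *)
(* Borel in (t, x); membership in L^q_loc is stated for such an f.            *)
Definition Lloc_spacetime (q : R) (T : \bar R) (f : R -> Rn -> R) :=
  let D : set spacetime := [set z | time_itv T z.1] in
  measurable_fun D (fun z : spacetime => f z.1 z.2) /\
  forall K : set (R * Rn), compact K -> K `<=` D ->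
    (\int[lebesgue_measure \x leb]_(z in (K : set spacetime))
       (`|f z.1 z.2| `^ q)%:E < +oo)%E.

(* Test functions on [0, T) x R^n need not vanish at t = 0: they are the      *)
(* restrictions of smooth functions with compact support in (-oo, T) x R^n.   *)
Definition test_function (T : \bar R) (phi : R * Rn -> R) :=
  [/\ smooth phi, compact (tsupp phi) &
      tsupp phi `<=` [set z | (z.1%:E < T)%E]].

Definition dtime (phi : R * Rn -> R) : R * Rn -> R := 'D_(1, 0) phi.

Definition dspace (i : 'I_n) (phi : R * Rn -> R) : R * Rn -> R :=
  'D_(0, unit_rV i) phi.

(* Weak form of w_tt - Laplacian w + c(t) w_t = F with w_t(0) = eps * w1,     *)
(* where dw is the time derivative and Dw the gradient of w.                  *)
Definition weak_wave (T : \bar R) (eps : R) (c : R -> R) (w1 : Rn -> R)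
    (dw : R -> Rn -> R) (Dw : R -> 'I_n -> Rn -> R) (F : R -> Rn -> R) :=
  forall phi, test_function T phi ->
  forall t, 0 < t -> (t%:E < T)%E ->
    \int[lebesgue_measure]_(s in `[0, t])
      (\int[leb]_x (- dw s x * dtime phi (s, x)
                    + c s * dw s x * phi (s, x)
                    + \sum_(i < n) Dw s i x * dspace i phi (s, x)))
    + \int[leb]_x (dw t x * phi (t, x))
  = eps * \int[leb]_x (w1 x * phi (0, x))
    + \int[lebesgue_measure]_(s in `[0, t]) \int[leb]_x (F s x * phi (s, x)).

Definition weak_solution (b : R -> R) (p q rho eps : R)
    (u0 u1 v0 v1 : Rn -> R) (T : \bar R) (u v : R -> Rn -> R) :=
  exists (du dv : R -> Rn -> R) (Du Dv : R -> 'I_n -> Rn -> R),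
  [/\ [/\ C_W11loc T u Du, C1_L1loc T u du & Lloc_spacetime q T u],
      [/\ C_W11loc T v Dv, C1_L1loc T v dv & Lloc_spacetime p T v],
      forall t, 0 < t -> (t%:E < T)%E ->
        ess_supp (fun x => (u t x, v t x)) `<=` eball (rho + t),
      {ae leb, forall x, u 0 x = eps * u0 x} /\
      {ae leb, forall x, v 0 x = eps * v0 x} &
      weak_wave T eps (fun=> 1) u1 du Du (fun s x => `|v s x| `^ p) /\
      weak_wave T eps b v1 dv Dv (fun s x => `|u s x| `^ q)].

End weak_solution.

Definition admissible_datum {R : realType} {n : nat} (rho : R)
    (f : 'rV[R]_n -> R) :=
  [/\ {ae lebesgue_rV R n, forall x, 0 <= f x},
      ~ {ae lebesgue_rV R n, forall x, f x = 0} &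
      ess_supp f `<=` eball rho].

(* Gamma(n, p, q, 0) *)
Definition Gamma0 {R : realType} (n : nat) (p q : R) : R :=
  Num.max (Num.max ((2 + p^-1) / (p * q - 1) - (n%:R - 1) / 2)
                   ((q + 2) / (p * q - 1) - n%:R + 1))
          ((2 * p + 1) / (p * q - 1) - n%:R).

(* Main.v *)
Require Import Defs.
From mathcomp Require Import all_boot all_order all_algebra.
From mathcomp Require Import all_classical all_reals all_analysis.
From mathcomp Require Import finmap measurable_realfun ring lra.

(* Let U, V be the space integrals of u, v, let F, H be those of |v|^p, |u|^q *)
(* and put G(t) = U(0) + eps int u1 + int_0^t F. Testing with functions equal *)
(* to 1 on the light cone gives U' + U = G and V'' + b V' = H, so that, b     *)
(* being integrable, V' dominates a fixed multiple of eps int v1 + int_0^t H. *)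
(* Finite speed of propagation and Jensen's inequality bound F and H below by *)
(* powers of V and U; along the times T (1 - 2^-(j+1)) this feeds G(T/2) back *)
(* into itself with exponent p q > 1, and G(T) < +oo forces                   *)
(*   G(T/2) <= C T^(n - (2p+1)/(pq-1)).                                       *)
(* The terms of Gamma come from three lower bounds on G(T/2): G >= c eps from *)
(* the data; V >= c eps T, hence F >= c (eps T)^p T^(-n(p-1)); and            *)
(* F >= c eps^p T^((n-1)(1-p/2)), obtained by testing the equation of v with  *)
(* the plane waves e^(x.w - t). These replace the customary spherical average *)
(* of e^(x.w): finitely many directions w at mutual distance T^(-1/2), taken  *)
(* in one cap of the sphere, already produce the sharp power of T.            *)

(** Two bounds on [forcing], the function G above, compete at half of any time tau below the
    lifespan. From above: one round of the coupling, from u to v and back ([forcing_step]), bounds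
    G(a + 4h) below by a multiple of h^(1+2p) (1 - e^(-h))^(pq) G(a)^(pq). Since pq > 1, repeating
    it on intervals that shrink towards tau would make G infinite at tau, unless G(tau/2) is small
    ([iteration], [saturation_bound]). From below: [forcing_ge_data], [forcing_ge_linear] and
    [forcing_ge_wave]. Each of them, set against the upper bound, gives eps tau^gamma <= C, where
    gamma is one of the three terms of Gamma. [lifespan_bound] collects the three cases. The
    equations enter only through [functional_identity]. The test functions are e^(x.w - ks) with |w|
    = k, truncated outside the light cone; they solve the free wave equation on it, and the weak
    form becomes an integral identity between continuous functions of time. The choice k = 0 gives
    the means, k = 1 the plane waves. The damping b costs the factor exp(-4 int b) ([gronwall],
    [scattering_gronwall]). For the wave bound, [plane_wave_lower] keeps e^(-t) int v e^(x.w) above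
    a multiple of its initial value for every unit vector w. [plane_wave_Lp] turns these linear
    bounds into a bound on int |v|^p: on a ball of radius r in dimension m + 1 one wave has mass of
    order r^(m/2) at most ([ball_plane_wave]), whereas the sum of about r^(m/2) well separated waves
    stays bounded ([sum_plane_wave_le]). *)

Set Implicit Arguments.
Unset Strict Implicit.
Unset Printing Implicit Defensive.

Import Order.TTheory GRing.Theory Num.Theory.
Import numFieldNormedType.Exports.

Local Open Scope classical_set_scope.
Local Open Scope ring_scope.

(** * Smooth elementary functions *)

Section flat.
Context {R : realType}.
Implicit Types (x y : R) (k : nat).

(** The factor x^(-k) makes the family stable: differentiation sends the member k to a combination
    of the members k + 1 and k + 2, so that smoothness of e^(-1/x) at 0 reduces to first
    derivatives. *)
Definition flat k x : R := if 0 < x then x^-1 ^+ k * expR (- x^-1) else 0.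

(** This is the k-th power of y/k <= e^(y/k). *)
Lemma expr_le_expR k y : 0 <= y -> y ^+ k <= k%:R ^+ k * expR y.
Proof.
move=> y0; case: k => [|k]; first by rewrite !expr0 mul1r -expR0 ler_expR.
have -> : expR y = expR (y / k.+1%:R) ^+ k.+1.
  by rewrite -expRM_natl mulrC divfK// pnatr_eq0.
rewrite -exprMn lerXn2r// ?nnegrE// ?mulr_ge0 ?expR_ge0//.
rewrite -ler_pdivrMl ?ltr0n// mulrC.
by apply: le_trans (expR_ge1Dx _); rewrite lerDr.
Qed.

(** The exponential e^(-1/x) beats x^(-k-2); the two spare powers of x make the derivative at 0
    exist and vanish. *)
Lemma flat_quadratic k x : `|flat k x| <= k.+2%:R ^+ k.+2 * x ^+ 2.
Proof.
rewrite /flat; case: ifPn => [x0|_]; last by rewrite normr0 mulr_ge0// sqr_ge0.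
rewrite ger0_norm ?mulr_ge0 ?exprn_ge0 ?invr_ge0 ?expR_ge0 ?(ltW x0)//.
have xk : x^-1 ^+ k = x ^+ 2 * x^-1 ^+ k.+2.
  by rewrite -(addn2 k) exprD mulrCA -exprMn divff ?gt_eqF// expr1n mulr1.
rewrite xk expRN -mulrA [leRHS]mulrC ler_wpM2l ?sqr_ge0// ler_pdivrMr ?expR_gt0//.
by apply: expr_le_expR; rewrite invr_ge0 ltW.
Qed.

Lemma is_derive_quadratic (f : R -> R) C : (forall x, `|f x| <= C * x ^+ 2) ->
  is_derive (0 : R) 1 f 0.
Proof.
move=> fC.
have f0 : f 0 = 0.
  by apply/eqP; rewrite -normr_le0; apply: le_trans (fC 0) _; rewrite expr0n mulr0.
have C0 : 0 <= C by have := le_trans (normr_ge0 _) (fC 1); rewrite expr1n mulr1.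
have cv : h^-1 *: (f (h *: 1 + 0) - f 0) @[h --> 0^'] --> (0 : R).
  apply/cvgr0Pnorm_le => e e0; near=> h.
  rewrite f0 subr0 addr0 [h *: 1]mulr1 normrZ normfV.
  rewrite ler_pdivrMl ?normr_gt0; last by near: h; exact: nbhs_dnbhs_neq.
  apply: le_trans (fC h) _; rewrite -real_normK ?num_real// expr2 mulrCA.
  rewrite ler_wpM2l//.
  have : `|h| <= e / (C + 1).
    near: h; apply: dnbhs0_le; rewrite divr_gt0//; lra.
  rewrite ler_pdivlMr; last lra.
  by move=> he; apply: le_trans he; rewrite mulrDr mulrC mulr1 lerDl.
split; first by apply/cvg_ex; exists 0.
exact: cvg_lim cv.
Unshelve. all: by end_near.
Qed.

Lemma is_derive_flat k x :
  is_derive x 1 (flat k) (flat k.+2 x - k%:R * flat k.+1 x).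
Proof.
have [x0|x0|<-] := ltgtP 0 x.
- have xn0 : x != 0 by rewrite gt_eqF.
  have H : is_derive x 1 (fun y => y^-1 ^+ k * expR (- y^-1))
      (flat k.+2 x - k%:R * flat k.+1 x).
    have Hi : is_derive x 1 (fun y : R => y^-1) (- x ^- 2 *: 1).
      exact: (@is_deriveV R id x 1 1 xn0 (is_derive_id _ _)).
    have He : is_derive x 1 (expR \o (fun y : R => - y^-1))
        (expR (- x^-1) * - (- x ^- 2 *: 1)).
      apply: is_derive1_comp; exact: (@is_deriveN _ _ _ _ x 1 _ Hi).
    have Hx : is_derive x 1 (fun y : R => y^-1 ^+ k)
        ((k%:R * x^-1 ^+ k.-1) *: (- x ^- 2 *: 1)).
      have := @is_deriveX R R (fun y : R => y^-1) k x 1 _ Hi.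
      by rewrite exprfctE.
    apply: (is_derive_eq (is_deriveM Hx He)).
    rewrite /flat x0 /GRing.scale /= -exprVn.
    case: k {Hx} => [|k] /=; rewrite ?exprS ?expr0; ring.
  apply: near_eq_is_derive H.
  by near=> y; rewrite /flat ifT//; near: y; exact: lt_nbhsr.
- have -> : flat k.+2 x - k%:R * flat k.+1 x = 0.
    by rewrite /flat ltNge ltW//= mulr0 subr0.
  apply: (@near_eq_is_derive R R R (cst 0) _ x 1 0 _ (is_derive_cst _ _ _)).
  by near=> y; rewrite /flat ltNge ltW//=; near: y; exact: lt_nbhsl.
- have -> : flat k.+2 0 - k%:R * flat k.+1 0 = 0 :> R.
    by rewrite /flat ltxx mulr0 subr0.
  exact: is_derive_quadratic (flat_quadratic k).
Unshelve. all: by end_near.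
Qed.

Lemma flat0_gt0 x : 0 < x -> 0 < flat 0 x.
Proof. by move=> x0; rewrite /flat x0 expr0 mul1r expR_gt0. Qed.

Lemma flat_ge0 k x : 0 <= flat k x.
Proof.
rewrite /flat; case: ifPn => // x0.
by rewrite mulr_ge0 ?expR_ge0// exprn_ge0// invr_ge0 ltW.
Qed.

Definition smooth_step x := flat 0 x / (flat 0 x + flat 0 (1 - x)).

Lemma smooth_step_den x : 0 < flat 0 x + flat 0 (1 - x).
Proof.
have [x0|x0] := ltP 0 x.
  by rewrite ltr_pwDl ?flat0_gt0 ?flat_ge0.
by rewrite ltr_wpDl ?flat_ge0// flat0_gt0//; lra.
Qed.

Lemma smooth_step_ge0 x : 0 <= smooth_step x.
Proof. by rewrite divr_ge0 ?flat_ge0 ?ltW ?smooth_step_den. Qed.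

Lemma smooth_step_le1 x : smooth_step x <= 1.
Proof.
by rewrite ler_pdivrMr ?smooth_step_den// mul1r lerDl flat_ge0.
Qed.

Lemma smooth_step1 x : 1 <= x -> smooth_step x = 1.
Proof.
move=> x1; have x0 : 0 < x by lra.
rewrite /smooth_step [X in _ + X]/flat ltNge ifN; last by rewrite negbK; lra.
by rewrite addr0 divff// gt_eqF// flat0_gt0.
Qed.

Lemma smooth_step0 x : x <= 0 -> smooth_step x = 0.
Proof. by move=> x0; rewrite /smooth_step {1}/flat ltNge x0/= mul0r. Qed.

End flat.

Section elementary.
Context {R : realType} {V : normedModType R}.
Implicit Types (f g L : V -> R) (v x : V).

(** The linear part enters through the increments h * l v, the form in which directional derivatives
    consume it. *)
Definition affine L := continuous L /\
  exists l : V -> R, forall (h : R) v x, L (h *: v + x) = h * l v + L x.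

(** Generators of all test functions below: [flat] for cutoffs, exponentials for plane waves and
    decay in time, inverses for the denominator of [smooth_step]. *)
Inductive elementary : (V -> R) -> Prop :=
| elem_flat k L : affine L -> elementary (fun x => flat k (L x))
| elem_exp L : affine L -> elementary (fun x => expR (L x))
| elem_cst (a : R) : elementary (fun=> a)
| elem_add f g : elementary f -> elementary g -> elementary (fun x => f x + g x)
| elem_mul f g : elementary f -> elementary g -> elementary (fun x => f x * g x)
| elem_inv f : (forall x, f x != 0) -> elementary f ->
    elementary (fun x => (f x)^-1).

Lemma is_derive_comp_affine (f : R -> R) (df : R) L (l : V -> R) v x :
  (forall (h : R) v x, L (h *: v + x) = h * l v + L x) ->
  is_derive (L x) 1 f df -> is_derive x v (fun y => f (L y)) (l v * df).
Proof.
move=> Ll [dfx <-].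
have dfx' : differentiable f (L x) by apply/derivable1_diffP.
have dv : derivable f (L x) (l v) by apply: diff_derivable.
have e : (fun h : R => h^-1 *: (f (L (h *: v + x)) - f (L x)))
       = (fun h : R => h^-1 *: (f (h *: l v + L x) - f (L x))).
  by apply/funext => h; rewrite Ll.
have -> : l v * 'D_1 f (L x) = 'D_(l v) f (L x).
  by rewrite !deriveE// -[in RHS](mulr1 (l v)) linearZ.
by split; rewrite /derivable /derive e.
Qed.

(* Closure of the class under directional derivatives is what makes its       *)
(* members smooth: no bookkeeping of the iterated derivatives is needed.      *)
Lemma elementary_derive f : elementary f -> forall v, exists2 df,
  elementary df & forall x, is_derive x v f (df x).
Proof.
elim=> [k L aL|L aL|a|f1 g1 _ If _ Ig|f1 g1 ef If eg Ig|f1 f0 ef If] v.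
- have [_ [l Ll]] := aL.
  exists (fun x => l v * (flat k.+2 (L x) + - k%:R * flat k.+1 (L x))).
    apply: elem_mul; first exact: elem_cst.
    apply: elem_add; first exact: elem_flat.
    by apply: elem_mul; [exact: elem_cst|exact: elem_flat].
  by move=> x; apply: is_derive_comp_affine => //; rewrite mulNr; exact: is_derive_flat.
- have [_ [l Ll]] := aL; exists (fun x => l v * expR (L x)).
    by apply: elem_mul; [exact: elem_cst|exact: elem_exp].
  by move=> x; apply: is_derive_comp_affine.
- exists (fun=> 0); first exact: elem_cst.
  by move=> x; exact: is_derive_cst.
- have [[df edf Hf] [dg edg Hg]] := (If v, Ig v).
  exists (fun x => df x + dg x); first exact: elem_add.
  by move=> x; exact: is_deriveD.
- have [[df edf Hf] [dg edg Hg]] := (If v, Ig v).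
  exists (fun x => f1 x * dg x + g1 x * df x).
    by apply: elem_add; exact: elem_mul.
  by move=> x; exact: is_deriveM.
- have [df edf Hf] := If v.
  exists (fun x => (- 1 * ((f1 x)^-1 * (f1 x)^-1)) * df x).
    apply: elem_mul => //; apply: elem_mul; first exact: elem_cst.
    by apply: elem_mul; exact: elem_inv.
  move=> x; have [d1 d2] := Hf x.
  split; first exact: derivableV.
  by rewrite deriveV// d2 /GRing.scale/= mulN1r -invfM expr2.
Qed.

Lemma elementary_continuous f : elementary f -> continuous f.
Proof.
elim=> [k L [cL _]|L [cL _]|a|f1 g1 _ If _ Ig|f1 g1 _ If _ Ig|f1 f0 _ If] x.
- apply: (@continuous_comp _ _ _ L (flat k)); first exact: cL.
  apply: differentiable_continuous; apply/derivable1_diffP.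
  by have [] := is_derive_flat k (L x).
- by apply: (@continuous_comp _ _ _ L expR); [exact: cL|exact: continuous_expR].
- exact: cvg_cst.
- by apply: cvgD; [exact: If|exact: Ig].
- by apply: cvgM; [exact: If|exact: Ig].
- by apply: cvgV; [exact: f0|exact: If].
Qed.

Lemma elementary_smooth f : elementary f -> smooth f.
Proof.
move=> ef s; suff : elementary (iter_derive s f).
  move=> es; split; first exact: elementary_continuous.
  by move=> x v; have [df _ /(_ x)[]] := elementary_derive es v.
elim: s => [//|v s IH] /=.
have [df edf H] := elementary_derive IH v.
suff -> : 'D_v (iter_derive s f) = df by [].
by apply/funext => x; have [_ ->] := H x.
Qed.

Lemma elementary_D f v : elementary f -> elementary ('D_v f).
Proof.
move=> ef; have [df edf H] := elementary_derive ef v.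
suff -> : 'D_v f = df by [].
by apply/funext => x; have [_ ->] := H x.
Qed.

Lemma affine_cst_sub L (a c : R) : affine L -> affine (fun x => a + c * L x).
Proof.
move=> [cL [l Ll]]; split.
  move=> x; apply: cvgD; first exact: cvg_cst.
  by apply: cvgM; [exact: cvg_cst|exact: cL].
by exists (fun v => c * l v) => h v x; rewrite Ll; ring.
Qed.

Lemma elementary_step L : affine L -> elementary (fun x => smooth_step (L x)).
Proof.
move=> aL; have aL1 : affine (fun x => 1 - L x).
  have := affine_cst_sub 1 (-1) aL.
  by under eq_fun do rewrite mulN1r.
apply: elem_mul; first exact: elem_flat.
apply: elem_inv; first by move=> x; rewrite gt_eqF// smooth_step_den.
by apply: elem_add; exact: elem_flat.
Qed.

Lemma elementary_prod (I : Type) (r : seq I) (F : I -> V -> R) :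
  (forall i, elementary (F i)) -> elementary (fun x => \prod_(i <- r) F i x).
Proof.
move=> eF; elim: r => [|i r IH].
  by under eq_fun do rewrite big_nil; exact: elem_cst.
by under eq_fun do rewrite big_cons; exact: elem_mul.
Qed.

End elementary.

(** * Integrals on row vectors *)

Lemma continuous_big_sum (R : realType) (V : topologicalType) (I : Type)
    (s : seq I) (F : I -> V -> R) : (forall i, continuous (F i)) ->
  continuous (fun x => \sum_(i <- s) F i x).
Proof.
move=> cF; elim: s => [|i s IH].
  have -> : (fun x => \sum_(i <- [::]) F i x) = cst 0.
    by apply/funext => y; rewrite big_nil.
  exact: cst_continuous.
have -> : (fun x => \sum_(i <- i :: s) F i x) =
    F i \+ (fun x => \sum_(i <- s) F i x).
  by apply/funext => y; rewrite big_cons.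
by move=> x; apply: continuousD; [exact: cF|exact: IH].
Qed.

Section rV_measure.
Context {R : realType} {n : nat}.
Local Notation Rn := ('rV[R]_n).
Local Notation leb := (lebesgue_rV R n).

Definition cube (c : R) : set Rn := [set x | forall i, `|x ord0 i| <= c].

Lemma cubeE c : cube c = [set x | forall i, `[- c, c]%classic (x ord0 i)].
Proof.
by apply/seteqP; split => x /= cx i; have := cx i; rewrite in_itv /= ler_norml.
Qed.

Lemma measurable_box (A : 'I_n -> set R) : (forall i, measurable (A i)) ->
  measurable [set x : Rn | forall i, A i (x ord0 i)].
Proof.
move=> mA; rewrite [X in measurable X](_ : _ = \bigcap_(i in [set: 'I_n])
    ((fun x : 'rV[R]_n => x ord0 i) @^-1` A i)).
  apply: fin_bigcap_measurable => // i _; rewrite -[X in measurable X]setTI.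
  exact: measurable_coord.
by rewrite predeqE => x; split => [h i _|h i]; [exact: h|exact: (h i)].
Qed.

Lemma measurable_cube c : measurable (cube c).
Proof. by rewrite cubeE; apply: (@measurable_box (fun=> _)) => i; exact: measurable_itv. Qed.

Lemma compact_cube c : compact (cube c).
Proof. by rewrite cubeE; apply: (@rV_compact _ _ (fun=> _)) => i; exact: segment_compact. Qed.

Lemma lebesgue_cube c : 0 <= c -> leb (cube c) = ((2 * c) ^+ n)%:E.
Proof.
move=> c0; rewrite cubeE (@lebesgue_rV_box R n (fun=> `[- c, c]%classic))//.
under eq_bigr do rewrite lebesgue_measure_itv/= lte_fin.
have -> : (if - c < c then (c%:E - (- c)%:E)%E else 0%E) = (2 * c)%:E :> \bar R.
  case: ifPn => [_|]; first by rewrite -EFinB; congr EFin; ring.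
  by rewrite -leNgt => cc; congr EFin; lra.
by rewrite prodEFin prodr_const card_ord.
Qed.

Lemma measurable_affine (L : Rn -> R) : affine L -> measurable_fun setT L.
Proof.
move=> [_ [l Ll]].
have E (s : seq 'I_n) (c : 'I_n -> R) :
    L (\sum_(j <- s) c j *: 'e_j) = \sum_(j <- s) c j * l 'e_j + L 0.
  elim: s => [|j s IH]; first by rewrite !big_nil add0r.
  by rewrite !big_cons Ll IH addrA.
have -> : L = fun x => \sum_(j < n) x ord0 j * l 'e_j + L 0.
  by apply/funext => x; rewrite {1}[x]row_sum_delta E.
apply: measurable_funD => //; apply: measurable_sum => j.
by apply: measurable_funM => //; exact: measurable_coord.
Qed.

Lemma measurable_invr d (T : measurableType d) (f : T -> R) :
  measurable_fun setT f -> measurable_fun setT (fun x => (f x)^-1).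
Proof.
move=> mf.
(* A real power of f^2 is measurable by composition; where f vanishes both sides are 0. *)
have -> : (fun x => (f x)^-1) = (fun x => f x * (f x ^+ 2) `^ (-1)).
  apply/funext => x; rewrite powR_inv1 ?sqr_ge0//.
  have [->|fx0] := eqVneq (f x) 0; first by rewrite invr0 mul0r.
  by rewrite expr2 invfM mulrA divff// mul1r.
apply: measurable_funM => //.
apply: (measurableT_comp (measurable_powR (-1))).
exact: measurable_funX.
Qed.

(** The sigma-algebra on row vectors is generated by the coordinates, so the proof goes by induction
    on the class, down to affine functions, which are combinations of coordinates. *)
Lemma elementary_measurable (f : Rn -> R) : elementary f -> measurable_fun setT f.
Proof.
elim=> [k L aL|L aL|a|f1 g1 _ If _ Ig|f1 g1 _ If _ Ig|f1 f0 _ If] //.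
- apply: (measurableT_comp _ (measurable_affine aL)).
  apply: continuous_measurable_fun => x; apply: differentiable_continuous.
  by apply/derivable1_diffP; have [] := is_derive_flat k x.
- exact: (measurableT_comp (@measurable_expR R) (measurable_affine aL)).
- exact: measurable_funD.
- exact: measurable_funM.
- exact: measurable_invr.
Qed.

Lemma compact_continuous_bounded (K : set Rn) (g : Rn -> R) : compact K -> continuous g ->
  exists2 C, 0 <= C & forall x, K x -> `|g x| <= C.
Proof.
move=> cK cg.
have := @continuous_compact _ _ g K _ cK.
move=> /(_ _)/compact_bounded [] .
  by apply: continuous_subspaceT.
move=> M [Mr H]; exists (`|M| + 1) => [|x Kx]; first by rewrite addr_ge0.
apply: H; last by exists x.
by rewrite (le_lt_trans (ler_norm _))// ltrDl.
Qed.

Section pairing.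
Variables (c C : R) (g : Rn -> R).
Hypotheses (mg : measurable_fun setT g) (gC : forall x, `|g x| <= C)
  (g0 : forall x, ~ cube c x -> g x = 0).

Definition L1cube (f : Rn -> R) :=
  measurable_fun [set: Rn] f /\ leb.-integrable (cube c) (EFin \o f).

Lemma L1loc_cube f : L1loc f -> L1cube f.
Proof. by move=> [mf If]; split => //; exact/If/compact_cube. Qed.

Lemma measurable_fun_norm (A : set Rn) (f : Rn -> R) : measurable_fun setT f ->
  measurable_fun A (fun x => `|f x|%:E).
Proof.
move=> mf; apply/measurable_EFinP.
apply: (measurableT_comp (@normr_measurable R setT)).
exact: measurable_funTS.
Qed.

Lemma integrable_pairing f : L1cube f ->
  leb.-integrable setT (EFin \o (fun x => f x * g x)).
Proof.
move=> [mf If].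
have H : leb.-integrable (cube c) ((EFin \o g) \* (EFin \o f))%E.
  apply: integrableMr; first exact: measurable_cube.
  - exact: measurable_funTS.
  - exists C; split; first exact: num_real.
    by move=> M CM x _ /=; apply: le_trans (gC x) _; exact: ltW.
  - exact: If.
move/(integrable_mkcond _ (measurable_cube c)) : H.
apply: eq_integrable => // x _; rewrite patchE /=.
case: ifPn => [_|/negP cx]; first by rewrite -EFinM mulrC.
by rewrite g0 ?mulr0// => /mem_set.
Qed.

Lemma le_pairing f : L1cube f ->
  (`|\int[leb]_x (f x * g x)|%:E <= C%:E * \int[leb]_(x in cube c) `|f x|%:E)%E.
Proof.
move=> lf; have C0 : 0 <= C by apply: le_trans (gC 0).
rewrite -ge0_integralZl//; [|exact: measurable_cube|by apply: measurable_fun_norm; case: lf].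
have ifg := integrable_pairing lf.
rewrite -abse_EFin /Rintegral fineK; last exact: integrable_fin_num.
apply: le_trans (le_abse_integral _ _ _) _ => //; first by case/integrableP: ifg.
rewrite [leRHS]integral_mkcond; apply: ge0_le_integral.
- exact: measurableT.
- by move=> x _; exact: abse_ge0.
- by apply: measurableT_comp => //; case/integrableP: ifg.
- apply: (measurable_restrictT _ (measurable_cube c)).1.
  by apply: measurable_funeM; apply: measurable_fun_norm; case: lf.
move=> x _; rewrite patchE /=; case: ifPn => [_|/negP cx].
  by rewrite -EFinM lee_fin normrM mulrC ler_wpM2r.
by rewrite g0 ?mulr0 ?normr0// => /mem_set.
Qed.

Lemma L1cubeB f h : L1cube f -> L1cube h -> L1cube (fun x => f x - h x).
Proof.
move=> [mf If] [mh Ih]; split; first exact: measurable_funB.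
exact: (integrableB (measurable_cube c) If Ih).
Qed.

(** Pairing with a bounded weight carried by a cube is Lipschitz for the L^1 norm on that cube
    ([le_pairing]). In this way continuity and differentiability with values in L^1_loc become
    statements on scalar functions of time. *)
Lemma cvg_pairing (F : set_system R) (FF : Filter F) f h :
  (\forall t \near F, L1cube (f t)) -> L1cube h -> cvg_L1loc F f h ->
  \int[leb]_x (f t x * g x) @[t --> F] --> \int[leb]_x (h x * g x).
Proof.
move=> lf lh /(_ _ (@compact_cube c))/fine_cvgP[ffin fcv].
have C0 : 0 <= C by apply: le_trans (gC 0).
apply/cvgrPdist_le => e e0.
have eC : 0 < e / (C + 1) by rewrite divr_gt0//; lra.
near=> t.
have lft : L1cube (f t) by near: t.
rewrite distrC -RintegralB//; [|exact: integrable_pairing..].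
under eq_Rintegral do rewrite -mulrBl.
rewrite -lee_fin; apply: le_trans (le_pairing (L1cubeB lft lh)) _.
have fint : (\int[leb]_(x in cube c) `|f t x - h x|%:E)%E \is a fin_num by near: t.
rewrite -(fineK fint) -EFinM lee_fin.
have H : fine (\int[leb]_(x in cube c) `|f t x - h x|%:E)%E < e / (C + 1).
  by near: t; apply: (cvgr_lt _ fcv).
apply: le_trans (_ : C * (e / (C + 1)) <= _); first by rewrite ler_wpM2l// ltW.
rewrite mulrCA ler_piMr ?(ltW e0)// ler_pdivrMr; lra.
Unshelve. all: by end_near.
Qed.

End pairing.

Definition enorm (x : Rn) : R := Num.sqrt (\sum_(i < n) x ord0 i ^+ 2).

Lemma continuous_enorm : continuous enorm.
Proof.
move=> x; apply: (@continuous_comp _ _ _ (fun x : Rn => \sum_(i < n) x ord0 i ^+ 2) Num.sqrt);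
  last exact: sqrt_continuous.
apply: continuous_big_sum => i y; under eq_fun do rewrite expr2.
by apply: continuousM; exact: coord_continuous.
Qed.

Lemma coord_le_enorm (x : Rn) i : `|x ord0 i| <= enorm x.
Proof.
rewrite -sqrtr_sqr ler_wsqrtr// (bigD1 i)//= lerDl.
by apply: sumr_ge0 => j _; exact: sqr_ge0.
Qed.

Lemma eball_cube r : eball r `<=` cube r.
Proof. by move=> x xr i; exact: le_trans (coord_le_enorm x i) xr. Qed.

Lemma measurable_enorm : measurable_fun setT enorm.
Proof.
have m : measurable_fun setT (fun x : Rn => \sum_(i < n) x ord0 i ^+ 2).
  by apply: measurable_sum => i; apply: measurable_funX; exact: measurable_coord.
apply: (measurableT_comp _ m); apply: continuous_measurable_fun.
exact: sqrt_continuous.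
Qed.

Lemma measurable_eball r : measurable (eball r : set Rn).
Proof.
have := measurable_enorm measurableT (measurable_itv `]-oo, r]).
rewrite setTI; congr (measurable _); apply/seteqP; split => x /=; by rewrite in_itv.
Qed.

(* Compact exhaustion of the complement of the ball replaces the Lindelof     *)
(* property in passing from open null sets to their union.                    *)
Lemma ess_supp_ae {W : nmodType} (f : Rn -> W) r : ess_supp f `<=` eball r ->
  {ae leb, forall x, ~ eball r x -> f x = 0}.
Proof.
move=> sf; pose K (j : nat) : set Rn := cube j%:R `&` [set x | r + j.+1%:R^-1 <= enorm x].
have cK j : compact (K j).
  apply: compact_closedI; first exact: compact_cube.
  apply: (@preimage_closed _ _ enorm [set y | r + j.+1%:R^-1 <= y]).
    by move=> x _; exact: continuous_enorm.
  exact: closed_ge.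
have nK j : leb.-negligible [set x | K j x /\ f x <> 0].
  have := cK j; rewrite compact_cover.
  move=> /(_ _ [set U | open U /\ {ae leb, forall x, U x -> f x = 0}] id)[].
  - by move=> U [].
  - move=> x [_ xr]; apply: contrapT => nx.
    have : eball r x by apply: sf => -[U HU Ux]; apply: nx; exists U.
    rewrite /eball/= -/(enorm x) => xr'.
    have := le_trans xr xr'; rewrite gerDl leNgt invr_gt0 ltr0n//.
  move=> D sD KD.
  have H : leb.-negligible (\bigcup_(U in [set` D]) [set x | U x /\ f x <> 0]).
    rewrite bigcup_fset big_seq; apply: (big_ind (fun A => leb.-negligible A)).
    - exact: negligible_set0.
    - by move=> A B; exact: negligibleU.
    move=> U /sD/set_mem[_]; apply: negligibleS => x [Ux fx] /=.
    by move=> /(_ Ux).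
  apply: negligibleS H => x [/KD[U UD Ux] fx]; by exists U.
apply: negligibleS (negligible_bigcup nK) => x /= /not_implyP[xr fx].
have rx : r < enorm x by rewrite ltNge; apply/negP.
have [j jr] : exists j : nat, r + j.+1%:R^-1 <= enorm x /\ enorm x <= j%:R.
  have e0 : 0 < enorm x - r by rewrite subr_gt0.
  near \oo => j; exists j; split; last by near: j; exact: nbhs_infty_ger.
  rewrite -lerBrDl; apply/ltW; near: j.
  exact: (near_infty_natSinv_lt (PosNum e0)).
exists j => //; split => //; split; last by case: jr.
by move=> i; apply: le_trans (coord_le_enorm x i) _; case: jr.
Unshelve. all: by end_near.
Qed.

End rV_measure.

(** * Gaussian estimates on balls *)

Section gaussian.
Context {R : realType}.

(** Tonelli, since the measure in dimension n + 1 is the image of a product measure. *)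
Lemma integral_cons_rV n (F : 'rV[R]_n.+1 -> \bar R) :
  measurable_fun setT F -> (forall x, (0 <= F x)%E) ->
  (\int[lebesgue_rV R n.+1]_x F x =
   \int[lebesgue_rV R n]_v \int[lebesgue_measure]_a F (cons_rV (a, v)))%E.
Proof.
move=> mF F0.
have mcons := @measurable_cons_rV R n.
have mFc : measurable_fun setT (F \o @cons_rV R n) by exact: measurableT_comp.
transitivity (\int[lebesgue_measure \x lebesgue_rV R n]_z (F (@cons_rV R n z)))%E.
  by apply: (ge0_integral_pushforward mcons _ measurableT mF) => x _.
by rewrite fubini_tonelli2.
Qed.

Lemma integral_prod_rV n (f : 'I_n -> R -> R) :
  (forall i, measurable_fun setT (f i)) -> (forall i t, 0 <= f i t) ->
  (\int[lebesgue_rV R n]_x (\prod_(i < n) f i (x ord0 i))%:E =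
   \prod_(i < n) \int[lebesgue_measure]_t (f i t)%:E)%E.
Proof.
elim: n f => [|n IH] f mf f0.
  rewrite big_ord0; under eq_integral do rewrite big_ord0.
  by rewrite integral_cst//= diracE mem_set// mul1e.
have mprod k (g : 'I_k -> R -> R) : (forall i, measurable_fun setT (g i)) ->
    measurable_fun setT (fun x : 'rV[R]_k => \prod_(i < k) g i (x ord0 i)).
  move=> mg; apply: measurable_prod => i _.
  exact: (measurableT_comp (mg i) (@measurable_coord R k i)).
rewrite integral_cons_rV; last 2 first.
- by apply/measurable_EFinP; exact: mprod.
- by move=> x; rewrite lee_fin prodr_ge0.
have E v : (\int[lebesgue_measure]_a
      (\prod_(i < n.+1) f i ((cons_rV (a, v)) ord0 i))%:E =
    (\prod_(i < n) f (lift ord0 i) (v ord0 i))%:E *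
    \int[lebesgue_measure]_a (f ord0 a)%:E)%E.
  rewrite -ge0_integralZl//; last 3 first.
  - by apply/measurable_EFinP; exact: mf.
  - by move=> x _; rewrite lee_fin.
  - by rewrite lee_fin prodr_ge0.
  apply: eq_integral => a _; rewrite -EFinM big_ord_recl mulrC; congr (_ * _)%:E.
    by apply: eq_bigr => i _; rewrite !mxE liftK.
  by rewrite mxE unlift_none.
under eq_integral do rewrite E muleC.
rewrite ge0_integralZl//; last 3 first.
- by apply/measurable_EFinP; apply: (mprod n (fun i => f (lift ord0 i))).
- by move=> x _; rewrite lee_fin prodr_ge0.
- by apply: integral_ge0 => x _; rewrite lee_fin.
by rewrite (IH (fun i => f (lift ord0 i)))// big_ord_recl.
Qed.

Lemma integral_normal_fun (a s : R) : s != 0 ->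
  (\int[lebesgue_measure]_x (normal_fun a s x)%:E = ((normal_peak s)^-1)%:E)%E.
Proof.
move=> s0; have p0 := normal_peak_gt0 s0.
have := integral_normal_pdf a s; rewrite normal_pdfE//.
under eq_integral do rewrite EFinM.
rewrite ge0_integralZl//; last 3 first.
- by apply/measurable_EFinP; exact: measurable_normal_fun.
- by move=> x _; rewrite lee_fin expR_ge0.
- by rewrite lee_fin ltW.
move=> H; rewrite -[RHS]mule1 -H muleA -EFinM mulVf ?gt_eqF// mul1e//.
Qed.

Lemma integral_exp_itv_le (c lo A : R) : 0 < c ->
  (\int[lebesgue_measure]_(a in `[lo, A]) (expR (c * (a - A)))%:E <= (c^-1)%:E)%E.
Proof.
move=> c0; have [loA|Alo] := ltP lo A; last first.
  have -> : (\int[lebesgue_measure]_(a in `[lo, A]) (expR (c * (a - A)))%:E = 0)%E.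
    move: Alo; rewrite le_eqVlt => /predU1P[->|Alo].
      by rewrite set_itv1 integral_set1.
    by rewrite set_itv_ge ?integral_set0// bnd_simp -ltNge.
  by rewrite lee_fin invr_ge0 ltW.
have dF x : is_derive x (1 : R) (fun a : R => c^-1 * expR (c * (a - A)))
    (expR (c * (x - A))).
  have He : is_derive x (1 : R) (expR \o (fun a : R => c * (a - A)))
      (expR (c * (x - A)) * c).
    apply: is_derive1_comp.
    have -> : (fun a : R => c * (a - A)) = c \*: (id - cst A) by [].
    by apply: is_derive_eq; rewrite subr0 /GRing.scale /= mulr1.
  have := @is_deriveZ _ _ _ _ c^-1 x 1 _ He.
  by move=> /is_derive_eq; apply; rewrite /GRing.scale/= mulrCA mulVf ?mulr1 ?gt_eqF.
have cF : continuous (fun a : R => c^-1 * expR (c * (a - A))).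
  move=> x; apply: differentiable_continuous; apply/derivable1_diffP.
  by have [] := dF x.
rewrite (@continuous_FTC2 _ _ (fun a => c^-1 * expR (c * (a - A))))//.
- by rewrite -EFinB lee_fin subrr mulr0 expR0 mulr1 lerBlDr lerDl
    mulr_ge0 ?expR_ge0 ?invr_ge0 ?(ltW c0).
- apply: continuous_subspaceT => x.
  apply: (@continuous_comp _ _ _ (fun a : R => c * (a - A)) expR);
    last exact: continuous_expR.
  by apply: cvgM; [exact: cvg_cst|apply: cvgB; [exact: cvg_id|exact: cvg_cst]].
- split; first by move=> x _; have [] := dF x.
    by apply: cvg_at_right_filter; exact: cF.
  by apply: cvg_at_left_filter; exact: cF.
- by move=> x _; rewrite derive1E; have [_ ->] := dF x.
Qed.

Definition dotr n (x w : 'rV[R]_n) : R := \sum_(i < n) x ord0 i * w ord0 i.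

(* Expand |x - r w|^2 <= 2 r (r - x.w).                                       *)
Lemma dotr_le_gauss n (x w : 'rV[R]_n) r : 0 < r -> enorm x <= r ->
  \sum_(i < n) w ord0 i ^+ 2 = 1 ->
  dotr x w <= r - (\sum_(i < n) (x ord0 i - r * w ord0 i) ^+ 2) / (2 * r).
Proof.
move=> r0 xr w1.
have x2 : \sum_(i < n) x ord0 i ^+ 2 <= r ^+ 2.
  rewrite -(@sqr_sqrtr _ (\sum_(i < n) x ord0 i ^+ 2)); last first.
    by apply: sumr_ge0 => i _; exact: sqr_ge0.
  by rewrite lerXn2r// nnegrE ?sqrtr_ge0// ltW.
have -> : \sum_(i < n) (x ord0 i - r * w ord0 i) ^+ 2 =
    \sum_(i < n) x ord0 i ^+ 2 - 2 * r * dotr x w + r ^+ 2.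
  have -> : r ^+ 2 = r ^+ 2 * \sum_(i < n) w ord0 i ^+ 2 by rewrite w1 mulr1.
  rewrite /dotr !mulr_sumr -sumrB -big_split/=.
  by apply: eq_bigr => i _; ring.
have r2 : 0 < 2 * r by lra.
rewrite lerBrDr -lerBrDl ler_pdivrMr//.
apply: le_trans (_ : r ^+ 2 - 2 * r * dotr x w + r ^+ 2 <= _).
  by rewrite lerD2r lerD2r.
by rewrite le_eqVlt; apply/orP; left; apply/eqP; ring.
Qed.

(** The wave concentrates near the point r w of the sphere: by [dotr_le_gauss] it decays like a
    Gaussian of width sqrt r in the last m coordinates, and it decays exponentially in the first
    one, at a rate kept away from 0 by the lower bound on the first entry of w. The total mass is of
    order r^(m/2). *)
Lemma ball_plane_wave m (w : 'rV[R]_m.+1) r : 0 < r ->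
  \sum_(i < m.+1) w ord0 i ^+ 2 = 1 -> 2^-1 <= w ord0 ord0 ->
  (\int[lebesgue_rV R m.+1]_x (\1_(eball r) x * expR (dotr x w - r))%:E <=
   (4 * ((normal_peak (Num.sqrt (2 * r)))^-1) ^+ m)%:E)%E.
Proof.
move=> r0 w1 w0.
pose s := Num.sqrt (2 * r).
have s2 : s ^+ 2 = 2 * r by rewrite sqr_sqrtr//; lra.
have sn0 : s != 0 by rewrite sqrtr_eq0 -ltNge; lra.
have w0p : 0 < w ord0 ord0 by apply: lt_le_trans w0; rewrite invr_gt0.
pose G (v : 'rV[R]_m) := \prod_(i < m) normal_fun (r * w ord0 (lift ord0 i)) s (v ord0 i).
(* A v is the first coordinate at which x.w = r, given the other coordinates v. *)
pose A (v : 'rV[R]_m) := (r - \sum_(i < m) v ord0 i * w ord0 (lift ord0 i)) / w ord0 ord0.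
have G0 v : 0 <= G v by apply: prodr_ge0 => i _; exact: expR_ge0.
have mG : measurable_fun setT G.
  apply: measurable_prod => i _.
  apply: (measurableT_comp _ (@measurable_coord R m i)).
  exact: measurable_normal_fun.
have mF : measurable_fun setT
    (fun x : 'rV[R]_m.+1 => (\1_(eball r) x * expR (dotr x w - r))%:E).
  apply/measurable_EFinP; apply: measurable_funM.
    by apply: measurable_indic; exact: measurable_eball.
  apply: measurableT_comp => //; apply: measurable_funB => //.
  by apply: measurable_sum => i; apply: measurable_funM => //; exact: measurable_coord.
have F0 (x : 'rV[R]_m.+1) : (0 <= (\1_(eball r) x * expR (dotr x w - r))%:E)%E.
  by rewrite lee_fin mulr_ge0 ?expR_ge0.
rewrite integral_cons_rV//.
apply: (@le_trans _ _ (\int[lebesgue_rV R m]_v (4 * G v)%:E)%E); last first.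
  under eq_integral do rewrite EFinM.
  rewrite ge0_integralZl//; last 2 first.
  - by apply/measurable_EFinP.
  - by move=> x _; rewrite lee_fin.
  rewrite (integral_prod_rV (f := fun i => normal_fun (r * w ord0 (lift ord0 i)) s)).
  - under eq_bigr do rewrite integral_normal_fun//.
    by rewrite prodEFin prodr_const card_ord.
  - by move=> i; exact: measurable_normal_fun.
  - by move=> i t; exact: expR_ge0.
apply: ge0_le_integral => //.
- by move=> v _; apply: integral_ge0.
- have mFc := measurableT_comp mF (@measurable_cons_rV R m).
  exact: (measurable_fun_fubini_tonelli_G _ mFc (fun z => F0 _)).
- by apply/measurable_EFinP; apply: measurable_funM.
move=> v _.
(* Half of the exponent gives the Gaussian in the last m coordinates, the     *)
(* other half the decay in the first one.                                     *)
have key a : \1_(eball r) (cons_rV (a, v)) * expR (dotr (cons_rV (a, v)) w - r) <=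
    G v * (expR (w ord0 ord0 / 2 * (a - A v)) * \1_(`[- r, A v]%classic) a).
  rewrite indicE; case: (boolP (_ \in _)) => [/set_mem xr|_]; last first.
    by rewrite mul0r mulr_ge0// mulr_ge0 ?expR_ge0.
  have ar : - r <= a.
    have := le_trans (coord_le_enorm (cons_rV (a, v)) ord0) xr.
    by rewrite mxE unlift_none /= ler_norml => /andP[].
  have dE : dotr (cons_rV (a, v)) w - r = w ord0 ord0 * (a - A v).
    rewrite /dotr big_ord_recl mxE unlift_none /= mulrBr /A mulrC.
    rewrite [w ord0 ord0 * (_ / _)]mulrCA divff ?mulr1 ?gt_eqF// opprB addrA; congr (_ + _ - _).
    by apply: eq_bigr => i _; rewrite mxE liftK.
  have := dotr_le_gauss r0 xr w1; rewrite big_ord_recl.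
  set S := \sum_(i < m) _ => dS.
  have S0 : 0 <= S by apply: sumr_ge0 => i _; exact: sqr_ge0.
  have d1 : dotr (cons_rV (a, v)) w - r <= - (S / (2 * r)).
    rewrite lerBlDl; apply: le_trans dS _; rewrite lerD2l lerN2.
    by rewrite ler_pM2r ?lerDr ?sqr_ge0// invr_gt0; lra.
  have aA : a <= A v.
    rewrite -subr_le0 -(pmulr_rle0 _ w0p) -dE; apply: le_trans d1 _.
    by rewrite oppr_le0 divr_ge0//; lra.
  rewrite indicE mem_set ?mulr1 ?mul1r; last by rewrite /= in_itv/= ar.
  have -> : G v = expR (- (S / (4 * r))).
    rewrite /G /normal_fun -expR_sum; congr expR.
    rewrite /S mulr_suml -sumrN; apply: eq_bigr => i _.
    by rewrite mxE liftK /= s2; field; rewrite gt_eqF.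
  rewrite -expRD ler_expR dE in d1 *.
  have -> : S / (4 * r) = S / (2 * r) / 2 by field; rewrite gt_eqF.
  lra.
have mk : measurable_fun setT
    (fun a : R => expR (w ord0 ord0 / 2 * (a - A v)) * \1_(`[- r, A v]%classic) a).
  apply: measurable_funM => //; apply: measurableT_comp => //.
  by apply: measurable_funM => //; apply: measurable_funB.
apply: (@le_trans _ _ (\int[lebesgue_measure]_a ((G v)%:E * (expR (w ord0 ord0 / 2 * (a - A v)) *
    \1_(`[- r, A v]%classic) a)%:E))%E).
  apply: ge0_le_integral => //.
  - apply: (measurableT_comp mF).
    apply: (measurableT_comp (@measurable_cons_rV R m)).
    exact: pair2_measurable.
  - by apply/measurable_EFinP; exact: measurable_funM.
  - by move=> a _; rewrite -EFinM lee_fin key.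
rewrite ge0_integralZl//; last 2 first.
- by apply/measurable_EFinP.
- by rewrite lee_fin G0.
rewrite [4 * _]mulrC EFinM; apply: lee_wpmul2l; first by rewrite lee_fin G0.
have c0 : 0 < w ord0 ord0 / 2 by rewrite divr_gt0.
have -> : (\int[lebesgue_measure]_a
    (expR (w ord0 ord0 / 2 * (a - A v)) * \1_(`[- r, A v]%classic) a)%:E =
  \int[lebesgue_measure]_(a in `[(- r)%R, A v]) (expR (w ord0 ord0 / 2 * (a - A v)))%:E)%E.
  rewrite [RHS]integral_mkcond; apply: eq_integral => a _.
  by rewrite patchE indicE; case: ifP; rewrite ?mulr1 ?mulr0.
apply: le_trans (integral_exp_itv_le _ _ c0) _; rewrite lee_fin.
by rewrite -[leRHS]invrK lef_pV2 ?posrE ?invr_gt0//; lra.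
Qed.

End gaussian.

(** * Jensen's inequality and sums of plane waves *)

Section grid.
Context {R : realType}.

Lemma integrable_mulrl d (T : measurableType d) (mu : {measure set T -> \bar R})
    (D : set T) (f : T -> R) (k : R) : measurable D ->
  mu.-integrable D (EFin \o f) -> mu.-integrable D (EFin \o (fun x => k * f x)).
Proof. by move=> mD /(integrableZl mD k). Qed.

Lemma expRN1_le_half : expR (- 1) <= 2^-1 :> R.
Proof.
rewrite expRN lef_pV2 ?posrE ?expR_gt0//.
by apply: le_trans (expR_ge1Dx _); lra.
Qed.

Lemma Rintegral_sum d (T : measurableType d) (mu : {measure set T -> \bar R})
    (D : set T) (I : Type) (s : seq I) (F : I -> T -> R) : measurable D ->
  (forall i, mu.-integrable D (EFin \o F i)) ->
  mu.-integrable D (EFin \o (fun x => \sum_(i <- s) F i x)) /\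
  \int[mu]_(x in D) (\sum_(i <- s) F i x) = \sum_(i <- s) \int[mu]_(x in D) F i x.
Proof.
move=> mD iF; elim: s => [|i s [IH1 IH2]].
  have -> : (fun x => \sum_(i <- [::]) F i x) = cst 0.
    by apply/funext => x; rewrite big_nil.
  rewrite big_nil Rintegral_cst// mul0r; split => //.
  exact: integrable0.
have -> : (fun x => \sum_(i <- i :: s) F i x) =
    (fun x => F i x + \sum_(i <- s) F i x).
  by apply/funext => x; rewrite big_cons.
by rewrite big_cons RintegralD// IH2; split => //; exact: (integrableD mD (iF i) IH1).
Qed.

(** The induction shifts a by one, and the two branches make it close: for a <= 0 the sum is
    geometric; for a > 0 the correction - e^(-a) leaves room for the next summand. *)
Lemma sum_expN_le N (a : R) :
  \sum_(k < N) expR (- `|a - k%:R|) <= if a <= 0 then 2 * expR a else 4 - expR (- a).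
Proof.
have e1 := expRN1_le_half.
elim: N a => [|N IH] a.
  rewrite big_ord0; case: ifPn => a0; first by rewrite mulr_ge0 ?expR_ge0.
  rewrite subr_ge0; apply: (@le_trans _ _ 1); last lra.
  by rewrite -[leRHS]expR0 ler_expR oppr_le0; apply/ltW; rewrite ltNge.
rewrite big_ord_recl subr0.
have -> : \sum_(i < N) expR (- `|a - (lift ord0 i)%:R|) =
    \sum_(i < N) expR (- `|(a - 1) - i%:R|).
  by apply: eq_bigr => i _; rewrite /= /bump leq0n natrD opprD addrA.
have := IH (a - 1); set S := \sum_(i < N) _.
case: ifPn => a1; case: ifPn => a0.
- rewrite ler0_norm// opprK expRD => H.
  have := ler_wpM2l (expR_ge0 a) e1; nra.
- move=> H; have : expR (a - 1) <= 1 by rewrite -[leRHS]expR0 ler_expR.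
  have : expR (- `|a|) <= 1 by rewrite -[leRHS]expR0 ler_expR oppr_le0.
  have : expR (- a) <= 1 by rewrite -[leRHS]expR0 ler_expR oppr_le0; lra.
  by lra.
- by move: a1; rewrite -ltNge => ?; lra.
- move: a1; rewrite -ltNge => a1; rewrite gtr0_norm; last lra.
  rewrite opprB => H.
  have : 2 * expR (- a) <= expR (1 - a).
    have -> : expR (1 - a) = expR 1 * expR (- a) by rewrite -expRD.
    by rewrite ler_wpM2r ?expR_ge0//; apply: le_trans (expR_ge1Dx _); lra.
  by lra.
Qed.

(** Since y^2 / 2 >= |y| - 1/2, the Gaussian sum is controlled by the exponential one. *)
Lemma sum_gauss_le N (a : R) :
  \sum_(k < N) expR (- ((a - k%:R) ^+ 2 / 2)) <= 4 * expR 2^-1.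
Proof.
apply: (@le_trans _ _ (\sum_(k < N) expR (- `|a - k%:R|) * expR 2^-1)).
  apply: ler_sum => k _; rewrite -expRD ler_expR.
  have := sqr_ge0 (`|a - k%:R| - 1); rewrite sqrrB1 real_normK ?num_real//; lra.
rewrite -mulr_suml ler_wpM2r ?expR_ge0//.
apply: le_trans (sum_expN_le N a) _.
case: ifPn => a0; last by rewrite lerBlDr lerDl expR_ge0.
have : expR a <= 1 by rewrite -[leRHS]expR0 ler_expR.
by lra.
Qed.

(** Young's inequality for x and a^(p-1) with the conjugate exponents p and p/(p-1). *)
Lemma powR_tangent (p x a : R) : 1 < p -> 0 <= x -> 0 < a ->
  p * a `^ (p - 1) * x - (p - 1) * a `^ p <= x `^ p.
Proof.
move=> p1 x0 a0; have p0 : 0 < p by lra.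
have := @conjugate_powR R x (a `^ (p - 1)) p (p / (p - 1)) x0 (powR_ge0 _ _).
have q0 : 0 < p / (p - 1) by rewrite divr_gt0//; lra.
move=> /(_ p0 q0).
have pn1 : p - 1 != 0 by rewrite gt_eqF; lra.
have -> : p^-1 + (p / (p - 1))^-1 = 1 by field; rewrite pn1 gt_eqF.
move=> /(_ erefl); rewrite -powRrM.
have -> : (p - 1) * (p / (p - 1)) = p by field.
have -> : a `^ p / (p / (p - 1)) = a `^ p * (p - 1) / p by field; rewrite pn1 gt_eqF.
rewrite -mulrDl ler_pdivlMr// => H.
have <- : x * a `^ (p - 1) * p = p * a `^ (p - 1) * x by ring.
by rewrite lerBlDr [(p - 1) * _]mulrC.
Qed.

(* The tangent line of [x `^ p] at [A / W] is integrated against [w].         *)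
Lemma jensen_powR d (T : measurableType d) (mu : {measure set T -> \bar R})
    (D : set T) (f w : T -> R) (p A W : R) : measurable D -> 1 < p ->
  (forall x, D x -> 0 <= w x) ->
  mu.-integrable D (EFin \o w) ->
  mu.-integrable D (EFin \o (fun x => `|f x| * w x)) ->
  mu.-integrable D (EFin \o (fun x => `|f x| `^ p * w x)) ->
  0 < W -> \int[mu]_(x in D) w x <= W ->
  0 <= A -> A <= \int[mu]_(x in D) (`|f x| * w x) ->
  A `^ p <= W `^ (p - 1) * \int[mu]_(x in D) (`|f x| `^ p * w x).
Proof.
move=> mD p1 w0 iw ifw ifpw W0 wW; rewrite le_eqVlt => /predU1P[<-|A0] AI.
  rewrite powR0 ?gt_eqF//; last lra.
  rewrite mulr_ge0 ?powR_ge0// Rintegral_ge0// => x Dx.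
  by rewrite mulr_ge0 ?powR_ge0// w0.
pose a := A / W; have a0 : 0 < a by rewrite divr_gt0.
have ap : a `^ p = a `^ (p - 1) * a.
  by rewrite -{3}[a]powRr1 ?(ltW a0)// -powRD ?(gt_eqF a0) ?implybT// subrK.
have : \int[mu]_(x in D) (p * a `^ (p - 1) * (`|f x| * w x) - (p - 1) * a `^ p * w x)
    <= \int[mu]_(x in D) (`|f x| `^ p * w x).
  apply: le_Rintegral => //.
    by apply: (@integrableB _ _ _ mu D mD
      (EFin \o (fun x => p * a `^ (p - 1) * (`|f x| * w x)))
      (EFin \o (fun x => (p - 1) * a `^ p * w x)));
      apply: integrable_mulrl.
  move=> x Dx; rewrite [p * _ * (_ * _)]mulrA -mulrBl ler_wpM2r ?w0//.
  exact: powR_tangent.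
rewrite RintegralB//; [|exact: integrable_mulrl..].
rewrite !RintegralZl// => H.
have ap0 : 0 < a `^ (p - 1) by rewrite powR_gt0.
have : a `^ (p - 1) * A <= \int[mu]_(x in D) (`|f x| `^ p * w x).
  apply: le_trans H.
  have H1 : p * a `^ (p - 1) * A <= p * a `^ (p - 1) * \int[mu]_(x in D) (`|f x| * w x).
    by rewrite ler_wpM2l// mulr_ge0 ?(ltW ap0)//; lra.
  have H2 : (p - 1) * a `^ p * \int[mu]_(x in D) w x <= (p - 1) * a `^ p * W.
    by rewrite ler_wpM2l// mulr_ge0 ?powR_ge0//; lra.
  have H3 : (p - 1) * a `^ p * W = (p - 1) * a `^ (p - 1) * A.
    by rewrite ap /a -!mulrA mulVf ?mulr1 ?gt_eqF.
  rewrite H3 in H2; lra.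
move=> /(ler_wpM2l (powR_ge0 W (p - 1))); apply: le_trans.
rewrite mulrA -powRM ?(ltW W0) ?(ltW a0)// /a mulrCA divff ?gt_eqF// mulr1.
by rewrite -{3}[A]powRr1 ?(ltW A0)// -powRD ?(gt_eqF A0) ?implybT// subrK.
Qed.

End grid.

(** * Plane waves over a grid of directions *)

Section plane_waves.
Context {R : realType} (m : nat).
Local Notation leb := (lebesgue_rV R m.+1).

(** Points of the unit sphere whose last m coordinates run over a grid of step 1/s. With s = sqrt r
    this step is the angular width of a cap. *)
Definition grid_dir (s : R) N (k : {ffun 'I_m -> 'I_N}) : 'rV[R]_m.+1 :=
  cons_rV (Num.sqrt (1 - \sum_(i < m) ((k i)%:R / s) ^+ 2), \row_i ((k i)%:R / s)).

(** Every transverse coordinate is at most 1/(2(m+1)), so their squares add up to at most 1/4 and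
    leave 3/4 for the square of the first one. *)
Lemma grid_dirP (s : R) N (k : {ffun 'I_m -> 'I_N.+1}) : 0 < s ->
  N%:R <= s / (2 * m.+1%:R) ->
  \sum_(i < m.+1) grid_dir s k ord0 i ^+ 2 = 1 /\ 2^-1 <= grid_dir s k ord0 ord0.
Proof.
move=> s0 Ns; pose Y := \sum_(i < m) ((k i)%:R / s : R) ^+ 2.
have Y4 : Y <= 4^-1.
  have M1 : 1 <= m.+1%:R :> R by rewrite ler1n.
  have H i : ((k i)%:R / s : R) ^+ 2 <= 4^-1 / m.+1%:R.
    have k0 : 0 <= (k i)%:R / s :> R by rewrite divr_ge0// ltW.
    have kM : (k i)%:R / s <= (2 * m.+1%:R)^-1 :> R.
      rewrite ler_pdivrMr// mulrC; apply: le_trans Ns.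
      by rewrite ler_nat -ltnS.
    apply: (@le_trans _ _ ((2 * m.+1%:R)^-1 ^+ 2)); first by rewrite lerXn2r// nnegrE invr_ge0 mulr_ge0.
    rewrite invfM exprMn; have -> : (2^-1 : R) ^+ 2 = 4^-1 by field.
    by rewrite ler_wpM2l// expr2 ler_piMr// invf_le1// ltr0n.
  apply: (@le_trans _ _ (\sum_(i < m) (4^-1 / m.+1%:R))); first exact: ler_sum.
  rewrite sumr_const card_ord -[_ *+ m]mulr_natr mulrAC -mulrA ler_piMr// ler_pdivrMr ?ltr0n// mul1r.
  by rewrite ler_nat.
rewrite /grid_dir big_ord_recl mxE unlift_none /= sqr_sqrtr -/Y; last lra.
split.
  have -> : \sum_(i < m) (cons_rV (Num.sqrt (1 - Y), \row_i0 ((k i0)%:R / s)))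
      ord0 (lift ord0 i) ^+ 2 = Y.
    by apply: eq_bigr => i _; rewrite !mxE liftK /= mxE.
  by rewrite subrK.
have -> : (2^-1 : R) = Num.sqrt (2^-1 ^+ 2) by rewrite sqrtr_sqr ger0_norm.
by rewrite ler_wsqrtr//; lra.
Qed.

(** By [dotr_le_gauss] each wave lies below a product of m Gaussians, which after scaling by sqrt r
    are centred at integers. The sum over the grid then factors into m one-dimensional sums, each
    bounded by [sum_gauss_le]. *)
Lemma sum_plane_wave_le (r : R) N x : 0 < r -> enorm x <= r ->
  N%:R <= Num.sqrt r / (2 * m.+1%:R) ->
  \sum_(k : {ffun 'I_m -> 'I_N.+1}) expR (dotr x (grid_dir (Num.sqrt r) k) - r)
    <= (4 * expR 2^-1) ^+ m.
Proof.
move=> r0 xr Ns; set s := Num.sqrt r.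
have s0 : 0 < s by rewrite sqrtr_gt0.
have s2 : s ^+ 2 = r by rewrite sqr_sqrtr// ltW.
pose F (i : 'I_m) (j : 'I_N.+1) := expR (- ((x ord0 (lift ord0 i) / s - j%:R) ^+ 2 / 2)).
apply: (@le_trans _ _ (\sum_(k : {ffun 'I_m -> 'I_N.+1}) \prod_(i < m) F i (k i))).
  apply: ler_sum => k _; rewrite /F -expR_sum ler_expR lerBlDl.
  have [w1 w2] := grid_dirP k s0 Ns.
  apply: le_trans (dotr_le_gauss r0 xr w1) _; rewrite lerD2l sumrN lerN2.
  rewrite big_ord_recl mulrDl ler_wpDl//; first by rewrite divr_ge0 ?sqr_ge0//; lra.
  rewrite mulr_suml; apply: ler_sum => i _; rewrite !mxE liftK /= mxE.
  by rewrite le_eqVlt; apply/orP; left; apply/eqP; rewrite -s2; field; rewrite gt_eqF.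
rewrite -(bigA_distr_bigA F) -[X in _ ^+ X](card_ord m) -prodr_const.
apply: ler_prod => i _; apply/andP; split; last exact: sum_gauss_le.
by apply: sumr_ge0 => j _; exact: expR_ge0.
Qed.

Lemma measurable_dotr n (w : 'rV[R]_n) : measurable_fun setT (fun x => dotr x w).
Proof.
apply: measurable_sum => i; apply: measurable_funM => //.
exact: measurable_coord.
Qed.

Lemma measurable_plane_wave n (w : 'rV[R]_n) (r : R) :
  measurable_fun setT (fun x => expR (dotr x w - r)).
Proof.
apply: measurableT_comp => //; apply: measurable_funB => //.
exact: measurable_dotr.
Qed.

Lemma plane_wave_le1 n (x w : 'rV[R]_n) r : 0 < r -> enorm x <= r ->
  \sum_(i < n) w ord0 i ^+ 2 = 1 -> expR (dotr x w - r) <= 1.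
Proof.
move=> r0 xr w1; rewrite -[leRHS]expR0 ler_expR subr_le0.
apply: le_trans (dotr_le_gauss r0 xr w1) _; rewrite gerBl divr_ge0//; last lra.
by apply: sumr_ge0 => i _; exact: sqr_ge0.
Qed.

Lemma integrable_plane_wave (w : 'rV[R]_m.+1) r (f : 'rV[R]_m.+1 -> R) : 0 < r ->
  \sum_(i < m.+1) w ord0 i ^+ 2 = 1 ->
  leb.-integrable (eball r) (EFin \o f) ->
  leb.-integrable (eball r) (EFin \o (fun x => f x * expR (dotr x w - r))).
Proof.
move=> r0 w1 If; have mr : measurable (eball r : set 'rV[R]_m.+1) by exact: measurable_eball.
apply: (le_integrable mr _ _ If).
  have /measurable_EFinP mf := measurable_int _ If.
  apply/measurable_EFinP; apply: measurable_funM => //.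
  by apply: measurable_funTS; exact: measurable_plane_wave.
move=> x xr /=; rewrite lee_fin normrM ler_piMr// ger0_norm ?expR_ge0//.
exact: plane_wave_le1.
Qed.

(* A plane wave only sees f on a cap of angular width r^(-1/2). Summing over  *)
(* the grid of directions gains the number of caps, about r^(m/2), while the  *)
(* sum of the waves stays bounded on the ball.                                *)
Lemma plane_wave_Lp (p : R) : 1 < p -> exists2 K : R, 0 < K &
  forall r (f : 'rV[R]_m.+1 -> R) (A : R), 0 < r ->
  leb.-integrable (eball r) (EFin \o (fun x => `|f x|)) ->
  leb.-integrable (eball r) (EFin \o (fun x => `|f x| `^ p)) ->
  0 <= A ->
  (forall w : 'rV[R]_m.+1, \sum_(i < m.+1) w ord0 i ^+ 2 = 1 ->
     A <= \int[leb]_(x in eball r) (`|f x| * expR (dotr x w - r))) ->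
  A `^ p * Num.sqrt r ^+ m <=
  K * (Num.sqrt r ^+ m) `^ (p - 1) * \int[leb]_(x in eball r) (`|f x| `^ p).
Proof.
move=> p1.
pose c1 : R := 4 * Num.sqrt (4 * pi) ^+ m.
have c10 : 0 < c1 by rewrite mulr_gt0// exprn_gt0// sqrtr_gt0 mulr_gt0// pi_gt0.
pose c2 : R := (4 * expR 2^-1) ^+ m.
have c20 : 0 < c2 by rewrite exprn_gt0// mulr_gt0// expR_gt0.
pose M : R := 2 * m.+1%:R; have M0 : 0 < M by rewrite mulr_gt0// ltr0n.
exists (M ^+ m * c1 `^ (p - 1) * c2).
  by rewrite !mulr_gt0 ?exprn_gt0 ?powR_gt0.
move=> r f A r0 If Ifp A0 AI.
have mr : measurable (eball r : set 'rV[R]_m.+1) by exact: measurable_eball.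
set s := Num.sqrt r; have s0 : 0 < s by rewrite sqrtr_gt0.
set I := \int[leb]_(x in eball r) _.
(* Each axis carries N + 1 > s / M grid points, index 0 included, so the count is at least (s / M)^m
   even for small r. *)
pose N := Num.truncn (s / M).
have sM0 : 0 <= s / M by rewrite divr_ge0 ?ltW.
have /andP[NsM sMN] : N%:R <= s / M < N.+1%:R by exact: truncn_itv.
pose W := c1 * s ^+ m; have W0 : 0 < W by rewrite mulr_gt0 ?exprn_gt0.
pose e (k : {ffun 'I_m -> 'I_N.+1}) x := expR (dotr x (grid_dir s k) - r).
have dirP (k : {ffun 'I_m -> 'I_N.+1}) := grid_dirP k s0 NsM.
have Ie k : leb.-integrable (eball r) (EFin \o e k).
  have -> : e k = (fun x => 1 * expR (dotr x (grid_dir s k) - r)).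
    by apply/funext => x; rewrite mul1r.
  apply: (@integrable_plane_wave _ r (fun=> 1) r0 (proj1 (dirP k))).
  apply: measurable_bounded_integrable => //.
    apply: (@le_lt_trans _ _ (leb (cube r))).
      have mc : measurable (cube r : set 'rV[R]_m.+1) by exact: measurable_cube.
      exact: (le_measure leb (mem_set mr) (mem_set mc) (@eball_cube R m.+1 r)).
    by rewrite lebesgue_cube ?ltry// ltW.
  by exists 1; split; [exact: num_real|move=> y y1 x _; rewrite normr1 ltW].
have step k : A `^ p <= W `^ (p - 1) * \int[leb]_(x in eball r) (`|f x| `^ p * e k x).
  have [w1 w2] := dirP k.
  apply: jensen_powR => //.
  - by move=> x _; exact: expR_ge0.
  - exact: integrable_plane_wave.
  - exact: integrable_plane_wave.
  - have := ball_plane_wave r0 w1 w2.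
    rewrite /Rintegral -lee_fin fineK; last exact: (integrable_fin_num mr (Ie k)).
    have -> : (4 * (normal_peak (Num.sqrt (2 * r)))^-1 ^+ m)%R = W.
      rewrite /W /c1 -mulrA -exprMn; congr (_ * _ ^+ _).
      rewrite /normal_peak invrK sqr_sqrtr; last lra.
      by rewrite -sqrtrM ?mulr_ge0 ?pi_ge0//; congr Num.sqrt; ring.
    apply: le_trans; rewrite integral_mkcond le_eqVlt; apply/orP; left; apply/eqP.
    apply: eq_integral => x _; rewrite patchE indicE; case: ifP => _;
      by rewrite ?mul1r ?mul0r.
  - exact: AI.
have : \sum_(k : {ffun 'I_m -> 'I_N.+1}) A `^ p <= \sum_k W `^ (p - 1) *
    \int[leb]_(x in eball r) (`|f x| `^ p * e k x) by apply: ler_sum.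
rewrite sumr_const -mulr_sumr card_ffun !card_ord.
have [IS <-] := Rintegral_sum (index_enum _) mr
  (fun k => integrable_plane_wave r0 (proj1 (dirP k)) Ifp).
set J := \int[leb]_(x in eball r) _ => H.
have JI : J <= c2 * I.
  rewrite -RintegralZl//; apply: le_Rintegral => //; first exact: integrable_mulrl.
  move=> x xr; rewrite -mulr_sumr mulrC ler_wpM2r ?powR_ge0//.
  exact: sum_plane_wave_le.
have sN : (s / M) ^+ m <= (N.+1 ^ m)%:R by rewrite natrX lerXn2r ?nnegrE// ltW.
have Ap : A `^ p * (s / M) ^+ m <= W `^ (p - 1) * (c2 * I).
  apply: le_trans (ler_wpM2l (powR_ge0 _ _) sN) _; rewrite mulr_natr.
  by apply: le_trans H _; rewrite ler_wpM2l ?powR_ge0.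
have Mm : 0 < M ^+ m by rewrite exprn_gt0.
have -> : s ^+ m = M ^+ m * (s / M) ^+ m by rewrite -exprMn mulrCA divff ?mulr1 ?gt_eqF.
rewrite mulrCA -!mulrA ler_wpM2l ?(ltW Mm)//; apply: le_trans Ap _.
rewrite /W powRM ?(ltW c10) ?exprn_ge0 ?(ltW s0)//.
have -> : M ^+ m * (s / M) ^+ m = s ^+ m by rewrite -exprMn mulrCA divff ?mulr1 ?gt_eqF.
by rewrite le_eqVlt; apply/orP; left; apply/eqP; ring.
Qed.

End plane_waves.

(** * Differential inequalities and the blow-up iteration *)

Section ode.
Context {R : realType}.
Implicit Types (a b t s : R).

Lemma within_dist (f : R -> R) a b : {within `[a, b], continuous f} ->
  forall x, a <= x <= b -> forall e, 0 < e ->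
  exists2 d, 0 < d & forall y, a <= y <= b -> `|y - x| < d -> `|f y - f x| < e.
Proof.
move=> /subspace_continuousP cf x xab e e0.
have /cvgrPdist_lt /(_ e e0) := cf x xab.
rewrite near_withinE => /nbhs_ballP[d d0 H]; exists d => // y yab yd.
by rewrite distrC; apply: H; rewrite //= -ball_normE /= distrC.
Qed.

Lemma withinM (A : set R) (f g : R -> R) : {within A, continuous f} ->
  {within A, continuous g} -> {within A, continuous (fun x => f x * g x)}.
Proof.
move=> /subspace_continuousP cf /subspace_continuousP cg.
by apply/subspace_continuousP => x Ax; apply: cvgM; [exact: cf|exact: cg].
Qed.

Lemma withinD (A : set R) (f g : R -> R) : {within A, continuous f} ->
  {within A, continuous g} -> {within A, continuous (fun x => f x + g x)}.
Proof.
move=> /subspace_continuousP cf /subspace_continuousP cg.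
by apply/subspace_continuousP => x Ax; apply: cvgD; [exact: cf|exact: cg].
Qed.

Lemma within_comp (A : set R) (g f : R -> R) : continuous g ->
  {within A, continuous f} -> {within A, continuous (fun x => g (f x))}.
Proof.
move=> cg /subspace_continuousP cf.
apply/subspace_continuousP => x Ax.
exact: (cvg_comp _ _ (cf x Ax) (cg (f x))).
Qed.

Lemma within_cst (A : set R) (c : R) : {within A, continuous (fun=> c)}.
Proof. by apply: continuous_subspaceT => x; exact: cvg_cst. Qed.

Lemma within_id (A : set R) : {within A, continuous (fun x : R => x)}.
Proof. by apply: continuous_subspaceT => x; exact: cvg_id. Qed.

Lemma within_subitv (f : R -> R) a b c d : {within `[a, b], continuous f} ->
  a <= c -> d <= b -> {within `[c, d], continuous f}.
Proof.
move=> cf ac db; apply: continuous_subspaceW cf => x /=.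
rewrite !in_itv /= => /andP[cx xd].
by rewrite (le_trans ac cx) (le_trans xd db).
Qed.

Lemma ler_is_derive (f df : R -> R) a t : a <= t ->
  {within `[a, t], continuous f} ->
  (forall x, a < x < t -> is_derive x 1 f (df x)) ->
  (forall x, a < x < t -> 0 <= df x) -> f a <= f t.
Proof.
rewrite le_eqVlt => /predU1P[->//|at_] cf fdf df0.
have [c cat ft] := MVT at_ fdf cf.
by rewrite -subr_ge0 ft mulr_ge0 ?df0 ?subr_ge0// ltW.
Qed.

(** The hypothesis makes e^(kx) (y x - c) nondecreasing: y is driven towards c at the rate k. *)
Lemma relaxation (y dy : R -> R) (k c : R) a t : a <= t ->
  {within `[a, t], continuous y} ->
  (forall x, a < x < t -> is_derive x 1 y (dy x)) ->
  (forall x, a < x < t -> k * (c - y x) <= dy x) ->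
  c * (1 - expR (- (k * (t - a)))) + expR (- (k * (t - a))) * y a <= y t.
Proof.
move=> le_at cy ydy H.
have : expR (k * a) * (y a - c) <= expR (k * t) * (y t - c).
  apply: (@ler_is_derive (fun x => expR (k * x) * (y x - c))
    (fun x => expR (k * x) * (k * (y x - c) + dy x))) => //.
  - apply: withinM.
      apply: within_comp; first exact: continuous_expR.
      by apply: withinM; [exact: within_cst|exact: within_id].
    by apply: withinD => //; exact: within_cst.
  - move=> x xat; have dy' := ydy _ xat.
    have He : is_derive x (1 : R) (expR \o (k \*: id)) (expR (k * x) * k).
      apply: is_derive1_comp; apply: is_derive_eq.
      by rewrite /GRing.scale /= mulr1.
    have Hy : is_derive x (1 : R) (y - cst c) (dy x - 0) by apply: is_deriveB.
    apply: is_derive_eq (is_deriveM He Hy) _.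
    by rewrite /GRing.scale /= !fctE /GRing.scale/=; ring.
  - move=> x xat; rewrite mulr_ge0 ?expR_ge0//; have := H _ xat; lra.
have et : 0 < expR (- (k * t)) by exact: expR_gt0.
move=> /(ler_wpM2l (ltW et)).
rewrite !mulrA -!expRD addNr expR0 mul1r.
have -> : - (k * t) + k * a = - (k * (t - a)) by ring.
by lra.
Qed.

(** Turns the linear loss over one short interval into an exponential one, which multiplies
    correctly over successive intervals. *)
Lemma expR_le_linear (x : R) : 0 <= x <= 4^-1 -> expR (- (4 * x)) <= 1 - 2 * x.
Proof.
move=> /andP[x0 x4]; rewrite expRN.
have h : 1 + 4 * x <= expR (4 * x) by exact: expR_ge1Dx.
apply: (@le_trans _ _ (1 + 4 * x)^-1).
  by rewrite lef_pV2 ?posrE ?expR_gt0//; lra.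
rewrite -[leLHS]mul1r ler_pdivrMr; last lra.
nra.
Qed.

(* [K * (beta t - beta s)] bounds the damping loss on [s, t]; continuous      *)
(* induction only ever needs it on short intervals.                           *)
Lemma gronwall (W G beta z : R -> R) T : 0 <= T ->
  {within `[0, T], continuous W} -> {within `[0, T], continuous G} ->
  {within `[0, T], continuous beta} ->
  (forall s t, 0 <= s -> s <= t -> t <= T -> G s <= G t) ->
  (forall s t, 0 <= s -> s <= t -> t <= T -> beta s <= beta t) ->
  0 < G 0 -> G 0 <= W 0 ->
  (forall s t K, 0 <= s -> s <= t -> t <= T -> 0 <= K ->
     (forall x, s <= x <= t -> z x <= K) ->
     W s + (G t - G s) - K * (beta t - beta s) <= W t) ->
  (forall a, 0 <= a -> a < T -> (forall s, 0 <= s <= a -> 0 < W s) ->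
     exists2 d, 0 < d & forall s, a <= s <= T -> s < a + d -> z s <= W s) ->
  forall t, 0 <= t <= T -> expR (- (4 * (beta t - beta 0))) * G t <= W t.
Proof.
move=> T0 cW cG cb ndG ndb G0 GW HW Hz.
pose E t := expR (- (4 * (beta t - beta 0))) * G t.
have cE : {within `[0, T], continuous E}.
  apply: withinM => //; apply: within_comp; first exact: continuous_expR.
  apply: within_comp; first exact: opp_continuous.
  apply: withinM; first exact: within_cst.
  by apply: withinD => //; exact: within_cst.
have Gpos t : 0 <= t -> t <= T -> 0 < G t.
  by move=> t0 tT; apply: lt_le_trans G0 _; exact: ndG.
have Epos t : 0 <= t -> t <= T -> 0 < E t.
  by move=> t0 tT; rewrite mulr_gt0 ?expR_gt0 ?Gpos.
pose S := [set t | 0 <= t <= T /\ forall s, 0 <= s <= t -> E s <= W s].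
have E0 : E 0 <= W 0 by rewrite /E subrr mulr0 oppr0 expR0 mul1r.
have S0 : S 0.
  split; first by rewrite lexx.
  by move=> s s0; have -> : s = 0 by apply/eqP; rewrite eq_le andbC.
have supS : has_sup S by split; [exists 0|exists T => t [/andP[]]].
set tau := sup S.
have tau0 : 0 <= tau by apply: ub_le_sup => //; case: supS.
have tauT : tau <= T by apply: ge_sup => [|t [/andP[]]//]; exists 0.
have lttau s : 0 <= s -> s < tau -> E s <= W s.
  move=> s0 stau; have [t St st] := sup_adherent (ltac:(by rewrite subr_gt0; exact: stau) : 0 < tau - s) supS.
  have [_ H] := St; apply: H; rewrite s0 /=; move: st; rewrite -/tau; lra.
(* The supremum is attained: a strict failure at tau would persist, by continuity, slightly before
   tau. *)
have Etau : E tau <= W tau.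
  rewrite leNgt; apply/negP => WE.
  have t00 : 0 < tau.
    rewrite lt_neqAle tau0 andbT; apply/eqP => t0; move: WE; rewrite -t0; lra.
  have e0 : 0 < (E tau - W tau) / 2 by lra.
  have tt : 0 <= tau <= T by rewrite tau0.
  have [d1 d10 H1] := within_dist cE tt e0.
  have [d2 d20 H2] := within_dist cW tt e0.
  pose d := Num.min (Num.min d1 d2) tau.
  have d0 : 0 < d by rewrite !lt_min d10 d20.
  have [da [db dc]] : d <= d1 /\ d <= d2 /\ d <= tau.
    by rewrite /d !ge_min !lexx ?orbT.
  have st : tau - d / 2 < tau by lra.
  have := lttau (tau - d / 2) ltac:(lra) st.
  have ss : 0 <= tau - d / 2 <= T by lra.
  have sd : `|tau - d / 2 - tau| < d by rewrite ltr_norml; lra.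
  have := H1 _ ss ltac:(lra); have := H2 _ ss ltac:(lra).
  rewrite !ltr_norml; lra.
have Stau s : 0 <= s <= tau -> E s <= W s.
  by move=> /andP[s0]; rewrite le_eqVlt => /predU1P[->//|]; exact: lttau.
have tauE : tau = T.
  apply/eqP; rewrite eq_le tauT /= leNgt; apply/negP => tauT'.
  have [d1 d10 H1] := Hz tau tau0 tauT'
    (fun s hs => lt_le_trans (Epos s ltac:(lra) ltac:(lra)) (Stau s hs)).
  have Wtau : 0 < W tau by apply: lt_le_trans Etau; exact: Epos.
  have tt : 0 <= tau <= T by rewrite tau0.
  have [d2 d20 H2] := within_dist cW tt Wtau.
  have [d3 d30 H3] := within_dist cb tt (ltac:(lra) : 0 < 4^-1 :> R).
  (* Within distance d after tau one has z <= W <= 2 W(tau), and beta grows by at most 1/4. The loss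
     is then at most 2 W(tau) times the growth of beta, which [expR_le_linear] absorbs. *)
  pose d := Num.min (Num.min d1 d2) (Num.min d3 (T - tau)).
  have d0 : 0 < d by rewrite !lt_min d10 d20 d30 subr_gt0.
  have [da [db [dc dd]]] : d <= d1 /\ d <= d2 /\ d <= d3 /\ d <= T - tau.
    by rewrite /d !ge_min !lexx ?orbT.
  have : S (tau + d / 2).
    split; first lra.
    move=> s /andP[s0 sd]; have [stau|taus] := leP s tau; first by apply: Stau; rewrite s0.
    have zK x : tau <= x <= s -> z x <= 2 * W tau.
      move=> /andP[tx xs].
      have := H1 x ltac:(lra) ltac:(lra).
      have := H2 x ltac:(lra) ltac:(rewrite ltr_norml; lra).
      rewrite ltr_norml; lra.
    have := HW tau s (2 * W tau) tau0 (ltW taus) ltac:(lra) ltac:(lra) zK.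
    have bs := ndb tau s tau0 (ltW taus) ltac:(lra).
    have bs4 : beta s - beta tau <= 4^-1.
      have := H3 s ltac:(lra) ltac:(rewrite ltr_norml; lra).
      rewrite ltr_norml; lra.
    have Gs := ndG tau s tau0 (ltW taus) ltac:(lra).
    set x := beta s - beta tau => Hs.
    have x0 : 0 <= x by rewrite subr_ge0.
    have x4 : 0 <= x <= 4^-1 by rewrite x0.
    have ex := expR_le_linear x4.
    have -> : E s = expR (- (4 * x)) * (expR (- (4 * (beta tau - beta 0))) * G s).
      by rewrite mulrA -expRD /E /x; congr (expR _ * _); ring.
    have e1 : expR (- (4 * (beta tau - beta 0))) <= 1.
      by rewrite -[leRHS]expR0 ler_expR oppr_le0 mulr_ge0// subr_ge0 ndb.
    have e2 := expR_gt0 (- (4 * (beta tau - beta 0))).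
    have H4 : expR (- (4 * (beta tau - beta 0))) * G s <= W tau + (G s - G tau).
      move: Etau; rewrite /E; nra.
    apply: le_trans (ler_wpM2l (expR_ge0 _) H4) _.
    have pos : 0 <= W tau + (G s - G tau) by lra.
    apply: le_trans (ler_wpM2r pos ex) _.
    apply: le_trans Hs; nra.
  by move=> /(ub_le_sup (proj2 supS)); rewrite -/tau; lra.
by move=> t; rewrite -tauE; exact: Stau.
Qed.

Lemma bernoulli_ineq (x : R) j : 0 <= x -> 1 + j%:R * x <= (1 + x) ^+ j.
Proof.
move=> x0; elim: j => [|j IH]; first by rewrite mul0r addr0 expr0.
have j0 : 0 <= j%:R :> R by exact: ler0n.
by rewrite exprS -natr1; nra.
Qed.

Lemma powR2_unbounded (tau X : R) : 0 < tau -> exists j : nat, X < 2 `^ (j%:R * tau).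
Proof.
move=> tau0; pose x : R := 2 `^ tau - 1.
have x0 : 0 < x.
  rewrite subr_gt0 -[ltLHS](_ : 1 `^ tau = 1); last by rewrite powR1.
  by apply: gt0_ltr_powR => //; rewrite ?nnegrE ?ltr1n.
exists (Num.bound `|X / x|); set j := Num.bound _.
have jX : X / x < j%:R 
  by apply: le_lt_trans (ler_norm _) _; exact: archi_boundP.
rewrite mulrC powRrM powR_mulrn ?powR_ge0//.
have -> : 2 `^ tau = 1 + x by rewrite /x addrC subrK.
apply: lt_le_trans (bernoulli_ineq j (ltW x0)).
by move: jX; rewrite ltr_pdivrMr// => jX; lra.
Qed.

(* With h = T 2^(-j-4) the hypothesis carries the bound G >= L 2^(j tau) from *)
(* a_j = T (1 - 2^(-j-1)) to a_(j+1); the geometric growth alone contradicts  *)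
(* the finiteness of G T.                                                     *)
Lemma iteration (p q : R) : 1 < p -> 1 < q -> exists2 C : R, 0 < C &
  forall (T D : R) (G : R -> R), 1 <= T -> 0 < D -> 0 <= G (T / 2) ->
  (forall s t, 0 <= s -> s <= t -> t <= T -> G s <= G t) ->
  (forall a h, T / 2 <= a -> 0 < h -> a + 4 * h <= T ->
    D * h `^ (1 + 2 * p) * (1 - expR (- h)) `^ (p * q) * G a `^ (p * q)
      <= G (a + 4 * h)) ->
  D * T `^ (1 + 2 * p) * G (T / 2) `^ (p * q - 1) <= C.
Proof.
move=> p1 q1; have pq1 : 1 < p * q by nra.
pose th := 1 + 2 * p + p * q; have th0 : 0 < th by rewrite /th; lra.
(* This exponent solves p q tau - th = tau. Multiplying 2^(j tau p q) by the loss 2^(-(j+5) th)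
   therefore gives back 2^(j tau), up to the constant 2^(-5 th) compensated in the choice of C. *)
pose tau := th / (p * q - 1).
have tau0 : 0 < tau by rewrite divr_gt0//; lra.
exists (2 `^ (5 * th) * 2 `^ tau); first by rewrite mulr_gt0 ?powR_gt0.
move=> T D G T1 D0 G0 ndG HG.
rewrite leNgt; apply/negP => big; set L := G (T / 2) in G0 big.
have L0 : 0 < L.
  rewrite lt_neqAle G0 andbT; apply/eqP => L0; move: big; rewrite -L0 powR0; last first.
    by rewrite gt_eqF//; lra.
  by rewrite mulr0 ltNge mulr_ge0 ?powR_ge0.
pose a (j : nat) := T * (1 - 2^-1 ^+ j.+1).
have e0 j : 0 < (2^-1 : R) ^+ j by rewrite exprn_gt0.
have e1 j : (2^-1 : R) ^+ j <= 1 by rewrite exprn_ile1//; lra.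
have aT j : a j <= T by rewrite /a; have := e0 j.+1; nra.
have aT2 j : T / 2 <= a j.
  rewrite /a; have := e1 j; rewrite exprS => ?; nra.
have claim j : L * 2 `^ (j%:R * tau) <= G (a j).
  elim: j => [|j IH].
    rewrite mul0r powRr0 mulr1 /L; have -> : a 0%N = T / 2 by rewrite /a expr1; field.
    by [].
  pose e : R := 2^-1 ^+ j.
  pose h := T * e / 16.
  have he0 : 0 < h by rewrite /h divr_gt0// mulr_gt0 ?e0//; lra.
  have aS : a j.+1 = a j + 4 * h by rewrite /a /h /e !exprS; field.
  rewrite aS; apply: le_trans (HG (a j) h (aT2 j) he0 _); last by rewrite -aS.
  have e320 : 0 < e / 32 by rewrite divr_gt0// e0.
  (* Both h / T and 1 - e^(-h) are bounded below by e / 32 = 2^(-(j+5)), the latter because T >= 1;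
     a single power of 2 then serves all factors. *)
  have hT : T * (e / 32) <= h by rewrite /h; have := e0 j; rewrite -/e; nra.
  have kh : e / 32 <= 1 - expR (- h).
    have he : 1 + e / 16 <= expR h.
      apply: le_trans (expR_ge1Dx _); rewrite lerD2l /h.
      by have := e0 j; rewrite -/e; nra.
    rewrite expRN lerBrDl -lerBrDr; apply: (@le_trans _ _ (1 + e / 16)^-1).
      by rewrite lef_pV2 ?posrE ?expR_gt0//; have := e0 j; rewrite -/e; lra.
    rewrite -[leLHS]mul1r ler_pdivrMr; last by have := e0 j; rewrite -/e; lra.
    have := e0 j; have := e1 j; rewrite -/e; nra.
  have LX0 : 0 <= L * 2 `^ (j%:R * tau) by rewrite mulr_ge0 ?powR_ge0.
  have e32 : e / 32 = 2 `^ (- (j%:R + 5)).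
    rewrite powRN -natrD powR_mulrn// exprD invfM /e exprVn; congr (_ * _^-1).
    by ring.
  apply: (@le_trans _ _ (D * (T * (e / 32)) `^ (1 + 2 * p) * (e / 32) `^ (p * q) *
      (L * 2 `^ (j%:R * tau)) `^ (p * q))); last first.
    apply: ler_pM; rewrite ?mulr_ge0 ?powR_ge0 ?(ltW D0)//.
      apply: ler_pM; rewrite ?mulr_ge0 ?powR_ge0 ?(ltW D0)//.
        rewrite ler_wpM2l ?(ltW D0)// ge0_ler_powR// ?nnegrE; try lra.
        by rewrite mulr_ge0 ?(ltW e320)//; lra.
      by rewrite ge0_ler_powR// ?nnegrE; lra.
    by rewrite ge0_ler_powR// ?nnegrE; lra.
  rewrite e32 [(T * _) `^ _]powRM ?powR_ge0//; last lra.
  rewrite [(L * _) `^ _]powRM ?powR_ge0// -!powRrM.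
  have -> : D * (T `^ (1 + 2 * p) * 2 `^ (- (j%:R + 5) * (1 + 2 * p))) *
      2 `^ (- (j%:R + 5) * (p * q)) * (L `^ (p * q) * 2 `^ (j%:R * tau * (p * q))) =
      (D * T `^ (1 + 2 * p) * L `^ (p * q - 1)) * L *
      (2 `^ (- (j%:R + 5) * (1 + 2 * p)) * 2 `^ (- (j%:R + 5) * (p * q)) *
       2 `^ (j%:R * tau * (p * q))).
    have -> : L `^ (p * q) = L `^ (p * q - 1) * L.
      by rewrite -{3}[L]powRr1 ?(ltW L0)// -powRD ?(gt_eqF L0) ?implybT// subrK.
    by ring.
  have pq0 : p * q - 1 != 0 by rewrite gt_eqF//; lra.
  rewrite -!powRD ?pnatr_eq0 ?implybT//.
  have -> : - (j%:R + 5) * (1 + 2 * p) + - (j%:R + 5) * (p * q) +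
      j%:R * tau * (p * q) = - (5 * th) + j%:R * tau.
    by rewrite /tau /th; field.
  have -> : j.+1%:R * tau = tau + j%:R * tau by rewrite -natr1; ring.
  rewrite [X in _ <= _ * X]powRD ?pnatr_eq0 ?implybT//.
  rewrite [X in L * X]powRD ?pnatr_eq0 ?implybT// powRN.
  set X := 2 `^ (j%:R * tau); have X0 : 0 <= X by exact: powR_ge0.
  set Y := 2 `^ (5 * th) in big *; have Y0 : 0 < Y by exact: powR_gt0.
  set M := D * _ * _ in big *.
  have -> : M * L * (Y^-1 * X) = (M / Y) * (L * X) by ring.
  have -> : L * (2 `^ tau * X) = 2 `^ tau * (L * X) by ring.
  rewrite ler_wpM2r ?mulr_ge0 ?(ltW L0)// ler_pdivlMr// mulrC; exact: ltW.
have [j Hj] := powR2_unbounded (G T / L) tau0.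
have := le_trans (claim j) (ndG (a j) T (le_trans (ltac:(lra) : 0 <= T / 2) (aT2 j)) (aT j) (lexx T)).
by move: Hj; rewrite ltr_pdivrMr// mulrC ltNge => /negP.
Qed.

End ode.

(** * Test functions *)

Section cutoff.
Context {R : realType} {n : nat}.
Local Notation Rn := ('rV[R]_n).
Implicit Types (g : Rn -> R) (c : R).

Definition cutoff c g := elementary g /\ forall x, ~ cube c x -> g x = 0.

Lemma closed_cube c : closed (cube c : set Rn).
Proof. by apply: compact_closed; [exact: norm_hausdorff|exact: compact_cube]. Qed.

Lemma cutoff_derive c g v : cutoff c g -> cutoff c ('D_v g).
Proof.
move=> [eg g0]; split; first exact: elementary_D.
move=> x cx; have <- : 'D_v (cst 0 : Rn -> R) x = 0 by exact: derive_cst.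
apply: near_eq_derive.
have : nbhs x (~` cube c).
  by apply: open_nbhs_nbhs; split => //; apply: closed_openC; exact: closed_cube.
by apply: filterS => y /g0.
Qed.

Lemma cutoff_bounded c g : cutoff c g ->
  measurable_fun setT g /\ exists C, forall x, `|g x| <= C.
Proof.
move=> [eg g0]; split; first exact: elementary_measurable.
have [C C0 H] := compact_continuous_bounded (@compact_cube R n c) (elementary_continuous eg).
exists C => x; have [/H//|/g0->] := pselect (cube c x).
by rewrite normr0.
Qed.

Lemma tsupp_sub (V : normedModType R) (f : V -> R) (K : set V) :
  compact K -> (forall x, ~ K x -> f x = 0) -> compact (tsupp f) /\ tsupp f `<=` K.
Proof.
move=> cK f0; have clK : closed K by apply: compact_closed => //; exact: norm_hausdorff.
have tK : tsupp f `<=` K.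
  rewrite (proj1 (closure_id K) clK); apply: closure_subset => x /eqP fx.
  by apply: contrapT => /f0.
by split => //; apply: (subclosed_compact _ cK) => //; exact: closed_closure.
Qed.

Lemma affine_coord i (a b : R) : affine (fun x : Rn => a + b * x ord0 i).
Proof.
apply: affine_cst_sub; split; first exact: coord_continuous.
by exists (fun v : Rn => v ord0 i) => h v x; rewrite !mxE.
Qed.

Lemma affine_dotr (w : Rn) : affine (fun x : Rn => dotr x w).
Proof.
split; last first.
  exists (fun v => dotr v w) => h v x.
  rewrite /dotr mulr_sumr -big_split/=.
  by apply: eq_bigr => i _; rewrite !mxE; ring.
apply: continuous_big_sum => i x.
by apply: continuousM; [exact: coord_continuous|exact: cst_continuous].
Qed.

Definition chi (M : R) (x : Rn) : R :=
  \prod_(i < n) (smooth_step (M + 1 + (-1) * x ord0 i) * smooth_step (M + 1 + 1 * x ord0 i)).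

Lemma chi_ge0 M x : 0 <= chi M x.
Proof. by apply: prodr_ge0 => i _; rewrite mulr_ge0 ?smooth_step_ge0. Qed.

Lemma chi_le1 M x : chi M x <= 1.
Proof.
apply: prodr_ile1 => i _; rewrite mulr_ge0 ?smooth_step_ge0//=.
by rewrite mulr_ile1 ?smooth_step_ge0 ?smooth_step_le1.
Qed.

Lemma chi1 M x : cube M x -> chi M x = 1.
Proof.
move=> Mx; rewrite /chi big1// => i _; have := Mx i.
by rewrite ler_norml => /andP[h1 h2]; rewrite !smooth_step1 ?mulr1//; lra.
Qed.

Lemma chi0 M x : ~ cube (M + 1) x -> chi M x = 0.
Proof.
move=> Mx; apply/eqP; rewrite /chi.
have [i Hi] : exists i, ~ `|x ord0 i| <= M + 1.
  by apply: contrapT => H; apply: Mx => i; apply: contrapT => Hi; apply: H; exists i.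
rewrite (bigD1 i)//= mulf_eq0; apply/orP; left.
move: Hi; rewrite ler_norml => /negP; rewrite negb_and -!ltNge mulf_eq0.
move=> /orP[H|H]; apply/orP; [right|left]; rewrite smooth_step0//; lra.
Qed.

Lemma elementary_chi M : elementary (chi M).
Proof.
apply: elementary_prod => i.
by apply: elem_mul; apply: elementary_step; exact: affine_coord.
Qed.

(** The direction w = 0 gives the plain mean; a unit vector w gives a plane wave. *)
Definition wave_weight M (w : Rn) (x : Rn) := chi M x * expR (dotr x w).

Lemma wave_weight_cutoff M w : cutoff (M + 1) (wave_weight M w).
Proof.
split; last by move=> x /chi0 cx; rewrite /wave_weight cx mul0r.
by apply: elem_mul; [exact: elementary_chi|apply: elem_exp; exact: affine_dotr].
Qed.

Lemma derive_dotr (w v x : Rn) : 'D_v (fun x => expR (dotr x w)) x = dotr v w * expR (dotr x w).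
Proof.
have [_ [l Ll]] := affine_dotr w.
have H : is_derive x v (fun x : Rn => expR (dotr x w)) (dotr v w * expR (dotr x w)).
  apply: (@is_derive_comp_affine R _ expR _ (fun x => dotr x w)
    (fun v => dotr v w)) => h v' x'.
  rewrite /dotr mulr_sumr -big_split/=.
  by apply: eq_bigr => i _; rewrite !mxE; ring.
by case: H.
Qed.

Lemma near_enorm_lt (x : Rn) M : enorm x < M -> \forall y \near x, enorm y < M.
Proof.
move=> xM; have := @continuous_enorm R n x.
move=> /(_ [set y | y < M]); apply; exact: lt_nbhsl.
Qed.

(** Where |x| < M the cutoff is locally constant equal to 1, so only the exponential gets
    differentiated. *)
Lemma laplace_wave_weight M w (x : Rn) : enorm x < M ->
  \sum_(i < n) 'D_(unit_rV i) ('D_(unit_rV i) (wave_weight M w)) x =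
  (\sum_(i < n) w ord0 i ^+ 2) * wave_weight M w x.
Proof.
move=> xM; rewrite mulr_suml; apply: eq_bigr => i _.
have gE y : enorm y < M -> wave_weight M w y = expR (dotr y w).
  move=> yM; rewrite /wave_weight chi1 ?mul1r// => j.
  by apply: le_trans (coord_le_enorm y j) _; exact: ltW.
have ui : dotr (unit_rV i) w = w ord0 i.
  rewrite /dotr (bigD1 i)//= !mxE !eqxx mul1r big1 ?addr0// => j ji.
  by rewrite mxE (negbTE ji) andbF mul0r.
have gD y : enorm y < M -> 'D_(unit_rV i) (wave_weight M w) y =
    w ord0 i * expR (dotr y w).
  move=> yM; rewrite -ui -derive_dotr; apply: near_eq_derive.
  by apply: filterS (near_enorm_lt yM) => z /gE.
have -> : 'D_(unit_rV i) ('D_(unit_rV i) (wave_weight M w)) x =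
    'D_(unit_rV i) (fun y => w ord0 i * expR (dotr y w)) x.
  apply: near_eq_derive.
  by apply: filterS (near_enorm_lt xM) => z /gD.
have -> : (fun y => w ord0 i * expR (dotr y w)) =
    w ord0 i \*: (fun y : Rn => expR (dotr y w)) by [].
rewrite deriveZ; last first.
  have [_ H] := elementary_smooth (elem_exp (affine_dotr w)) [::].
  exact: H.
by rewrite derive_dotr ui gE// /GRing.scale /=; ring.
Qed.

End cutoff.

Section test_functions.
Context {R : realType} {n : nat}.
Local Notation Rn := ('rV[R]_n).
Local Notation Rt := (R * 'rV[R]_n)%type.

Lemma elementary_snd (f : Rn -> R) : elementary f -> elementary (fun z : Rt => f z.2).
Proof.
have aS (L : Rn -> R) : affine L -> affine (fun z : Rt => L z.2).
  move=> [cL [l Ll]]; split; last by exists (fun z => l z.2) => h v x; rewrite /= Ll.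
  move=> z; apply: (@continuous_comp _ _ _ (fun z : Rt => z.2) L).
    exact: cvg_snd.
  exact: cL.
elim=> [k L aL|L aL|a|f1 g1 _ If _ Ig|f1 g1 _ If _ Ig|f1 f0 _ If].
- exact: (elem_flat k (aS _ aL)).
- exact: (elem_exp (aS _ aL)).
- exact: elem_cst.
- exact: elem_add.
- exact: elem_mul.
- by apply: elem_inv.
Qed.

Lemma affine_fst (a b : R) : affine (fun z : Rt => a + b * z.1).
Proof.
apply: affine_cst_sub; split; first by move=> z; exact: cvg_fst.
by exists (fun z : Rt => z.1).
Qed.

(** Test functions live on all times below T and must have compact support there, which calls for a
    second step at negative times. Around s = 0, where the data enter, the cutoff is 1. *)
Definition time_cutoff (T2 T1 s : R) : R :=
  smooth_step (T1 / (T1 - T2) + (- (T1 - T2)^-1) * s) * smooth_step (2 + 1 * s).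

Lemma time_cutoff1 T2 T1 s : T2 < T1 -> -1 <= s <= T2 -> time_cutoff T2 T1 s = 1.
Proof.
move=> T21 /andP[s1 sT]; rewrite /time_cutoff !smooth_step1 ?mulr1//; first lra.
have -> : T1 / (T1 - T2) + - (T1 - T2)^-1 * s = (T1 - s) / (T1 - T2) by field; lra.
by rewrite ler_pdivlMr; lra.
Qed.

Lemma time_cutoff0 T2 T1 s : T2 < T1 -> ~ -2 <= s <= T1 -> time_cutoff T2 T1 s = 0.
Proof.
move=> T21 /negP; rewrite negb_and -!ltNge /time_cutoff => /orP[s2|sT].
  by rewrite [smooth_step (2 + _)]smooth_step0 ?mulr0//; lra.
rewrite smooth_step0 ?mul0r//.
have -> : T1 / (T1 - T2) + - (T1 - T2)^-1 * s = (T1 - s) / (T1 - T2) by field; lra.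
by rewrite ler_pdivrMr; lra.
Qed.

(** For g = e^(x.w) with |w| = k, the decay e^(-ks) yields a solution of the free wave equation that
    stays bounded on the light cone. *)
Definition st_test T2 T1 k (g : Rn -> R) (z : Rt) : R :=
  time_cutoff T2 T1 z.1 * (expR (0 + (- k) * z.1) * g z.2).

Lemma st_test_function T2 T1 k g c (T : \bar R) : T2 < T1 -> (T1%:E < T)%E ->
  cutoff c g -> test_function T (st_test T2 T1 k g).
Proof.
move=> T21 T1T [eg g0].
have cK : compact (`[-2, T1]%classic `*` cube c : set Rt).
  by apply: compact_setX; [exact: segment_compact|exact: compact_cube].
have [cs ss] : compact (tsupp (st_test T2 T1 k g)) /\
    tsupp (st_test T2 T1 k g) `<=` `[-2, T1]%classic `*` cube c.
  apply: tsupp_sub => // -[s x] /not_andP[] /=; rewrite /st_test /=.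
    by rewrite in_itv /= => H; rewrite time_cutoff0 ?mul0r.
  by move=> /g0 ->; rewrite !mulr0.
split => //.
  apply: elementary_smooth; rewrite /st_test /time_cutoff; apply: elem_mul.
    apply: (elem_mul (elementary_step (affine_fst _ _)) (elementary_step (affine_fst _ _))).
  apply: elem_mul; last exact: elementary_snd.
  by apply: elem_exp; exact: affine_fst.
move=> -[s x] /ss[] /=; rewrite in_itv /= => /andP[_ sT] _.
by apply: le_lt_trans T1T; rewrite lee_fin.
Qed.

Lemma derive_slice_snd (F : Rt -> R) s (u x : Rn) :
  'D_((0, u) : Rt) F (s, x) = 'D_u (fun y => F (s, y)) x.
Proof.
have e : (fun h : R => h^-1 *: (F (h *: ((0, u) : Rt) + (s, x)) - F (s, x))) =
    (fun h : R => h^-1 *: (F (s, h *: u + x) - F (s, x))).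
  apply/funext => h; have -> : h *: ((0, u) : Rt) + (s, x) = (s, h *: u + x) => //.
  by congr pair; rewrite /= scaler0 add0r.
by rewrite /derive e.
Qed.

Lemma derive_slice_fst (F : Rt -> R) (s : R) (x : Rn) :
  'D_((1, 0) : Rt) F (s, x) = 'D_1 (fun t => F (t, x)) s.
Proof.
have e : (fun h : R => h^-1 *: (F (h *: ((1, 0) : Rt) + (s, x)) - F (s, x))) =
    (fun h : R => h^-1 *: (F (h *: 1 + s, x) - F (s, x))).
  apply/funext => h; have -> : h *: ((1, 0) : Rt) + (s, x) = (h *: 1 + s, x) => //.
  by congr pair; rewrite /= scaler0 add0r.
by rewrite /derive e.
Qed.

Lemma dspace_st_test T2 T1 k g c s x i : cutoff c g ->
  dspace i (st_test T2 T1 k g) (s, x) =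
  time_cutoff T2 T1 s * (expR (- (k * s)) * 'D_(unit_rV i) g x).
Proof.
move=> [eg _].
have -> : dspace i (st_test T2 T1 k g) (s, x) =
    'D_(unit_rV i) (fun y => st_test T2 T1 k g (s, y)) x.
  exact: derive_slice_snd.
have -> : (fun y => st_test T2 T1 k g (s, y)) =
    (time_cutoff T2 T1 s * expR (- (k * s))) \*: g.
  by apply/funext => y; rewrite /st_test /= /GRing.scale /= add0r mulNr mulrA.
rewrite deriveZ ?mulrA//.
by have [_ H] := elementary_smooth eg [::]; exact: H.
Qed.

Lemma dtime_st_test T2 T1 k g s x : T2 < T1 -> -1 < s < T2 ->
  dtime (st_test T2 T1 k g) (s, x) = - k * (expR (- (k * s)) * g x).
Proof.
move=> T21 sT.
have -> : dtime (st_test T2 T1 k g) (s, x) =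
    'D_1 (fun t => st_test T2 T1 k g (t, x)) s.
  exact: derive_slice_fst.
have -> : 'D_1 (fun t => st_test T2 T1 k g (t, x)) s =
    'D_1 (g x \*: (expR \o (- k \*: id))) s.
  apply: near_eq_derive; near=> t.
  rewrite /st_test /= time_cutoff1 ?mul1r//; last first.
    apply/andP; split; apply/ltW; near: t; [apply: lt_nbhsr|apply: lt_nbhsl]; lra.
  by rewrite add0r mulrC.
have He : is_derive s (1 : R) (expR \o (- k \*: id)) (expR (- k * s) * - k).
  apply: is_derive1_comp; apply: is_derive_eq.
  by rewrite /GRing.scale /= mulr1.
have [_ ->] := @is_deriveZ _ _ _ _ (g x) s 1 _ He.
by rewrite /GRing.scale /= mulNr; ring.
Unshelve. all: by end_near.
Qed.

End test_functions.

(** * Pairings depending on time *)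

Section pairing_in_time.
Context {R : realType} {n : nat}.
Local Notation Rn := ('rV[R]_n).
Local Notation leb := (lebesgue_rV R n).
Implicit Types (T : \bar R) (g : Rn -> R) (c : R).

Definition pairing (f g : Rn -> R) : R := \int[leb]_x (f x * g x).

Lemma time_itvP T (T0 s : R) : (T0%:E < T)%E -> 0 <= s <= T0 -> time_itv T s.
Proof.
move=> T0T /andP[s0 sT]; split => //.
by apply: le_lt_trans T0T; rewrite lee_fin.
Qed.

Lemma pairing_continuous T (T0 : R) f g c : (T0%:E < T)%E -> C_L1loc T f -> cutoff c g ->
  {within `[0, T0], continuous (fun s => pairing (f s) g)}.
Proof.
move=> T0T [lf cf] cg; have [mg [C gC]] := cutoff_bounded cg.
apply/subspace_continuousP => s; rewrite /= in_itv /= => sT.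
have si := time_itvP T0T sT.
have sub : `[0, T0]%classic `<=` time_itv T.
  by move=> x; rewrite /= in_itv /=; exact: time_itvP.
apply: (@cvg_pairing R n c C g mg gC (proj2 cg)).
- rewrite near_withinE; near=> x => /sub xT; exact/L1loc_cube/lf.
- exact/L1loc_cube/lf.
move=> K cK; have := cf s si K cK.
by apply: cvg_trans; apply: cvg_app; exact: within_subset.
Unshelve. all: by end_near.
Qed.

Lemma L1cubeZ c (a : R) (f : Rn -> R) : L1cube c f -> L1cube c (fun x => a * f x).
Proof.
move=> [mf If]; split; first exact: measurable_funM.
by apply: integrable_mulrl => //; exact: measurable_cube.
Qed.

Lemma pairing_is_derive T (T0 : R) f df g c (s : R) : (T0%:E < T)%E -> C1_L1loc T f df ->
  cutoff c g -> 0 < s < T0 ->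
  is_derive s (1 : R) (fun s => pairing (f s) g) (pairing (df s) g).
Proof.
move=> T0T [[lf _] [ldf _] cf] cg /andP[s0 sT]; have [mg [C gC]] := cutoff_bounded cg.
have si : time_itv T s by apply: (time_itvP T0T); rewrite !ltW.
have lfc t : time_itv T t -> L1cube c (f t) by move=> ti; exact/L1loc_cube/lf.
have H : (\int[leb]_x ((f t x - f s x) / (t - s) * g x))
    @[t --> within (time_itv T `\ s) (nbhs s)] --> pairing (df s) g.
  apply: (@cvg_pairing R n c C g mg gC (proj2 cg)) => //.
  - rewrite near_withinE; near=> t => -[ti _].
    have := L1cubeZ (t - s)^-1 (L1cubeB (lfc t ti) (lfc s si)).
    by congr (L1cube c _); apply/funext => x; rewrite mulrC.
  - exact/L1loc_cube/ldf.
  - exact: cf.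
have slope : h^-1 *: (pairing (f (h *: 1 + s)) g - pairing (f s) g) @[h --> 0^']
    --> pairing (df s) g.
  apply/cvgrPdist_le => e e0.
  move/cvgrPdist_le : H => /(_ e e0); rewrite near_withinE.
  move=> /nbhs_ballP[d d0 H].
  near=> h.
  have hd : `|h| < d by near: h; apply: dnbhs0_lt.
  have hs : `|h| < s by near: h; apply: dnbhs0_lt.
  have hT : `|h| < T0 - s by near: h; apply: dnbhs0_lt; rewrite subr_gt0.
  have h0 : h != 0 by near: h; exact: nbhs_dnbhs_neq.
  have ti : time_itv T (h + s).
    by apply: (time_itvP T0T); move: hs hT; rewrite !ltr_norml; lra.
  have := H (h + s); rewrite /= -ball_normE /= opprD addrCA subrr addr0 normrN.
  move=> /(_ hd) H'.
  rewrite [h *: 1]mulr1.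
  have -> : h^-1 *: (pairing (f (h + s)) g - pairing (f s) g) =
      \int[leb]_x ((f (h + s) x - f s x) / (h + s - s) * g x).
    rewrite addrK /pairing -RintegralB//; try exact: (integrable_pairing mg gC (proj2 cg) (lfc _ _)).
    rewrite /GRing.scale /= -RintegralZl//.
      by apply: eq_Rintegral => x _; ring.
    have := integrable_pairing mg gC (proj2 cg) (L1cubeB (lfc _ ti) (lfc _ si)).
    by congr (_.-integrable _ (_ \o _)); apply/funext => x; ring.
  apply: H'; split => // /eqP; rewrite -subr_eq0 addrK; exact/negP.
split; first by apply/cvg_ex; exists (pairing (df s) g).
exact: (cvg_lim _ slope).
Unshelve. all: by end_near.
Qed.

Lemma measurable_time_itv T : measurable (time_itv T : set R).
Proof.
rewrite [X in measurable X](_ : _ = `[0, +oo[%classic `&` [set t : R | (t%:E < T)%E]).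
  apply: measurableI => //.
  case: T => [r| |].
  - suff -> : [set t : R | (t%:E < r%:E)%E] = `]-oo, r[%classic by [].
    by rewrite predeqE => t /=; rewrite in_itv /= lte_fin.
  - suff -> : [set t : R | (t%:E < +oo)%E] = setT by [].
    by rewrite predeqE => t; split => //= _; rewrite ltry.
  - suff -> : [set t : R | (t%:E < -oo)%E] = set0 by [].
    by rewrite predeqE => t; split => //=; rewrite ltNge leNye.
by rewrite predeqE => t; rewrite /time_itv /= in_itv /= andbT.
Qed.

Section power.
Variables (T : \bar R) (T0 q c : R) (f : R -> Rn -> R).
Hypotheses (T0T : (T0%:E < T)%E) (lf : Lloc_spacetime q T f).
Local Notation K := (`[0, T0]%classic `*` cube c : set (measurableTypeR R * Rn)).

Let mK : measurable K.
Proof. by apply: measurableX => //; exact: measurable_cube. Qed.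

Let sub : K `<=` [set z | time_itv T z.1].
Proof. by move=> [s x] [] /=; rewrite in_itv /= => sT _; exact: time_itvP T0T sT. Qed.

Let mf : measurable_fun K (fun z => `|f z.1 z.2| `^ q).
Proof.
have [m _] := lf.
apply: (measurableT_comp (measurable_powR q)).
apply: (measurableT_comp (@normr_measurable R setT)).
apply: measurable_funS m => //.
by rewrite -[X in measurable X]setTI; apply: measurable_fst => //; exact: measurable_time_itv.
Qed.

Lemma integrable_spacetime :
  (lebesgue_measure \x leb)%E.-integrable K (EFin \o (fun z => `|f z.1 z.2| `^ q)).
Proof.
apply/integrableP; split; first exact/measurable_EFinP.
have [_ H] := lf.
have cK : compact (K : set (R * Rn)).
  by apply: compact_setX; [exact: segment_compact|exact: compact_cube].
apply: le_lt_trans (H K cK sub).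
apply: ge0_le_integral => //.
- by apply/measurable_EFinP; apply: (measurableT_comp (@normr_measurable R setT)).
- exact/measurable_EFinP.
- by move=> z _; rewrite /= ger0_norm ?powR_ge0.
Qed.

(** Fubini on a space-time box. Only almost every time slice is controlled, so the later lower
    bounds on the sources hold for almost every time. *)
Lemma ae_integrable_power : {ae lebesgue_measure, forall s, 0 <= s <= T0 ->
  leb.-integrable (cube c) (EFin \o (fun x => `|f s x| `^ q))}.
Proof.
have := (integrable_mkcond _ mK).1 integrable_spacetime.
move=> /ae_integrable1; apply: filterS => s + sT.
move=> H; apply/(integrable_mkcond _ (measurable_cube c)).
apply: eq_integrable H => // x _; rewrite !patchE /=.
have -> : ((s, x) \in K) = (x \in cube c) => //.
by apply/idP/idP => /set_mem => [[]|cx]; [move=> _ /mem_set|apply/mem_set; split => //=; rewrite in_itv].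
Qed.

(** Fubini again: the iterated real-valued integral of the source in the weak formulation is a
    genuine one and not a default value. *)
Lemma integrable_power_pairing (k : R) g : cutoff c g ->
  lebesgue_measure.-integrable `[0, T0]
    (EFin \o (fun s => pairing (fun x => `|f s x| `^ q) (fun x => expR (- (k * s)) * g x))).
Proof.
move=> cg; have [mg [C gC]] := cutoff_bounded cg.
pose h (z : measurableTypeR R * Rn) := `|f z.1 z.2| `^ q * (expR (- (k * z.1)) * g z.2).
have mh : measurable_fun K h.
  apply: measurable_funM => //; apply: measurable_funTS; apply: measurable_funM.
    apply: measurableT_comp => //; apply: measurableT_comp => //.
    by apply: measurable_funM => //; exact: measurable_fst.
  by apply: measurableT_comp => //; exact: measurable_snd.
have Ih : (lebesgue_measure \x leb)%E.-integrable K (EFin \o h).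
  have I1 := @integrable_mulrl R _ _ _ K (fun z => `|f z.1 z.2| `^ q)
    (expR (`|k| * `|T0|) * C) mK integrable_spacetime.
  apply: (le_integrable mK _ _ I1); first exact/measurable_EFinP.
  move=> [s x] [/= + _]; rewrite in_itv /= => /andP[s0 sT].
  have C0 : 0 <= C by apply: le_trans (gC x).
  rewrite lee_fin /h /= !normrM [leRHS]mulrC ler_wpM2l//.
  apply: ler_pM => //; last by rewrite (ger0_norm C0).
  rewrite (ger0_norm (expR_ge0 _)) (ger0_norm (expR_ge0 _)) ler_expR -mulNr.
  apply: le_trans (ler_norm _) _; rewrite normrM normrN ler_wpM2l//.
  by rewrite ger0_norm// (le_trans sT)// ler_norm.
have IF0 := integrable_fubini_F ((integrable_mkcond _ mK).1 Ih).
set F := fubini_F _ _ in IF0.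
have IF : lebesgue_measure.-integrable `[0, T0] F by apply: (integrableS _ _ _ IF0).
have E s : s \in `[0, T0]%classic ->
    pairing (fun x => `|f s x| `^ q) (fun x => expR (- (k * s)) * g x) = fine (F s).
  move=> /set_mem sT; rewrite /pairing /Rintegral; congr fine.
  apply: eq_integral => x _; rewrite patchE /=.
  case: ifPn => // /negP H; have [cx|/(proj2 cg)->] := pselect (cube c x).
    by exfalso; apply: H; apply/mem_set.
  by rewrite !mulr0.
have I2 : lebesgue_measure.-integrable `[0, T0] (EFin \o (fine \o F)).
  apply: (le_integrable _ _ _ IF) => //.
    apply/measurable_EFinP; apply: (measurableT_comp (fine_measurable measurableT)).
    exact: measurable_int IF.
  by move=> s _ /=; case: (F s) => [r| |] //=; rewrite normr0 leey.
by apply: eq_integrable I2 => // s sT; rewrite /= E.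
Qed.

End power.
End pairing_in_time.

(** * Weighted means of a weak solution *)

Section functional.
Context {R : realType} {n : nat}.
Local Notation Rn := ('rV[R]_n).
Local Notation leb := (lebesgue_rV R n).
Local Notation mu := (@lebesgue_measure R).

Lemma ae_eq_Rintegral d (X : measurableType d) (m : {measure set X -> \bar R})
    (f h : X -> R) : measurable_fun setT f -> measurable_fun setT h ->
  {ae m, forall x, f x = h x} -> \int[m]_x f x = \int[m]_x h x.
Proof.
move=> mf mh fh; congr fine; apply: ae_eq_integral => //.
- exact/measurable_EFinP.
- exact/measurable_EFinP.
by apply: filterS fh => x /= ->.
Qed.

Lemma within_integrable (f : R -> R) a b : {within `[a, b], continuous f} ->
  mu.-integrable `[a, b] (EFin \o f).
Proof. by move=> cf; apply: continuous_compact_integrable => //; exact: segment_compact. Qed.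

Lemma integrable_mul_within (c f : R -> R) a b : {within `[a, b], continuous f} ->
  mu.-integrable `[a, b] (EFin \o c) ->
  mu.-integrable `[a, b] (EFin \o (fun s => c s * f s)).
Proof.
move=> cf ic.
have bf : [bounded f x | x in `[a, b]%classic].
  have := compact_bounded (continuous_compact cf (@segment_compact R a b)).
  by move=> [M [Mr H]]; exists M; split => // N MN x xab; apply: H => //; exists x.
have H : mu.-integrable `[a, b] ((EFin \o f) \* (EFin \o c))%E.
  apply: integrableMr => //.
  exact: subspace_continuous_measurable_fun cf.
by apply: eq_integrable H => // s _; rewrite /= mulrC.
Qed.

Lemma integrable_subitv (f : R -> R) a b t : b <= t ->
  mu.-integrable `[a, t] (EFin \o f) -> mu.-integrable `[a, b] (EFin \o f).
Proof.
move=> bt; apply: integrableS => // s; rewrite /= !in_itv /= => /andP[-> sb].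
exact: le_trans sb bt.
Qed.

Lemma FTC_within (f df : R -> R) a b : a < b -> {within `[a, b], continuous f} ->
  {within `[a, b], continuous df} ->
  (forall s, a < s < b -> is_derive s (1 : R) f (df s)) ->
  \int[mu]_(s in `[a, b]) df s = f b - f a.
Proof.
move=> ab cf cdf fdf; rewrite /Rintegral (@continuous_FTC2 _ _ f)//.
- have [_ h1 h2] := (continuous_within_itvP f ab).1 cf.
  by split => // s; rewrite in_itv /= => /fdf[].
- by move=> s; rewrite in_itv /= => /fdf[_ <-]; rewrite derive1E.
Qed.

Lemma lt_ereal_room (T : \bar R) (t : R) : (t%:E < T)%E ->
  exists2 d : R, 0 < d & ((t + d)%:E < T)%E.
Proof.
case: T => [r| |] //; rewrite ?lte_fin => tr.
  by exists ((r - t) / 2); rewrite ?lte_fin; lra.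
by exists 1; rewrite ?ltry.
Qed.

Lemma within_ext_left (f h : R -> R) (T0 : R) : 0 < T0 ->
  {within `[0, T0], continuous f} -> {within `[0, T0], continuous h} ->
  (forall t, 0 < t <= T0 -> f t = h t) -> f 0 = h 0.
Proof.
move=> T00 cf ch fh; apply/eqP; rewrite -subr_eq0 -normr_eq0; apply/eqP.
apply/le_anti; rewrite normr_ge0 andbT leNgt; apply/negP => e0.
have z0 : 0 <= (0 : R) <= T0 by rewrite lexx ltW.
have e20 : 0 < `|f 0 - h 0| / 2 by rewrite divr_gt0.
have [d1 d10 H1] := within_dist cf z0 e20.
have [d2 d20 H2] := within_dist ch z0 e20.
pose t := Num.min (Num.min (d1 / 2) (d2 / 2)) T0.
have t0 : 0 < t by rewrite !lt_min T00 !divr_gt0.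
have [t1 [t2 t3]] : t <= d1 / 2 /\ t <= d2 / 2 /\ t <= T0.
  by rewrite /t !ge_min !lexx ?orbT.
have tT : 0 <= t <= T0 by rewrite t3 ltW.
have [td1 td2] : t < d1 /\ t < d2 by split; lra.
have n0 : `|t - 0| = t by rewrite subr0 gtr0_norm.
have A : `|f t - f 0| < `|f 0 - h 0| / 2 by apply: H1; rewrite ?n0.
have B : `|h t - h 0| < `|f 0 - h 0| / 2 by apply: H2; rewrite ?n0.
rewrite fh ?t0// in A.
have := ler_normD (f 0 - h t) (h t - h 0).
by rewrite addrA subrK (distrC (f 0) (h t)); lra.
Qed.

Section identity.
Variables (T : \bar R) (T0 rho eps k : R) (c : R -> R) (om : Rn).
Variables (w1 : Rn -> R) (w dw : R -> Rn -> R) (Dw : R -> 'I_n -> Rn -> R).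
Variable (F : R -> Rn -> R).
Hypotheses (T00 : 0 < T0) (T0T : (T0%:E < T)%E).
Hypotheses (hw : C_W11loc T w Dw) (hdw : C1_L1loc T w dw).
Hypothesis hww : weak_wave T eps c w1 dw Dw F.
Hypothesis supp : forall t, 0 <= t <= T0 ->
  {ae leb, forall x, ~ eball (rho + t) x -> w t x = 0}.
Hypothesis ic : mu.-integrable `[0, T0] (EFin \o c).
Hypothesis omk : \sum_(i < n) om ord0 i ^+ 2 = k ^+ 2.
Let M := rho + T0 + 1.
Let g := wave_weight M om.
Hypothesis hF : mu.-integrable `[0, T0]
  (EFin \o (fun s => pairing (F s) (fun x => expR (- (k * s)) * g x))).
Let y s := expR (- (k * s)) * pairing (w s) g.
Let z s := expR (- (k * s)) * pairing (dw s) g.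

Let cg : cutoff (M + 1) g. Proof. exact: wave_weight_cutoff. Qed.

Let cexp : {within `[0, T0], continuous (fun s => expR (- (k * s)))}.
Proof.
apply: within_comp; first exact: continuous_expR.
apply: within_comp; first exact: opp_continuous.
by apply: withinM; [exact: within_cst|exact: within_id].
Qed.

Lemma functional_continuous : {within `[0, T0], continuous y}.
Proof. by apply: withinM => //; apply: (pairing_continuous T0T _ cg); case: hdw. Qed.

Lemma dfunctional_continuous : {within `[0, T0], continuous z}.
Proof. by apply: withinM => //; apply: (pairing_continuous T0T _ cg); case: hdw. Qed.

Lemma functional_is_derive s : 0 < s < T0 -> is_derive s (1 : R) y (z s - k * y s).
Proof.
move=> sT; have H := pairing_is_derive T0T hdw cg sT.
have He : is_derive s (1 : R) (expR \o (- k \*: id)) (expR (- k * s) * - k).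
  apply: is_derive1_comp; apply: is_derive_eq.
  by rewrite /GRing.scale /= mulr1.
have yE : y = (expR \o (- k \*: id)) * (fun s => pairing (w s) g).
  by apply/funext => t; rewrite /y /= fctE /= /GRing.scale /= mulNr.
have := is_deriveM He H; rewrite -yE => H'; apply: is_derive_eq H' _.
rewrite /z /y /GRing.scale /= !mulNr (_ : - k *: s = - (k * s)); last exact: mulNr.
by ring.
Qed.

Let L1w f : L1loc f -> forall h, cutoff (M + 1) h ->
  leb.-integrable setT (EFin \o (fun x => f x * h x)).
Proof.
move=> lf h ch; have [mh [C hC]] := cutoff_bounded ch.
exact: (integrable_pairing mh hC (proj2 ch) (L1loc_cube _ lf)).
Qed.

(** The weak gradient, tested against the derivatives of g, puts both derivatives on g. The support
    of w at time s lies in |x| < M, where g is an eigenfunction of the Laplacian. *)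
Let laplace s : 0 <= s <= T0 ->
  \sum_(i < n) pairing (Dw s i) ('D_(unit_rV i) g) = - (k ^+ 2 * pairing (w s) g).
Proof.
move=> sT; have si := time_itvP T0T sT.
have [[lw _] gw _] := hw.
have cD i : cutoff (M + 1) ('D_(unit_rV i) g) by exact: cutoff_derive.
have cDD i : cutoff (M + 1) ('D_(unit_rV i) ('D_(unit_rV i) g)) by exact: cutoff_derive.
have E i : pairing (Dw s i) ('D_(unit_rV i) g) =
    - pairing (w s) ('D_(unit_rV i) ('D_(unit_rV i) g)).
  have [_ wp] := gw s si i.
  rewrite /pairing wp ?opprK//; first exact/elementary_smooth/(proj1 (cD i)).
  by have [] := tsupp_sub (@compact_cube R n (M + 1)) (proj2 (cD i)).
under eq_bigr do rewrite E.
rewrite sumrN; congr (- _).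
have I i := L1w (lw s si) (cDD i).
have [_ <-] := Rintegral_sum (index_enum 'I_n) measurableT I.
rewrite /pairing -RintegralZl//; last exact: (L1w (lw s si) cg).
apply: ae_eq_Rintegral.
- by apply: measurable_sum => i; have := measurable_int _ (I i); move/measurable_EFinP.
- apply: measurable_funM => //.
  by have := measurable_int _ (L1w (lw s si) cg); move/measurable_EFinP.
apply: filterS (supp sT) => x Hx; rewrite -mulr_sumr.
have [xr|/Hx->] := pselect (eball (rho + s) x); last by rewrite !mul0r mulr0.
rewrite laplace_wave_weight ?omk; first by rewrite mulrCA.
by apply: le_lt_trans xr _; rewrite /M; lra.
Qed.

Let inner T2 T1 s : T2 < T1 -> T0 < T2 -> 0 <= s <= T0 ->
  \int[leb]_x (- dw s x * dtime (st_test T2 T1 k g) (s, x)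
    + c s * dw s x * st_test T2 T1 k g (s, x)
    + \sum_(i < n) Dw s i x * dspace i (st_test T2 T1 k g) (s, x)) =
  k * (z s - k * y s) + c s * z s.
Proof.
move=> T21 T02 sT; have si := time_itvP T0T sT.
have [[lw _] gw _] := hw; have [_ [ldw _] _] := hdw.
have th : time_cutoff T2 T1 s = 1 by rewrite time_cutoff1//; lra.
pose e := expR (- (k * s)).
have I1 := L1w (ldw s si) cg.
have I2 i := L1w (proj1 (gw s si i)) (cutoff_derive (unit_rV i) cg).
have [I3 S3] := Rintegral_sum (index_enum 'I_n) measurableT I2.
transitivity (\int[leb]_x (((k + c s) * e) * (dw s x * g x) +
    e * (\sum_(i < n) Dw s i x * 'D_(unit_rV i) g x))).
  apply: eq_Rintegral => x _; rewrite dtime_st_test//; last by lra.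
  rewrite /st_test /= th mul1r add0r !mulNr -/e mulr_sumr; congr (_ + _).
    by ring.
  apply: eq_bigr => i _; rewrite (dspace_st_test _ _ _ _ _ _ cg) th mul1r -/e.
  by rewrite mulrCA.
rewrite RintegralD//; [|exact: integrable_mulrl..].
rewrite !RintegralZl// S3.
have := laplace sT; rewrite /pairing => ->.
by rewrite /z /y /pairing -/e; ring.
Qed.

(** Inserting e^(-ks) g into the weak form leaves k (z - k y) + c z under the time integral. As y' =
    z - k y, the first part integrates to k (y t - y 0). *)
Lemma functional_identity t : 0 <= t <= T0 ->
  z t + k * (y t - y 0) + \int[mu]_(s in `[0, t]) (c s * z s) =
  eps * pairing w1 g +
  \int[mu]_(s in `[0, t]) pairing (F s) (fun x => expR (- (k * s)) * g x).
Proof.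
have icz : mu.-integrable `[0, T0] (EFin \o (fun s => c s * z s)).
  exact: integrable_mul_within dfunctional_continuous ic.
have cdy : {within `[0, T0], continuous (fun s => z s - k * y s)}.
  apply: withinD; first exact: dfunctional_continuous.
  apply: within_comp; first exact: opp_continuous.
  by apply: withinM; [exact: within_cst|exact: functional_continuous].
have pos t' : 0 < t' <= T0 -> z t' + k * (y t' - y 0) + \int[mu]_(s in `[0, t']) (c s * z s) =
    eps * pairing w1 g +
    \int[mu]_(s in `[0, t']) pairing (F s) (fun x => expR (- (k * s)) * g x).
  move=> {t} /andP[t0 tT]; move: t' t0 tT => t t0 tT.
  have [d d0 dT] := lt_ereal_room T0T.
  have T21 : T0 + d / 2 < T0 + d by lra.
  have T02 : T0 < T0 + d / 2 by lra.
  have tT' : (t%:E < T)%E by apply: le_lt_trans T0T; rewrite lee_fin.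
  have := hww (st_test_function k T21 dT cg) t0 tT'.
  have th s : 0 <= s <= t -> time_cutoff (T0 + d / 2) (T0 + d) s = 1.
    by move=> st; rewrite time_cutoff1//; lra.
  have -> : \int[mu]_(s in `[0, t])
      \int[leb]_x (- dw s x * dtime (st_test (T0 + d / 2) (T0 + d) k g) (s, x)
        + c s * dw s x * st_test (T0 + d / 2) (T0 + d) k g (s, x)
        + \sum_(i < n) Dw s i x * dspace i (st_test (T0 + d / 2) (T0 + d) k g) (s, x)) =
      \int[mu]_(s in `[0, t]) (k * (z s - k * y s) + c s * z s).
    apply: eq_Rintegral => s /set_mem; rewrite /= in_itv /= => st.
    by apply: inner => //; lra.
  have -> : \int[mu]_(s in `[0, t])
      \int[leb]_x (F s x * st_test (T0 + d / 2) (T0 + d) k g (s, x)) =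
      \int[mu]_(s in `[0, t]) pairing (F s) (fun x => expR (- (k * s)) * g x).
    apply: eq_Rintegral => s /set_mem; rewrite /= in_itv /= => st.
    by apply: eq_Rintegral => x _; rewrite /st_test /= th// mul1r add0r mulNr.
  have -> : \int[leb]_x (dw t x * st_test (T0 + d / 2) (T0 + d) k g (t, x)) = z t.
    have [_ [ldw _] _] := hdw.
    rewrite /z /pairing -RintegralZl//; last first.
      by apply: L1w cg; apply/ldw/(time_itvP T0T); rewrite tT ltW.
    apply: eq_Rintegral => x _; rewrite /st_test /= th ?(ltW t0) ?lexx// mul1r add0r mulNr.
    by ring.
  have -> : \int[leb]_x (w1 x * st_test (T0 + d / 2) (T0 + d) k g (0, x)) = pairing w1 g.
    apply: eq_Rintegral => x _; rewrite /st_test /= th ?(ltW t0) ?lexx// mul1r add0r mulr0.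
    by rewrite expR0 mul1r.
  have Idy : mu.-integrable `[0, t] (EFin \o (fun s => z s - k * y s)).
    by apply: (integrable_subitv tT); exact: within_integrable.
  move=> <-; rewrite RintegralD//; last 2 first.
  - exact: integrable_mulrl.
  - exact: integrable_subitv icz.
  have -> : \int[mu]_(s in `[0, t]) (k * (z s - k * y s)) = k * (y t - y 0).
    rewrite RintegralZl//; congr (_ * _); apply: FTC_within => //.
    - exact: within_subitv functional_continuous (lexx _) tT.
    - exact: within_subitv cdy (lexx _) tT.
    - by move=> s /andP[s0 st]; apply: functional_is_derive; rewrite s0 (lt_le_trans st).
  by ring.
(* The weak form speaks of t > 0 only. Both sides are continuous on [0, T0], which settles t = 0 and
   with it the initial velocity. *)
move=> /andP[]; rewrite le_eqVlt => /predU1P[<- _|t0 tT]; last by apply: pos; rewrite t0.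
pose f t := z t + k * (y t - y 0) + \int[mu]_(s in `[0, t]) (c s * z s).
pose h t := eps * pairing w1 g +
    \int[mu]_(s in `[0, t]) pairing (F s) (fun x => expR (- (k * s)) * g x).
apply: (@within_ext_left f h T0 T00) => //.
- apply: withinD.
    apply: withinD; first exact: dfunctional_continuous.
    apply: withinM; first exact: within_cst.
    by apply: withinD; [exact: functional_continuous|exact: within_cst].
  by apply: (parameterized_integral_continuous (ltW T00)).
- apply: withinD; first exact: within_cst.
  by apply: (parameterized_integral_continuous (ltW T00)).
Qed.

End identity.
End functional.

(** * Initial data and integrated sources *)

Section data.
Context {R : realType} {n : nat}.
Local Notation Rn := ('rV[R]_n).
Local Notation leb := (lebesgue_rV R n).
Local Notation mu := (@lebesgue_measure R).

(** For t > 0 this is part of the notion of solution; at t = 0 the support is inherited from the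
    data. *)
Lemma solution_support (b : R -> R) p q rho eps (u0 u1 v0 v1 : Rn -> R) T u v (t : R) :
  ess_supp u0 `<=` eball rho -> ess_supp v0 `<=` eball rho ->
  weak_solution b p q rho eps u0 u1 v0 v1 T u v ->
  0 <= t -> (t%:E < T)%E ->
  {ae leb, forall x, ~ eball (rho + t) x -> u t x = 0} /\
  {ae leb, forall x, ~ eball (rho + t) x -> v t x = 0}.
Proof.
move=> su0 sv0 [du [dv [Du [Dv [_ _ supp [iu iv] _]]]]].
rewrite le_eqVlt => /predU1P[<- _|t0 tT]; last first.
  have := ess_supp_ae (supp t t0 tT) => H.
  by split; apply: filterS H => x Hx /Hx[].
rewrite addr0; split.
  by apply: filterS2 iu (ess_supp_ae su0) => x -> Hx /Hx ->; rewrite mulr0.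
by apply: filterS2 iv (ess_supp_ae sv0) => x -> Hx /Hx ->; rewrite mulr0.
Qed.

Lemma L1cube_norm c (f : Rn -> R) : L1cube c f -> L1cube c (fun x => `|f x|).
Proof.
move=> [mf If]; split; first exact: (measurableT_comp (@normr_measurable R setT) mf).
have := integrable_abse If; by apply: eq_integrable => //; exact: measurable_cube.
Qed.

Lemma wave_weight_ge0 M (om x : Rn) : 0 <= wave_weight M om x.
Proof. by rewrite mulr_ge0 ?chi_ge0 ?expR_ge0. Qed.

Lemma wave_weight_ball M rho (om x : Rn) : rho <= M -> eball rho x ->
  wave_weight M om x = expR (dotr x om).
Proof.
move=> rM xr; rewrite /wave_weight chi1 ?mul1r// => i.
exact: le_trans (eball_cube xr i) rM.
Qed.

Lemma integrable_wave_pairing M (om : Rn) (f : Rn -> R) : L1cube (M + 1) f ->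
  leb.-integrable setT (EFin \o (fun x => f x * wave_weight M om x)).
Proof.
move=> lf; have cg := wave_weight_cutoff M om.
have [mg [C gC]] := cutoff_bounded cg.
exact: (integrable_pairing mg gC (proj2 cg) lf).
Qed.

Lemma integrable_eball_pairing c rho (f : Rn -> R) : rho <= c -> L1cube c f ->
  leb.-integrable (eball rho) (EFin \o f).
Proof.
move=> rc [mf If]; apply: integrableS If.
- exact: measurable_cube.
- exact: measurable_eball.
by move=> x /eball_cube xr i; exact: le_trans (xr i) rc.
Qed.

(** The bound has to be uniform in M and om, that is, in time and direction. On the ball the weight
    is at least e^(-rho), and the integral of |f| there is positive because f is nontrivial. *)
Lemma data_lower rho (f : Rn -> R) : L1loc f -> admissible_datum rho f ->
  exists2 m : R, 0 < m & forall M (om : Rn), rho <= M ->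
    (forall x, eball rho x -> - rho <= dotr x om) ->
    m <= pairing f (wave_weight M om).
Proof.
move=> lf [f0 fn0 sf].
have mr : measurable (eball rho : set Rn) by exact: measurable_eball.
have If : leb.-integrable (eball rho) (EFin \o (fun x => `|f x|)).
  exact: (integrable_eball_pairing (lexx _) (L1cube_norm (L1loc_cube rho lf))).
pose I := \int[leb]_(x in eball rho) `|f x|.
have I0 : 0 < I.
  have I0 : 0 <= I by apply: Rintegral_ge0.
  rewrite lt_neqAle I0 andbT.
  apply/eqP => /esym Iz; apply: fn0.
  have I00 : (\int[leb]_(x in eball rho) `|(EFin \o f) x| = 0)%E.
    rewrite -[LHS]fineK; first by rewrite -[fine _]/I Iz.
    exact: (integrable_fin_num mr If).
  have mf : measurable_fun (eball rho) (EFin \o f).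
    by apply/measurable_EFinP/measurable_funTS; case: lf.
  have := (ae_eq_integral_abs leb mr mf).1 I00.
  apply: filterS2 (ess_supp_ae sf) => x H1 H2.
  have [/H2 []//|/H1//] := pselect (eball rho x).
exists (expR (- rho) * I); first by rewrite mulr_gt0 ?expR_gt0.
move=> M om rM H.
have lfM := L1loc_cube (M + 1) lf.
have lfn := L1cube_norm lfM.
have -> : pairing f (wave_weight M om) = pairing (fun x => `|f x|) (wave_weight M om).
  have mw := elementary_measurable (proj1 (wave_weight_cutoff M om)).
  apply: ae_eq_Rintegral.
  - by apply: measurable_funM => //; case: lfM.
  - by apply: measurable_funM => //; case: lfn.
  by apply: filterS f0 => x fx; rewrite ger0_norm.
have Ig := integrable_wave_pairing om lfn.
have Igr : leb.-integrable (eball rho) (EFin \o (fun x => `|f x| * wave_weight M om x)).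
  exact: integrableS Ig.
apply: (@le_trans _ _ (\int[leb]_(x in eball rho) (`|f x| * wave_weight M om x))).
  rewrite /I -RintegralZl//; apply: le_Rintegral => //; first exact: integrable_mulrl.
  move=> x xr; rewrite mulrC ler_wpM2l// (wave_weight_ball om rM xr) ler_expR.
  exact: H.
rewrite /pairing /Rintegral fine_le//.
- exact: (integrable_fin_num mr Igr).
- exact: (integrable_fin_num measurableT Ig).
apply: ge0_subset_integral => //.
- by have := measurable_int _ Ig.
- by move=> x _; rewrite lee_fin mulr_ge0 ?wave_weight_ge0.
Qed.

(** Jensen's inequality for a weight dominated by the indicator of a cube of side 2(M+1). *)
Lemma mean_power M (p A : R) (f : Rn -> R) : 0 <= M -> 1 < p -> L1cube (M + 1) f ->
  leb.-integrable (cube (M + 1)) (EFin \o (fun x => `|f x| `^ p)) ->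
  0 <= A -> A <= pairing f (wave_weight M 0) ->
  A `^ p <= ((2 * (M + 1)) ^+ n) `^ (p - 1) *
    pairing (fun x => `|f x| `^ p) (wave_weight M 0).
Proof.
move=> M0 p1 lf Ifp A0 Af.
have lfn := L1cube_norm lf.
have lfp : L1cube (M + 1) (fun x => `|f x| `^ p).
  split => //; apply: (measurableT_comp (measurable_powR p)).
  exact: (proj1 lfn).
have l1 : L1cube (M + 1) (fun _ : Rn => 1).
  split => //; apply: measurable_bounded_integrable => //.
  - exact: measurable_cube.
  - suff : (leb (cube (M + 1)) < +oo)%E by [].
    by rewrite lebesgue_cube ?ltry//; lra.
  by exists 1; split; [exact: num_real|move=> y y1 x _; rewrite normr1 ltW].
have w1 (x : Rn) : wave_weight M 0 x <= \1_(cube (M + 1)) x.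
  rewrite /wave_weight /dotr big1 ?expR0 ?mulr1; last by move=> i _; rewrite mxE mulr0.
  rewrite indicE; have [xc|xc] := pselect (cube (M + 1) x).
    by rewrite mem_set//= chi_le1.
  by rewrite chi0.
have Iw : leb.-integrable setT (EFin \o wave_weight M (0 : Rn)).
  have := integrable_wave_pairing 0 l1.
  by apply: eq_integrable => // x _; rewrite /= mul1r.
have W0 : 0 < (2 * (M + 1)) ^+ n by rewrite exprn_gt0//; lra.
apply: (@jensen_powR R _ _ leb setT f (wave_weight M 0) p A _) => //.
- by move=> x _; exact: wave_weight_ge0.
- exact: integrable_wave_pairing.
- exact: integrable_wave_pairing.
- have mc : measurable (cube (M + 1) : set Rn) by exact: measurable_cube.
  have Ic := (integrable_mkcond _ mc).1 (proj2 l1).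
  rewrite -lee_fin -lebesgue_cube; last lra.
  rewrite /Rintegral fineK; last exact: (integrable_fin_num measurableT Iw).
  rewrite -[leRHS]mul1e -integral_cst// [leRHS]integral_mkcond.
  apply: ge0_le_integral => //.
  + by move=> x _; rewrite lee_fin wave_weight_ge0.
  + exact: measurable_int Iw.
  + have := measurable_int _ Ic; congr (measurable_fun _ _).
  by move=> x _; have := w1 x; rewrite patchE indicE; case: ifP => _ /=.
apply: le_trans Af _; apply: le_Rintegral => //.
- exact: integrable_wave_pairing.
- exact: integrable_wave_pairing.
by move=> x _; rewrite ler_wpM2r ?wave_weight_ge0// ler_norm.
Qed.

Lemma Rintegral_increment (H : R -> R) T0 s t L : 0 <= s -> s <= t -> t <= T0 ->
  mu.-integrable `[0, T0] (EFin \o H) ->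
  {ae mu, forall x, s <= x <= t -> L <= H x} ->
  L * (t - s) <= \int[mu]_(x in `[0, t]) H x - \int[mu]_(x in `[0, s]) H x.
Proof.
move=> s0 st tT IH LH.
have It : mu.-integrable `[0, t] (EFin \o H) by exact: integrable_subitv IH.
rewrite Rintegral_itvB ?bnd_simp//.
have Ist : mu.-integrable `]s, t] (EFin \o H).
  apply: integrableS It => // x; rewrite /= !in_itv /= => /andP[sx xt].
  by rewrite xt (le_trans s0)// ltW.
have mst : measurable (`]s, t] : set R) by [].
have fin : mu `]s, t]%classic = (t - s)%:E.
  rewrite lebesgue_measure_itv /= lte_fin; case: ifPn => //.
  by rewrite -leNgt => ts; congr EFin; lra.
have Ic : mu.-integrable `]s, t] (EFin \o cst L).
  apply: measurable_bounded_integrable => //.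
    suff : (mu `]s, t]%classic < +oo)%E by [].
    by rewrite fin ltry.
  by exists `|L|; split; [exact: num_real|move=> y y1 x _; exact: ltW].
have -> : L * (t - s) = \int[mu]_(x in `]s, t]) L.
  by rewrite Rintegral_cst// -[t - s]/(fine (t - s)%:E) -fin.
rewrite -subr_ge0 -RintegralB//.
have Id : mu.-integrable `]s, t] (EFin \o (fun x => H x - L)) by exact: integrableB Ist Ic.
(* The lower bound L <= H holds almost everywhere only; passing to the absolute value gives a
   pointwise nonnegative integrand with the same integral. *)
have -> : \int[mu]_(x in `]s, t]) (H x - L) = \int[mu]_(x in `]s, t]) `|H x - L|.
  congr fine; apply: ae_eq_integral => //.
  - exact: measurable_int Id.
  - have /measurable_EFinP md := measurable_int _ Id.
    by apply/measurable_EFinP; apply: (measurableT_comp (@normr_measurable R setT)).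
  move: LH; apply: (@filterS _ _ (ae_filter_ringOfSetsType _)) => x Lx; rewrite /= in_itv /= => /andP[sx xt].
  by rewrite ger0_norm// subr_ge0 Lx// xt ltW.
by apply: Rintegral_ge0.
Qed.

End data.

(** * Integrable damping *)

Section components.
Context {R : realType}.
Local Notation mu := (@lebesgue_measure R).

Lemma Rintegral_nondecreasing (H : R -> R) T0 s t : 0 <= s -> s <= t -> t <= T0 ->
  mu.-integrable `[0, T0] (EFin \o H) ->
  {ae mu, forall x, 0 <= x <= T0 -> 0 <= H x} ->
  \int[mu]_(x in `[0, s]) H x <= \int[mu]_(x in `[0, t]) H x.
Proof.
move=> s0 st tT IH H0; rewrite -subr_ge0.
have := @Rintegral_increment R H T0 s t 0 s0 st tT IH.
rewrite mul0r; apply; move: H0.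
apply: (@filterS _ _ (ae_filter_ringOfSetsType _)) => x Hx /andP[sx xt].
by apply: Hx; rewrite (le_trans s0)// (le_trans xt).
Qed.

(** [gronwall] with the primitive of b as beta; it never exceeds the full integral of b, so the
    factor is uniform in time. For means W = z, for plane waves W is z plus the functional
    itself. *)
Lemma scattering_gronwall (b W G z : R -> R) T0 : 0 <= T0 ->
  mu.-integrable `[0, +oo[ (EFin \o b) ->
  {ae mu, forall t, 0 <= t -> 0 <= b t} ->
  {within `[0, T0], continuous z} -> {within `[0, T0], continuous W} ->
  {within `[0, T0], continuous G} ->
  (forall s t, 0 <= s -> s <= t -> t <= T0 -> G s <= G t) -> 0 < G 0 ->
  (forall t, 0 <= t <= T0 -> W t = G t - \int[mu]_(x in `[0, t]) (b x * z x)) ->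
  (forall a, 0 <= a -> a < T0 -> (forall s, 0 <= s <= a -> 0 < W s) ->
     exists2 d, 0 < d & forall s, a <= s <= T0 -> s < a + d -> z s <= W s) ->
  forall t, 0 <= t <= T0 ->
    expR (- (4 * \int[mu]_(x in `[0, +oo[) b x)) * G t <= W t.
Proof.
move=> T00 ib b0 cz cW cG ndG G0 WE Hz t tT.
have ibT : mu.-integrable `[0, T0] (EFin \o b).
  by apply: integrableS ib => // s; rewrite /= !in_itv /= => /andP[->].
have ibz := integrable_mul_within cz ibT.
have b0T : {ae mu, forall x, 0 <= x <= T0 -> 0 <= b x}.
  move: b0; apply: (@filterS _ _ (ae_filter_ringOfSetsType _)) => x bx /andP[x0 _].
  exact: bx.
pose beta t := \int[mu]_(x in `[0, t]) b x.
have ndb s r : 0 <= s -> s <= r -> r <= T0 -> beta s <= beta r.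
  by move=> s0 sr rT; apply: (@Rintegral_nondecreasing b T0).
have beta0 : beta 0 = 0 by rewrite /beta set_itv1 Rintegral_set1.
have betaB : beta t <= \int[mu]_(x in `[0, +oo[) b x.
  have bp : {ae mu, forall x, `[0, +oo[%classic x -> (b x)%:E = `|b x|%:E}.
    move: b0; apply: (@filterS _ _ (ae_filter_ringOfSetsType _)) => x bx.
    by rewrite /= in_itv /= andbT => /bx x0; rewrite ger0_norm.
  have inb : mu.-integrable `[0, +oo[ (EFin \o (fun x => `|b x|)).
    by have := integrable_abse ib; apply: eq_integrable.
  have mnb := measurable_int _ inb.
  have sub : (`[0, t]%classic : set R) `<=` `[0, +oo[%classic.
    by move=> x; rewrite /= !in_itv /= => /andP[->].
  have -> : \int[mu]_(x in `[0, +oo[) b x = \int[mu]_(x in `[0, +oo[) `|b x|.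
    congr fine; apply: ae_eq_integral => //.
    exact: measurable_int ib.
  have -> : beta t = \int[mu]_(x in `[0, t]) `|b x|.
    congr fine; apply: ae_eq_integral => //.
    - exact: measurable_funS (measurable_int _ ib).
    - exact: measurable_funS mnb.
    move: bp; apply: (@filterS _ _ (ae_filter_ringOfSetsType _)) => x bx /sub.
    exact: bx.
  rewrite /Rintegral fine_le//.
  - apply: integrable_fin_num => //; exact: integrableS inb.
  - exact: integrable_fin_num.
  by apply: ge0_subset_integral.
have := @gronwall R W G beta z T0 T00 cW cG _ ndG ndb G0 _ _ Hz t tT.
rewrite beta0 subr0 => H; apply: le_trans (H _ _ _).
- rewrite ler_wpM2r ?ler_expR ?lerN2 ?ler_wpM2l//.
  by apply: le_trans (ltW G0) _; apply: ndG => //; case/andP: tT.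
- exact: parameterized_integral_continuous.
- by rewrite WE ?lexx// set_itv1 Rintegral_set1 subr0.
move=> s r K s0 sr rT K0 zK.
rewrite WE; last by rewrite s0 (le_trans sr).
rewrite WE; last by rewrite rT (le_trans s0).
have IK : mu.-integrable `[0, T0] (EFin \o (fun x => K * b x)) by exact: integrable_mulrl.
have ID : mu.-integrable `[0, T0] (EFin \o (fun x => K * b x - b x * z x)).
  by exact: integrableB IK ibz.
have := @Rintegral_increment R _ T0 s r 0 s0 sr rT ID.
have sT := le_trans sr rT.
rewrite !RintegralB//; last 4 first.
- exact: integrable_subitv IK.
- exact: integrable_subitv ibz.
- exact: integrable_subitv IK.
- exact: integrable_subitv ibz.
rewrite !RintegralZl//; last 2 first.
- exact: integrable_subitv ibT.
- exact: integrable_subitv ibT.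
rewrite mul0r -/(beta r) -/(beta s) => HH.
suff : 0 <= K * beta r - \int[mu]_(x in `[0, r]) (b x * z x) -
    (K * beta s - \int[mu]_(x in `[0, s]) (b x * z x)) by lra.
apply: HH; move: b0; apply: (@filterS _ _ (ae_filter_ringOfSetsType _)) => x bx sx.
have bx0 : 0 <= b x by apply: bx; case/andP: sx => sx _; exact: le_trans s0 sx.
by rewrite mulrC -mulrBr mulr_ge0// subr_ge0 zK.
Qed.

End components.

(** * One equation of the system *)

Section component.
Context {R : realType} {n : nat}.
Local Notation Rn := ('rV[R]_n).
Local Notation leb := (lebesgue_rV R n).
Local Notation mu := (@lebesgue_measure R).

(* One equation of the system on [0, tau]; f is the other unknown.            *)
Record component (T : \bar R) (tau rho eps q : R) (c : R -> R) (w1 : Rn -> R)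
    (w dw : R -> Rn -> R) (Dw : R -> 'I_n -> Rn -> R) (f : R -> Rn -> R) : Prop :=
  Component {
    comp_tau : 1 <= tau; comp_T : (tau%:E < T)%E; comp_rho : 0 < rho;
    comp_q : 1 < q;
    comp_w : C_W11loc T w Dw; comp_dw : C1_L1loc T w dw;
    comp_eq : weak_wave T eps c w1 dw Dw (fun s x => `|f s x| `^ q);
    comp_supp : forall t, 0 <= t <= tau ->
      {ae leb, forall x, ~ eball (rho + t) x -> w t x = 0};
    comp_c : mu.-integrable `[0, tau] (EFin \o c);
    comp_f : Lloc_spacetime q T f }.

Variables (T : \bar R) (tau rho eps q : R) (c : R -> R) (w1 : Rn -> R).
Variables (w dw : R -> Rn -> R) (Dw : R -> 'I_n -> Rn -> R) (f : R -> Rn -> R).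
Hypothesis C : component T tau rho eps q c w1 w dw Dw f.
Let M := rho + tau + 1.
Let g0 := wave_weight M (0 : Rn).

Lemma component_source_ge0 (k : R) (om : Rn) s :
  0 <= pairing (fun x => `|f s x| `^ q) (fun x => expR (- (k * s)) * wave_weight M om x).
Proof.
apply: Rintegral_ge0 => x _.
by rewrite mulr_ge0 ?powR_ge0// mulr_ge0 ?expR_ge0 ?wave_weight_ge0.
Qed.

(** The case k = 0, om = 0 of [functional_identity], where the weight is 1 on the light cone. *)
Lemma component_mean :
  [/\ {within `[0, tau], continuous (fun t => pairing (w t) g0)},
      {within `[0, tau], continuous (fun t => pairing (dw t) g0)},
      forall s, 0 < s < tau ->
        is_derive s (1 : R) (fun t => pairing (w t) g0) (pairing (dw s) g0),
      mu.-integrable `[0, tau]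
        (EFin \o (fun s => pairing (fun x => `|f s x| `^ q) g0)) &
      forall t, 0 <= t <= tau ->
        pairing (dw t) g0 + \int[mu]_(s in `[0, t]) (c s * pairing (dw s) g0) =
        eps * pairing w1 g0 +
        \int[mu]_(s in `[0, t]) pairing (fun x => `|f s x| `^ q) g0].
Proof.
have e1 s : expR (- (0 * s)) = 1 :> R by rewrite mul0r oppr0 expR0.
have eg : forall h : R -> Rn -> R, (fun s => pairing (h s) (fun x => expR (- (0 * s)) * g0 x)) =
    (fun s => pairing (h s) g0).
  by move=> h; apply/funext => s; apply: eq_Rintegral => x _; rewrite e1 mul1r.
have ey h : (fun s => expR (- (0 * s)) * pairing (h s) g0) = (fun s => pairing (h s) g0).
  by apply/funext => s; rewrite e1 mul1r.
have om0 : \sum_(i < n) (0 : Rn) ord0 i ^+ 2 = 0 ^+ 2 :> R.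
  by rewrite big1 ?expr0n// => i _; rewrite mxE expr0n.
have tau0 : 0 < tau by case: C => ? *; lra.
have IH : mu.-integrable `[0, tau] (EFin \o (fun s => pairing (fun x => `|f s x| `^ q)
    (fun x => expR (- (0 * s)) * g0 x))).
  exact: (integrable_power_pairing (comp_T C) (comp_f C) 0 (wave_weight_cutoff M 0)).
have F1 := functional_continuous (k := 0) (rho := rho) (om := 0) (comp_T C) (comp_dw C).
have F2 := dfunctional_continuous (k := 0) (rho := rho) (om := 0) (comp_T C) (comp_dw C).
have F3 := @functional_is_derive R n T tau rho 0 0 w dw (comp_T C) (comp_dw C).
have F4 := functional_identity tau0 (comp_T C) (comp_w C) (comp_dw C) (comp_eq C)
  (comp_supp C) (comp_c C) om0 IH.
split.
- by move: F1; rewrite ey.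
- by move: F2; rewrite ey.
- move=> s sT; have := F3 s sT; rewrite ey => H; apply: is_derive_eq H _.
  by rewrite e1 mul1r mul0r subr0.
- by move: IH; rewrite eg.
move=> t tT; have := F4 t tT; rewrite !e1 !mul1r mul0r addr0 eg => <-.
by congr (_ + _); apply: eq_Rintegral => s _; rewrite e1 mul1r.
Qed.

End component.

(** * Lower bounds for the means *)

Section lower_bounds.
Context {R : realType} {n : nat}.
Local Notation Rn := ('rV[R]_n).
Local Notation leb := (lebesgue_rV R n).
Local Notation mu := (@lebesgue_measure R).

Lemma damping_ge0 (b : R -> R) : mu.-integrable `[0, +oo[ (EFin \o b) ->
  {ae mu, forall t, 0 <= t -> 0 <= b t} -> 0 <= \int[mu]_(x in `[0, +oo[) b x.
Proof.
move=> ib b0.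
have inb : mu.-integrable `[0, +oo[ (EFin \o (fun x => `|b x|)).
  by have := integrable_abse ib; apply: eq_integrable.
have -> : \int[mu]_(x in `[0, +oo[) b x = \int[mu]_(x in `[0, +oo[) `|b x|.
  congr fine; apply: ae_eq_integral => //.
  - exact: measurable_int ib.
  - exact: measurable_int inb.
  move: b0; apply: (@filterS _ _ (ae_filter_ringOfSetsType _)) => x bx.
  by rewrite /= in_itv /= andbT => /bx x0; rewrite ger0_norm.
exact: Rintegral_ge0.
Qed.

Variables (T : \bar R) (tau rho eps q : R) (w1 : Rn -> R).
Variables (w dw : R -> Rn -> R) (Dw : R -> 'I_n -> Rn -> R) (f : R -> Rn -> R).
Let M := rho + tau + 1.
Let g0 := wave_weight M (0 : Rn).
Let H s := pairing (fun x => `|f s x| `^ q) g0.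

Let H0 s : 0 <= H s.
Proof. by apply: Rintegral_ge0 => x _; rewrite mulr_ge0 ?powR_ge0 ?wave_weight_ge0. Qed.

Let ndIH s t : 0 <= s -> s <= t -> t <= tau -> mu.-integrable `[0, tau] (EFin \o H) ->
  \int[mu]_(x in `[0, s]) H x <= \int[mu]_(x in `[0, t]) H x.
Proof.
move=> s0 st tT IH; apply: (@Rintegral_nondecreasing R H tau) => //.
by apply: (filterE (F := almost_everywhere mu)) => x _; exact: H0.
Qed.

(** With damping 1 the identity integrates to U' = G - U. As G is nondecreasing, from time a on U
    relaxes at rate 1 towards a level of at least G(a). *)
Lemma damped_mean_lower : component T tau rho eps q (fun=> 1) w1 w dw Dw f ->
  0 <= pairing (w 0) g0 -> 0 <= eps * pairing w1 g0 ->
  forall a t, 0 <= a -> a <= t -> t <= tau ->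
  (1 - expR (- (t - a))) *
    (pairing (w 0) g0 + eps * pairing w1 g0 + \int[mu]_(x in `[0, a]) H x)
  <= pairing (w t) g0.
Proof.
move=> C U0 W1; have [cU cZ dU IH id] := component_mean C.
pose U t := pairing (w t) g0; pose Z t := pairing (dw t) g0.
pose G t := U 0 + eps * pairing w1 g0 + \int[mu]_(x in `[0, t]) H x.
have ZE t : 0 < t -> t < tau -> Z t = G t - U t.
  move=> t0 tT; have := id t; rewrite (ltW t0) (ltW tT) => /(_ isT).
  have -> : \int[mu]_(s in `[0, t]) (1 * pairing (dw s) g0) = U t - U 0.
    have -> : \int[mu]_(s in `[0, t]) (1 * pairing (dw s) g0) = \int[mu]_(s in `[0, t]) Z s.
      by apply: eq_Rintegral => s _; rewrite mul1r.
    apply: FTC_within => //.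
    - exact: within_subitv cU (lexx _) (ltW tT).
    - exact: within_subitv cZ (lexx _) (ltW tT).
    by move=> s /andP[s0 st]; apply: dU; rewrite s0 (lt_trans st).
  rewrite -/(H _) -/(U _) -/(Z _) /G; set I := Rintegral _ _ _.
  by rewrite -[X in _ = _ + X]/I => ?; lra.
have relax a t : 0 <= a -> a <= t -> t <= tau ->
    G a * (1 - expR (- (1 * (t - a)))) + expR (- (1 * (t - a))) * U a <= U t.
  move=> a0 at_ tT; apply: (@relaxation _ U Z) => //.
  - exact: within_subitv cU a0 tT.
  - by move=> x /andP[ax xt]; apply: dU; rewrite (le_lt_trans a0 ax) (lt_le_trans xt tT).
  move=> x /andP[ax xt]; rewrite mul1r ZE; [|exact: le_lt_trans ax|exact: lt_le_trans tT].
  rewrite lerD2r /G lerD2l; apply: ndIH => //; first exact: ltW.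
  by apply: (le_trans (ltW xt)).
have e1 t : 0 <= t -> 0 <= 1 - expR (- (1 * t)).
  by move=> t0; rewrite subr_ge0 -[leRHS]expR0 ler_expR mul1r oppr_le0.
have G0 t : 0 <= G t.
  by rewrite addr_ge0 ?addr_ge0//; apply: Rintegral_ge0 => x _; exact: H0.
have Upos t : 0 <= t -> t <= tau -> 0 <= U t.
  move=> t0 tT; apply: le_trans (relax 0 t (lexx _) t0 tT).
  by rewrite addr_ge0 ?mulr_ge0 ?expR_ge0 ?e1// subr0.
move=> a t a0 at_ tT; apply: le_trans (relax a t a0 at_ tT).
rewrite mul1r mulrC lerDl mulr_ge0 ?expR_ge0// Upos//; exact: le_trans tT.
Qed.

Variable b : R -> R.
Hypothesis ib : mu.-integrable `[0, +oo[ (EFin \o b).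
Hypothesis b0 : {ae mu, forall t, 0 <= t -> 0 <= b t}.
Let delta := expR (- (4 * \int[mu]_(x in `[0, +oo[) b x)).

(** The derivative Z of the mean satisfies Z = G - int b Z, hence Z >= delta G by
    [scattering_gronwall]; the mean value theorem and the monotonicity of G conclude. *)
Lemma scattering_mean_lower : component T tau rho eps q b w1 w dw Dw f ->
  0 < eps * pairing w1 g0 ->
  forall a t, 0 <= a -> a <= t -> t <= tau ->
  delta * (eps * pairing w1 g0 + \int[mu]_(x in `[0, a]) H x) * (t - a)
  <= pairing (w t) g0 - pairing (w a) g0.
Proof.
move=> C W1; have [cU cZ dU IH id] := component_mean C.
pose Z t := pairing (dw t) g0.
pose G t := eps * pairing w1 g0 + \int[mu]_(x in `[0, t]) H x.
have tau0 : 0 <= tau by case: C => *; lra.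
have ndG s t : 0 <= s -> s <= t -> t <= tau -> G s <= G t.
  by move=> s0 st tT; rewrite lerD2l; apply: ndIH.
have G00 : 0 < G 0 by rewrite /G set_itv1 Rintegral_set1 addr0.
have ZG t : 0 <= t <= tau -> delta * G t <= Z t.
  apply: (@scattering_gronwall R b Z G Z tau tau0) => //.
  - by apply: withinD; [exact: within_cst|exact: parameterized_integral_continuous].
  - by move=> s sT; have := id s sT; rewrite -/(Z _) -/(H _) /G => <-; rewrite addrK.
  - by move=> a a0 aT _; exists 1 => // s _ _.
move=> a t a0; rewrite le_eqVlt => /predU1P[<- _|at_ tT]; first by rewrite !subrr mulr0.
have dU' x : x \in `]a, t[ -> is_derive x 1 (fun s => pairing (w s) g0) (Z x).
  by rewrite in_itv /= => /andP[ax xt]; apply: dU; rewrite (le_lt_trans a0 ax) (lt_le_trans xt tT).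
have [x] := MVT at_ dU' (within_subitv cU a0 tT).
rewrite in_itv /= => /andP[ax xt] ->.
rewrite ler_wpM2r ?subr_ge0 ?(ltW at_)//.
apply: le_trans (ZG x _); last by rewrite (le_trans a0 (ltW ax)) (le_trans (ltW xt) tT).
rewrite ler_wpM2l ?expR_ge0//; apply: ndG => //; first exact: ltW.
exact: le_trans (ltW xt) tT.
Qed.

(** Put P = z + y, so that P = G - int b z and y' = P - 2y. While P is positive, y stays positive,
    hence z <= P shortly afterwards and the Gronwall argument applies. Then P >= delta y(0), and y
    relaxes at rate 2 towards a level of at least delta y(0) / 2. *)
Lemma plane_wave_lower (om : Rn) : component T tau rho eps q b w1 w dw Dw f ->
  \sum_(i < n) om ord0 i ^+ 2 = 1 ->
  0 < pairing (w 0) (wave_weight M om) -> 0 <= eps * pairing w1 (wave_weight M om) ->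
  forall t, 0 <= t <= tau ->
  delta / 2 * pairing (w 0) (wave_weight M om) <=
    expR (- t) * pairing (w t) (wave_weight M om).
Proof.
move=> C om1 Y0 W1; set g := wave_weight M om in Y0 W1 *.
have om1' : \sum_(i < n) om ord0 i ^+ 2 = 1 ^+ 2 by rewrite expr1n.
have tau0 : 0 < tau by case: C => *; lra.
pose y s := expR (- (1 * s)) * pairing (w s) g.
pose z s := expR (- (1 * s)) * pairing (dw s) g.
pose Ho s := pairing (fun x => `|f s x| `^ q) (fun x => expR (- (1 * s)) * g x).
have Ho0 s : 0 <= Ho s by exact: component_source_ge0.
have IH : mu.-integrable `[0, tau] (EFin \o Ho).
  exact: (integrable_power_pairing (comp_T C) (comp_f C) 1 (wave_weight_cutoff M om)).
have cy : {within `[0, tau], continuous y}.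
  exact: functional_continuous (comp_T C) (comp_dw C).
have cz : {within `[0, tau], continuous z}.
  exact: dfunctional_continuous (comp_T C) (comp_dw C).
have dy s : 0 < s < tau -> is_derive s (1 : R) y (z s - 1 * y s).
  exact: (@functional_is_derive R n T tau rho 1 om w dw (comp_T C) (comp_dw C)).
have id := functional_identity tau0 (comp_T C) (comp_w C) (comp_dw C) (comp_eq C)
  (comp_supp C) (comp_c C) om1' IH.
have y0E : y 0 = pairing (w 0) g by rewrite /y mulr0 oppr0 expR0 mul1r.
pose P s := z s + y s.
pose G s := y 0 + eps * pairing w1 g + \int[mu]_(x in `[0, s]) Ho x.
have ndG s t : 0 <= s -> s <= t -> t <= tau -> G s <= G t.
  move=> s0 st tT; rewrite lerD2l; apply: (@Rintegral_nondecreasing R Ho tau) => //.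
  by apply: (filterE (F := almost_everywhere mu)) => x _; exact: Ho0.
have G00 : 0 < G 0.
  by rewrite /G set_itv1 Rintegral_set1 addr0 y0E ltr_pwDl.
have cP : {within `[0, tau], continuous P} by exact: withinD.
have relax c a : 0 <= a -> a <= tau -> (forall x, 0 < x < a -> 2 * c <= P x) ->
    c * (1 - expR (- (2 * (a - 0)))) + expR (- (2 * (a - 0))) * y 0 <= y a.
  move=> a0 aT HP; apply: (@relaxation _ y (fun s => z s - 1 * y s)) => //.
  - exact: within_subitv cy (lexx _) aT.
  - by move=> x /andP[x0 xa]; apply: dy; rewrite x0 (lt_le_trans xa).
  - by move=> x xa; have := HP x xa; rewrite /P; lra.
have PG t : 0 <= t <= tau -> delta * G t <= P t.
  apply: (@scattering_gronwall R b P G z tau (ltW tau0)) => //.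
  - by apply: withinD; [exact: within_cst|exact: parameterized_integral_continuous (ltW tau0) IH].
  - move=> s sT; have := id s sT; rewrite -/g -/(z s) -/(y s) -/(y 0) mul1r => E.
    rewrite /G /P; set I := Rintegral _ _ _ in E.
    set I' := \int[mu]_(x in `[0, s]) Ho x; set I2 := \int[mu]_(x in `[0, s]) (b x * z x).
    have : z s + (y s - y 0) + I2 = eps * pairing w1 g + I' by exact: E.
    by lra.
  - move=> a a0 aT HP.
    (* Relaxation towards the level 0: y(a) >= e^(-2a) y(0) as long as P >= 0 before a. *)
    have ya : 0 < y a.
      have := relax 0 a a0 (ltW aT); rewrite mul0r add0r subr0 => H1.
      apply: lt_le_trans (H1 _); first by rewrite mulr_gt0 ?expR_gt0 ?y0E.
      move=> x /andP[x0 xa]; rewrite mulr0; apply/ltW/HP.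
      by rewrite (ltW x0) (ltW xa).
    have aT' : 0 <= a <= tau by rewrite a0 ltW.
    have [d d0 Hd] := within_dist cy aT' ya; exists d => // s /andP[as_ sT] sd.
    have := Hd s; rewrite (le_trans a0 as_) sT => /(_ isT).
    rewrite ger0_norm ?subr_ge0// ltr_norml /P => H1.
    have : s - a < d by lra.
    by move=> /H1; lra.
have B0 := damping_ge0 ib b0.
have d1 : delta <= 1 by rewrite -[leRHS]expR0 ler_expR oppr_le0 mulr_ge0.
move=> t tT; have /andP[t0 tT'] := tT.
have -> : expR (- t) * pairing (w t) g = y t by rewrite /y mul1r.
rewrite -y0E; have yp : 0 < y 0 by rewrite y0E.
have dp : 0 < delta by exact: expR_gt0.
apply: le_trans (relax (delta / 2 * y 0) t t0 tT' _).
  have e0 := expR_gt0 (- (2 * (t - 0))).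
  have : delta / 2 * y 0 <= y 0 by nra.
  set e := expR _ in e0 *; nra.
move=> x /andP[x0 xt]; have xT : 0 <= x <= tau by rewrite (ltW x0) (le_trans (ltW xt) tT').
apply: le_trans (PG x xT).
have : y 0 <= G x.
  rewrite /G -addrA lerDl addr_ge0//; apply: Rintegral_ge0 => s _; exact: Ho0.
by move=> /(ler_wpM2l (ltW dp)); lra.
Qed.

End lower_bounds.

(** * The coupled system *)

Section solution.
Context {R : realType} {m : nat}.
Local Notation n := m.+1.
Local Notation Rn := ('rV[R]_n).
Local Notation leb := (lebesgue_rV R n).
Local Notation mu := (@lebesgue_measure R).

(** The right-hand side is one round of the coupling in the order in which [forcing_step] produces
    it; the left-hand side has the shape required by [iteration]. *)
Lemma step_algebra (W d k h G p q : R) : 0 < W -> 0 < d -> 0 < k -> 0 < h -> 0 <= G ->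
  d `^ p * W `^ (1 - p * q) * h `^ (1 + 2 * p) * k `^ (p * q) * G `^ (p * q) =
  W `^ (1 - p) * (d * (W `^ (1 - q) * (k * G) `^ q * h) * h) `^ p * h.
Proof.
move=> W0 d0 k0 h0 G0.
have -> : d * (W `^ (1 - q) * (k * G) `^ q * h) * h =
    d * (W `^ (1 - q) * (k `^ q * G `^ q) * h `^ 2).
  by rewrite powRM ?(ltW k0)// powR_mulrn ?(ltW h0)//; ring.
rewrite !powRM ?mulr_ge0 ?powR_ge0 ?(ltW d0)// -!powRrM.
have -> : 1 - p * q = (1 - p) + (1 - q) * p by ring.
rewrite [W `^ (_ + _)]powRD ?(gt_eqF W0) ?implybT//.
rewrite [h `^ (_ + _)]powRD ?(gt_eqF h0) ?implybT// powRr1 ?(ltW h0)//.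
by rewrite (mulrC p q); ring.
Qed.

(** The exceptional null set comes from the integrability of the time slices alone and is common to
    all A. *)
Lemma ae_mean_power (T : \bar R) (tau rho q : R) (f : R -> Rn -> R) :
  0 < tau -> 0 < rho -> (tau%:E < T)%E -> 1 < q -> C_L1loc T f -> Lloc_spacetime q T f ->
  {ae mu, forall s, 0 <= s <= tau -> forall A, 0 <= A ->
    A <= pairing (f s) (wave_weight (rho + tau + 1) 0) ->
    ((2 * (rho + tau + 1 + 1)) ^+ n) `^ (1 - q) * A `^ q <=
    pairing (fun x => `|f s x| `^ q) (wave_weight (rho + tau + 1) 0)}.
Proof.
move=> tau0 rho0 tT q1 [lf _] Lf.
have := @ae_integrable_power R n T tau q (rho + tau + 1 + 1) f tT Lf.
apply: (@filterS _ _ (ae_filter_ringOfSetsType _)) => s Is sT A A0 Af.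
have W0 : 0 < (2 * (rho + tau + 1 + 1)) ^+ n by rewrite exprn_gt0//; lra.
have -> : 1 - q = - (q - 1) by ring.
rewrite powRN mulrC ler_pdivrMr ?powR_gt0// mulrC.
apply: mean_power => //; first lra.
  exact/L1loc_cube/lf/(time_itvP tT).
exact: Is.
Qed.

Variables (T : \bar R) (tau rho eps p q m0 : R) (b : R -> R).
Variables (u1 v1 : Rn -> R) (u du v dv : R -> Rn -> R) (Du Dv : R -> 'I_n -> Rn -> R).
Hypotheses (C1 : component T tau rho eps p (fun=> 1) u1 u du Du v).
Hypotheses (C2 : component T tau rho eps q b v1 v dv Dv u).
Hypothesis ib : mu.-integrable `[0, +oo[ (EFin \o b).
Hypothesis b0 : {ae mu, forall t, 0 <= t -> 0 <= b t}.
Hypotheses (eps0 : 0 < eps) (m00 : 0 < m0).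
Let M := rho + tau + 1.
Let g0 := wave_weight M (0 : Rn).
Hypotheses (hu0 : eps * m0 <= pairing (u 0) g0) (hu1 : m0 <= pairing u1 g0).
Hypothesis hv0 : forall om : Rn, (forall x, eball rho x -> - rho <= dotr x om) ->
  eps * m0 <= pairing (v 0) (wave_weight M om).
Hypothesis hv1 : forall om : Rn, (forall x, eball rho x -> - rho <= dotr x om) ->
  m0 <= pairing v1 (wave_weight M om).
Let delta := expR (- (4 * \int[mu]_(x in `[0, +oo[) b x)).
Let W := (2 * (M + 1)) ^+ n.
Let F s := pairing (fun x => `|v s x| `^ p) g0.
Let H s := pairing (fun x => `|u s x| `^ q) g0.

(* The mean of u satisfies U' + U = forcing.                                  *)
Definition forcing (a : R) :=
  pairing (u 0) g0 + eps * pairing u1 g0 + \int[mu]_(x in `[0, a]) F x.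

Let tau1 : 1 <= tau. Proof. by case: C1. Qed.
Let tau0 : 0 < tau. Proof. by have := tau1; lra. Qed.
Let rho0 : 0 < rho. Proof. by case: C1. Qed.
Let tT : (tau%:E < T)%E. Proof. by case: C1. Qed.
Let p1 : 1 < p. Proof. by case: C1. Qed.
Let q1 : 1 < q. Proof. by case: C2. Qed.
Let d0 : 0 < delta. Proof. exact: expR_gt0. Qed.
Let W0 : 0 < W. Proof. by rewrite exprn_gt0// /M; have := tau1; have := rho0; lra. Qed.

Let IF : mu.-integrable `[0, tau] (EFin \o F).
Proof. by have [] := component_mean C1. Qed.
Let IH : mu.-integrable `[0, tau] (EFin \o H).
Proof. by have [] := component_mean C2. Qed.

Let F0 s : 0 <= F s.
Proof. by apply: Rintegral_ge0 => x _; rewrite mulr_ge0 ?powR_ge0 ?wave_weight_ge0. Qed.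
Let H0 s : 0 <= H s.
Proof. by apply: Rintegral_ge0 => x _; rewrite mulr_ge0 ?powR_ge0 ?wave_weight_ge0. Qed.

Let g0dir (x : Rn) : eball rho x -> - rho <= dotr x (0 : Rn).
Proof.
move=> _; rewrite /dotr big1 ?oppr_le0 ?(ltW rho0)// => i _.
by rewrite mxE mulr0.
Qed.

Let U0 : 0 <= pairing (u 0) g0.
Proof. by apply: le_trans hu0; rewrite mulr_ge0 ?ltW. Qed.
Let U1 : 0 < eps * pairing u1 g0.
Proof. by rewrite mulr_gt0// (lt_le_trans m00). Qed.
Let V0 : 0 < pairing (v 0) g0.
Proof. by apply: lt_le_trans (hv0 g0dir); rewrite mulr_gt0. Qed.
Let V1 : 0 < eps * pairing v1 g0.
Proof. by rewrite mulr_gt0// (lt_le_trans m00)// hv1. Qed.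

Let Vlow a t : 0 <= a -> a <= t -> t <= tau ->
  delta * (eps * pairing v1 g0 + \int[mu]_(x in `[0, a]) H x) * (t - a)
    <= pairing (v t) g0 - pairing (v a) g0.
Proof. exact: (scattering_mean_lower ib b0 C2 V1). Qed.

Let IHpos a : 0 <= \int[mu]_(x in `[0, a]) H x.
Proof. by apply: Rintegral_ge0 => x _; exact: H0. Qed.

Let Vpos t : 0 <= t -> t <= tau -> 0 <= pairing (v t) g0.
Proof.
move=> t0 tt; have := Vlow (lexx 0) t0 tt.
have : 0 <= delta * (eps * pairing v1 g0 + \int[mu]_(x in `[0, 0]) H x) * (t - 0).
  by rewrite !mulr_ge0 ?(ltW d0) ?subr0// addr_ge0// ltW.
have := V0; lra.
Qed.

Let aeF : {ae mu, forall s, 0 <= s <= tau -> forall A, 0 <= A ->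
  A <= pairing (v s) g0 -> W `^ (1 - p) * A `^ p <= F s}.
Proof.
have [cv _ _] := comp_w C2.
exact: (ae_mean_power tau0 rho0 tT p1 cv (comp_f C1)).
Qed.

Let aeH : {ae mu, forall s, 0 <= s <= tau -> forall A, 0 <= A ->
  A <= pairing (u s) g0 -> W `^ (1 - q) * A `^ q <= H s}.
Proof.
have [cu _ _] := comp_w C1.
exact: (ae_mean_power tau0 rho0 tT q1 cu (comp_f C2)).
Qed.

Lemma forcing_nondecreasing s t : 0 <= s -> s <= t -> t <= tau -> forcing s <= forcing t.
Proof.
move=> s0 st tt; rewrite lerD2l.
apply: (@Rintegral_nondecreasing R F tau _ _ s0 st tt IF).
by apply: (filterE (F := almost_everywhere mu)) => x _; exact: F0.
Qed.

Lemma forcing_ge_data a : eps * m0 <= forcing a.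
Proof.
rewrite /forcing -addrA; apply: le_trans hu0 _; rewrite lerDl.
by apply: (addr_ge0 (ltW U1)); apply: Rintegral_ge0 => x _; exact: F0.
Qed.

Lemma forcing_increment s t L : 0 <= s -> s <= t -> t <= tau ->
  {ae mu, forall x, s <= x <= t -> L <= F x} -> L * (t - s) <= forcing t.
Proof.
move=> s0 st tt LF; have := Rintegral_increment s0 st tt IF LF.
have : 0 <= \int[mu]_(x in `[0, s]) F x by apply: Rintegral_ge0 => x _; exact: F0.
by rewrite /forcing; have := U0; have := U1; lra.
Qed.

(** Four intervals of length h. After the first one, U is at least k G(a) by relaxation; on the
    second, Jensen bounds H below; during the third, V grows by the integral of H times h; on the
    fourth, Jensen bounds F below, and integration gives the increase of G. *)
Lemma forcing_step a h : 0 <= a -> 0 < h -> a + 4 * h <= tau ->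
  delta `^ p * W `^ (1 - p * q) * h `^ (1 + 2 * p) *
    (1 - expR (- h)) `^ (p * q) * forcing a `^ (p * q) <= forcing (a + 4 * h).
Proof.
move=> a0 h0 ah.
have G0 : 0 <= forcing a by apply: le_trans (forcing_ge_data a); rewrite mulr_ge0 ?ltW.
set k := 1 - expR (- h).
have k0 : 0 < k by rewrite subr_gt0 -[ltRHS]expR0 ltr_expR oppr_lt0.
rewrite step_algebra//.
set L1 := W `^ (1 - q) * (k * forcing a) `^ q.
have L10 : 0 <= L1 by rewrite mulr_ge0 ?powR_ge0.
have dL0 : 0 <= delta * (L1 * h).
  by apply: mulr_ge0; [exact: ltW|apply: mulr_ge0; [exact: L10|exact: ltW]].
have HL : {ae mu, forall s, a + h <= s <= a + 2 * h -> L1 <= H s}.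
  move: aeH; apply: (@filterS _ _ (ae_filter_ringOfSetsType _)) => s Hs /andP[s1 s2].
  apply: Hs; [by apply/andP; split; lra|by rewrite mulr_ge0 ?(ltW k0)|].
  have := @damped_mean_lower R n T tau rho eps p u1 u du Du v C1 U0 (ltW U1) a s a0 ltac:(lra) ltac:(lra).
  apply: le_trans; rewrite -/(forcing a) ler_wpM2r//.
  by rewrite lerD2l lerN2 ler_expR lerN2; lra.
have IL : L1 * h <= \int[mu]_(x in `[0, a + 2 * h]) H x.
  have := @Rintegral_increment R H tau (a + h) (a + 2 * h) L1 ltac:(lra) ltac:(lra) ltac:(lra) IH HL.
  have := IHpos (a + h).
  have -> : a + 2 * h - (a + h) = h by ring.
  by lra.
apply: le_trans (_ : W `^ (1 - p) * (delta * (L1 * h) * h) `^ p * (a + 4 * h - (a + 3 * h)) <= _).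
  by have -> : a + 4 * h - (a + 3 * h) = h by ring.
apply: forcing_increment; [lra|lra|lra|].
move: aeF; apply: (@filterS _ _ (ae_filter_ringOfSetsType _)) => s Fs /andP[s1 s2].
apply: Fs; [by apply/andP; split; lra|by apply: mulr_ge0; [exact: dL0|exact: ltW]|].
have v0 := Vpos (ltac:(lra) : 0 <= a + 2 * h) ltac:(lra).
have := Vlow (ltac:(lra) : 0 <= a + 2 * h) (ltac:(lra) : a + 2 * h <= s) ltac:(lra).
set I := Rintegral _ _ _ in IL *.
have i1 : L1 * h <= eps * pairing v1 g0 + I by have := V1; lra.
have i2 : h <= s - (a + 2 * h) by lra.
have : delta * (L1 * h) * h <= delta * (eps * pairing v1 g0 + I) * (s - (a + 2 * h)).
  apply: ler_pM => //; first exact: ltW.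
  by rewrite ler_wpM2l// ltW.
by lra.
Qed.

(** The data alone let the mean of v grow linearly in time. On [tau/4, tau/2] Jensen over the whole
    cube converts this into a lower bound on F. *)
Lemma forcing_ge_linear :
  W `^ (1 - p) * (delta * (eps * m0) * (tau / 4)) `^ p * (tau / 4) <= forcing (tau / 2).
Proof.
have t1 := tau0.
have -> : W `^ (1 - p) * (delta * (eps * m0) * (tau / 4)) `^ p * (tau / 4) =
    W `^ (1 - p) * (delta * (eps * m0) * (tau / 4)) `^ p * (tau / 2 - tau / 4).
  by congr (_ * _); field.
apply: forcing_increment; [lra|lra|lra|].
move: aeF; apply: (@filterS _ _ (ae_filter_ringOfSetsType _)) => s Fs /andP[s1 s2].
have dem : 0 <= delta * (eps * m0) by rewrite !mulr_ge0 ?(ltW d0) ?(ltW eps0) ?(ltW m00).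
apply: Fs; [by apply/andP; split; lra|by rewrite mulr_ge0//; lra|].
have := Vlow (lexx 0) (ltac:(lra) : 0 <= s) ltac:(lra).
rewrite set_itv1 Rintegral_set1 addr0 subr0.
have : delta * (eps * m0) * (tau / 4) <= delta * (eps * pairing v1 g0) * s.
  apply: ler_pM => //; first lra.
  by rewrite ler_wpM2l ?(ltW d0)// ler_wpM2l ?(ltW eps0)// hv1.
by have := V0; lra.
Qed.

(** Cauchy-Schwarz, read off from [dotr_le_gauss] for the direction - om. *)
Let dir1 (om x : Rn) : \sum_(i < n) om ord0 i ^+ 2 = 1 -> eball rho x -> - rho <= dotr x om.
Proof.
move=> om1 xr.
have omN : \sum_(i < n) (- om) ord0 i ^+ 2 = 1.
  by rewrite -om1; apply: eq_bigr => i _; rewrite mxE sqrrN.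
have := dotr_le_gauss rho0 xr omN.
have -> : dotr x (- om) = - dotr x om.
  by rewrite /dotr -sumrN; apply: eq_bigr => i _; rewrite mxE mulrN.
set S := \sum_(i < n) _; have S0 : 0 <= S by apply: sumr_ge0 => i _; exact: sqr_ge0.
have : 0 <= S / (2 * rho) by rewrite divr_ge0//; have := rho0; lra.
by lra.
Qed.

(** [plane_wave_lower] restricted to the support of v. Normalising the wave by rho + t instead of t
    costs e^(-rho) and makes it at most 1 on the ball. *)
Lemma plane_wave_ball (om : Rn) t : \sum_(i < n) om ord0 i ^+ 2 = 1 -> 0 <= t <= tau ->
  expR (- rho) * (delta / 2 * (eps * m0)) <=
  \int[leb]_(x in eball (rho + t)) (`|v t x| * expR (dotr x om - (rho + t))).
Proof.
move=> om1 tt; set g := wave_weight M om.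
have vg : eps * m0 <= pairing (v 0) g by apply: hv0 => x; exact: dir1.
have vg0 : 0 < pairing (v 0) g by apply: lt_le_trans vg; rewrite mulr_gt0.
have v1g : 0 <= eps * pairing v1 g.
  apply: (mulr_ge0 (ltW eps0)); apply: le_trans (ltW m00) _.
  by apply: hv1 => x; exact: dir1.
have := plane_wave_lower ib b0 C2 om1 vg0 v1g tt; rewrite -/delta -/g => low.
set r := rho + t.
have r0 : 0 < r by rewrite /r; have := rho0; lra.
have rM : r <= M by rewrite /r /M; lra.
have lv : L1loc (v t) by have [[lv _] _ _] := comp_w C2; exact/lv/(time_itvP tT).
have lvM := L1loc_cube (M + 1) lv; have lvn := L1cube_norm lvM.
have mr : measurable (eball r : set Rn) by exact: measurable_eball.
have Iv : leb.-integrable (eball r) (EFin \o (fun x => `|v t x|)).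
  by apply: (integrable_eball_pairing _ lvn); lra.
have Ig := integrable_wave_pairing om lvM.
have Ign := integrable_wave_pairing om lvn.
have up : pairing (v t) g <= expR r * \int[leb]_(x in eball r) (`|v t x| * expR (dotr x om - r)).
  rewrite -RintegralZl; [|exact: mr|exact: integrable_plane_wave].
  apply: (@le_trans _ _ (pairing (fun x => `|v t x|) g)).
    apply: le_Rintegral => // x _.
    by rewrite ler_wpM2r ?wave_weight_ge0// ler_norm.
  rewrite Rintegral_mkcond /pairing le_eqVlt; apply/orP; left; apply/eqP.
  apply: ae_eq_Rintegral.
  - by have /measurable_EFinP := measurable_int _ Ign.
  - apply/(measurable_restrictT _ mr).
    apply: measurable_funM => //; apply: measurable_funM.
      by have /measurable_EFinP := measurable_int _ Iv.
    by apply: measurable_funTS; exact: measurable_plane_wave.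
  have := comp_supp C2 tt; apply: filterS => x Hx.
  rewrite patchE; case: ifPn => [/set_mem xr|/negP xr]; last first.
    by rewrite Hx ?normr0 ?mul0r// => /mem_set.
  rewrite /g (wave_weight_ball om rM xr) mulrCA -expRD; congr (_ * expR _).
  by rewrite addrC subrK.
have -> : expR (- rho) * (delta / 2 * (eps * m0)) = expR (- r) * (expR t * (delta / 2 * (eps * m0))).
  by rewrite [RHS]mulrA -expRD /r; congr (expR _ * _); ring.
suff /(ler_wpM2l (expR_ge0 (- r))) : expR t * (delta / 2 * (eps * m0)) <=
    expR r * \int[leb]_(x in eball r) (`|v t x| * expR (dotr x om - r)).
  by rewrite [leRHS]mulrA -expRD addNr expR0 mul1r.
apply: le_trans up.
have h1 : delta / 2 * (eps * m0) <= expR (- t) * pairing (v t) g.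
  by apply: le_trans low; rewrite ler_wpM2l// divr_ge0 ?(ltW d0).
have := ler_wpM2l (expR_ge0 t) h1.
by rewrite [expR t * (expR _ * _)]mulrA -expRD subrr expR0 mul1r.
Qed.

(** The last hypothesis is what [plane_wave_Lp] provides; it is used at radius r = rho + s. The
    quotient of S = r^(m/2), the number of waves, by S^(p-1), the power of their mass, is r^th. *)
Lemma forcing_ge_wave K th : th = m%:R * (2 - p) / 2 -> 0 < K ->
  (forall r (f : Rn -> R) (A : R), 0 < r ->
    leb.-integrable (eball r) (EFin \o (fun x => `|f x|)) ->
    leb.-integrable (eball r) (EFin \o (fun x => `|f x| `^ p)) ->
    0 <= A ->
    (forall w : Rn, \sum_(i < n) w ord0 i ^+ 2 = 1 ->
       A <= \int[leb]_(x in eball r) (`|f x| * expR (dotr x w - r))) ->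
    A `^ p * Num.sqrt r ^+ m <=
    K * (Num.sqrt r ^+ m) `^ (p - 1) * \int[leb]_(x in eball r) (`|f x| `^ p)) ->
  K^-1 * (expR (- rho) * (delta / 2 * (eps * m0))) `^ p *
    (Num.min (4^-1 `^ th) ((rho + 1) `^ th) * tau `^ th) * (tau / 4) <= forcing (tau / 2).
Proof.
move=> thE K0 HK; have t1 := tau0; have tau1' := tau1.
set A := expR (- rho) * _.
have A0 : 0 <= A.
  by rewrite mulr_ge0 ?expR_ge0// mulr_ge0 ?divr_ge0 ?mulr_ge0 ?(ltW d0) ?(ltW eps0) ?(ltW m00).
have -> : tau / 4 = tau / 2 - tau / 4 by field.
apply: forcing_increment; [lra|lra|lra|].
have := @ae_integrable_power R n T tau p (M + 1) v tT (comp_f C1).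
apply: (@filterS _ _ (ae_filter_ringOfSetsType _)) => s Is /andP[s1 s2].
have st : 0 <= s <= tau by apply/andP; split; lra.
have {}Is := Is st.
set r := rho + s.
have r0 : 0 < r by rewrite /r; have := rho0; lra.
have rM : r <= M by rewrite /r /M; lra.
have lv : L1loc (v s) by have [[lv _] _ _] := comp_w C2; exact/lv/(time_itvP tT).
have lvM := L1loc_cube (M + 1) lv; have lvn := L1cube_norm lvM.
have lvp : L1cube (M + 1) (fun x => `|v s x| `^ p).
  split => //; apply: (measurableT_comp (measurable_powR p)).
  exact: (proj1 lvn).
have mr : measurable (eball r : set Rn) by exact: measurable_eball.
have rM1 : r <= M + 1 by lra.
have Iv := integrable_eball_pairing rM1 lvn.
have Ivp := integrable_eball_pairing rM1 lvp.
have := HK r (v s) A r0 Iv Ivp A0 (fun w w1 => plane_wave_ball w1 st).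
set I := Rintegral _ _ _ => HKs.
have IFs : I <= F s.
  have Ig := integrable_wave_pairing 0 lvp.
  rewrite /F /pairing /I /Rintegral fine_le//.
  - exact: (integrable_fin_num mr Ivp).
  - exact: (integrable_fin_num measurableT Ig).
  apply: (@le_trans _ _ (\int[leb]_(x in eball r) (`|v s x| `^ p * g0 x)%:E)%E).
    rewrite le_eqVlt; apply/orP; left; apply/eqP; apply: eq_integral => x /set_mem xr.
    rewrite /g0 (wave_weight_ball 0 rM xr) /dotr big1 ?expR0 ?mulr1// => i _.
    by rewrite mxE mulr0.
  apply: ge0_subset_integral => //.
  - by have := measurable_int _ Ig.
  - by move=> x _; rewrite lee_fin mulr_ge0 ?powR_ge0 ?wave_weight_ge0.
set S := Num.sqrt r ^+ m in HKs.
have S0 : 0 < S by rewrite exprn_gt0// sqrtr_gt0.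
have Sth : S `^ (2 - p) = r `^ th.
  rewrite /S -powR12_sqrt ?(ltW r0)// -powR_mulrn ?powR_ge0// -!powRrM.
  by congr (_ `^ _); rewrite thE; field.
have main : K^-1 * A `^ p * r `^ th <= F s.
  apply: le_trans IFs; rewrite -Sth.
  have -> : S `^ (2 - p) = S / S `^ (p - 1).
    by rewrite (_ : 2 - p = 1 - (p - 1)); [rewrite powRB ?(gt_eqF S0) ?implybT// powRr1 ?(ltW S0)|ring].
  have P0 : 0 < S `^ (p - 1) by exact: powR_gt0.
  have -> : K^-1 * A `^ p * (S / S `^ (p - 1)) = (A `^ p * S) / (K * S `^ (p - 1)).
    by field; rewrite !gt_eqF.
  by rewrite ler_pdivrMr ?mulr_gt0// mulrC [I * _]mulrC mulrC.
apply: le_trans main; rewrite ler_wpM2l ?mulr_ge0 ?powR_ge0 ?invr_ge0 ?(ltW K0)//.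
have rt : r = (r / tau) * tau by field; rewrite gt_eqF.
(* For s in [tau/4, tau/2] the radius is comparable to tau. The sign of th is not fixed, so the
   minimum takes both ends of the range of r / tau into account. *)
have lo : 4^-1 <= r / tau by rewrite ler_pdivlMr// /r; have := rho0; lra.
have hi : r / tau <= rho + 1 by rewrite ler_pdivrMr// /r; have := rho0; nra.
rewrite rt powRM ?(ltW t1)//; last lra.
rewrite ler_wpM2r ?powR_ge0// ge_min; apply/orP.
have rt0 : 0 < r / tau by rewrite divr_gt0.
have [th0|th0] := leP 0 th.
  by left; rewrite ge0_ler_powR// nnegrE; lra.
right; have thN : 0 <= - th by lra.
rewrite -[th]opprK powRN [leRHS]powRN lef_pV2 ?posrE ?powR_gt0//; last by have := rho0; lra.
by rewrite ge0_ler_powR// nnegrE; have := rho0; lra.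
Qed.

End solution.

(** * The lifespan estimate *)

Section lifespan_algebra.
Context {R : realType}.
Implicit Types (x y r p q a G k tau eps W X : R).

Lemma powR_root_le x y r : 0 <= x -> 0 < r -> x `^ r <= y -> x <= y `^ r^-1.
Proof.
move=> x0 r0 xy.
have -> : x = (x `^ r) `^ r^-1 by rewrite -powRrM divff ?gt_eqF// powRr1.
have y0 : 0 <= y by apply: le_trans xy; exact: powR_ge0.
by rewrite ge0_ler_powR// ?nnegrE ?powR_ge0// invr_ge0 ltW.
Qed.

(** A lower bound of size eps^p tau^a meets the upper bound of size tau^(-G); the p-th root isolates
    eps. *)
Lemma amplitude_bound p k a G tau eps Cx : 0 < p -> 0 < k -> 0 < tau -> 0 < eps ->
  eps `^ p * k * tau `^ a <= Cx * tau `^ (- G) ->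
  eps * tau `^ ((G + a) / p) <= (Cx / k) `^ p^-1.
Proof.
move=> p0 k0 tau0 eps0 H.
apply: powR_root_le => //; first by rewrite mulr_ge0 ?powR_ge0// ltW.
rewrite powRM ?powR_ge0 ?(ltW eps0)// -powRrM divfK ?gt_eqF//.
rewrite powRD ?(gt_eqF tau0) ?implybT// ler_pdivlMr//.
rewrite powRN in H; have tG : 0 < tau `^ G by exact: powR_gt0.
rewrite ler_pdivlMr// in H.
apply: le_trans H; rewrite le_eqVlt; apply/orP; left; apply/eqP; ring.
Qed.

(** The conclusion of [iteration] is solved for X, and the volume W is replaced by a multiple of
    tau^n. The resulting decay exponent is the third term of Gamma. *)
Lemma saturation_bound (n : nat) p q d W X om tau Cit : 1 < p -> 1 < q -> 0 < d ->
  0 < W -> 0 <= X -> 0 < om -> 0 < tau -> W <= (om * tau) ^+ n ->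
  d `^ p * W `^ (1 - p * q) * tau `^ (1 + 2 * p) * X `^ (p * q - 1) <= Cit ->
  X <= (Cit / d `^ p) `^ (p * q - 1)^-1 * om ^+ n * tau `^ (- ((2 * p + 1) / (p * q - 1) - n%:R)).
Proof.
move=> p1 q1 d0 W0 X0 om0 tau0 Wle H.
have pq0 : 0 < p * q - 1 by nra.
have dp : 0 < d `^ p by exact: powR_gt0.
have tp : 0 < tau `^ (1 + 2 * p) by exact: powR_gt0.
have Wp : 0 < W `^ (p * q - 1) by exact: powR_gt0.
have Cd0 : 0 <= Cit / d `^ p.
  by rewrite divr_ge0 ?(ltW dp)//; apply: le_trans H; rewrite !mulr_ge0 ?powR_ge0.
have {}H : X `^ (p * q - 1) <= Cit / d `^ p * W `^ (p * q - 1) * tau `^ (- (1 + 2 * p)).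
  rewrite powRN ler_pdivlMr// mulrAC ler_pdivlMr//.
  rewrite (_ : 1 - p * q = - (p * q - 1)) in H; last by ring.
  rewrite powRN in H.
  have -> : X `^ (p * q - 1) * tau `^ (1 + 2 * p) * d `^ p =
    (d `^ p / W `^ (p * q - 1) * tau `^ (1 + 2 * p) * X `^ (p * q - 1)) * W `^ (p * q - 1).
    by field; rewrite gt_eqF.
  by rewrite ler_wpM2r// ltW.
apply: le_trans (powR_root_le X0 pq0 H) _.
have CW0 : 0 <= Cit / d `^ p * W `^ (p * q - 1) by rewrite mulr_ge0 ?powR_ge0.
rewrite [(_ * tau `^ _) `^ _]powRM ?powR_ge0//.
rewrite [(_ * W `^ _) `^ _]powRM ?powR_ge0// -!powRrM divff ?gt_eqF//.
rewrite powRr1 ?(ltW W0)//.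
have -> : - ((2 * p + 1) / (p * q - 1) - n%:R) = n%:R + - (1 + 2 * p) / (p * q - 1).
  by field; rewrite gt_eqF.
rewrite powRD ?(gt_eqF tau0) ?implybT// powR_mulrn ?(ltW tau0)//.
rewrite -!mulrA ler_wpM2l ?powR_ge0// mulrA ler_wpM2r ?powR_ge0//.
by rewrite -exprMn.
Qed.

Lemma le_sum3 x (y1 y2 y3 : R) : 0 < y1 -> 0 < y2 -> 0 < y3 ->
  x <= y3 \/ x <= y2 \/ x <= y1 -> x <= y1 + y2 + y3.
Proof. by move=> ? ? ? [|[|]]; lra. Qed.

Lemma window_le (n : nat) (rho tau : R) : 0 < rho -> 1 <= tau ->
  0 < (2 * (rho + tau + 1 + 1)) ^+ n <= (2 * (rho + 3) * tau) ^+ n.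
Proof.
move=> rho0 tau1; rewrite exprn_gt0 /=; last lra.
by apply: lerXn2r; rewrite ?nnegrE; nra.
Qed.

(** The exponent (G + a)/p of [amplitude_bound] is the first term of Gamma for the wave bound and,
    in the next lemma, the second term for the linear bound. *)
Lemma wave_exponent (m : nat) p q : 1 < p -> 0 < p * q - 1 ->
  ((2 * p + 1) / (p * q - 1) - m.+1%:R + (m%:R * (2 - p) / 2 + 1)) / p =
  (2 + p^-1) / (p * q - 1) - (m.+1%:R - 1) / 2.
Proof. by move=> p1 pq0; rewrite -natr1; field; rewrite !gt_eqF//; lra. Qed.

Lemma linear_exponent (n : nat) p q : 1 < p -> 0 < p * q - 1 ->
  ((2 * p + 1) / (p * q - 1) - n%:R + (n%:R * (1 - p) + p + 1)) / p =
  (q + 2) / (p * q - 1) - n%:R + 1.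
Proof. by move=> p1 pq0; field; rewrite !gt_eqF//; lra. Qed.

Lemma Gamma0_cases (n : nat) p q :
  Gamma0 n p q = (2 * p + 1) / (p * q - 1) - n%:R \/
  Gamma0 n p q = (q + 2) / (p * q - 1) - n%:R + 1 \/
  Gamma0 n p q = (2 + p^-1) / (p * q - 1) - (n%:R - 1) / 2.
Proof.
rewrite /Gamma0 /Num.max; case: ifP => _; first by left.
by right; case: ifP => _; [left|right].
Qed.

End lifespan_algebra.

(** * Collecting the bounds *)

Section main.
Context {R : realType}.

(** The constant is chosen before eps, T and the solution, and the bound holds at every time tau >=
    1 below T; what is left for the theorem is a good choice of tau. *)
Lemma lifespan_bound (m : nat) (b : R -> R)
  (hbL1 : lebesgue_measure.-integrable `[0, +oo[ (EFin \o b))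
  (hb0 : {ae lebesgue_measure, forall t : R, 0 <= t -> 0 <= b t})
  (rho : R) (hrho : 0 < rho) (u0 u1 v0 v1 : 'rV[R]_m.+1 -> R)
  (hu0 : W11loc u0) (hu1 : L1loc u1) (hv0 : W11loc v0) (hv1 : L1loc v1)
  (au0 : admissible_datum rho u0) (au1 : admissible_datum rho u1)
  (av0 : admissible_datum rho v0) (av1 : admissible_datum rho v1)
  (p q : R) (hp : 1 < p) (hq : 1 < q) :
  exists2 C : R, 0 < C & forall (eps : R) (T : \bar R) (u v : R -> 'rV[R]_m.+1 -> R),
    0 < eps -> weak_solution b p q rho eps u0 u1 v0 v1 T u v ->
    forall tau : R, 1 <= tau -> (tau%:E < T)%E ->
      eps * tau `^ Gamma0 m.+1 p q <= C.
Proof.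
have [lu0 _] := hu0; have [lv0 _] := hv0.
have [mu0 mu00 Hu0] := data_lower lu0 au0.
have [mu1 mu10 Hu1] := data_lower hu1 au1.
have [mv0 mv00 Hv0] := data_lower lv0 av0.
have [mv1 mv10 Hv1] := data_lower hv1 av1.
pose m0 := Num.min (Num.min mu0 mu1) (Num.min mv0 mv1).
have m00 : 0 < m0 by rewrite !lt_min mu00 mu10 mv00 mv10.
have [l1 [l2 [l3 l4]]] : m0 <= mu0 /\ m0 <= mu1 /\ m0 <= mv0 /\ m0 <= mv1.
  by rewrite /m0 !ge_min !lexx ?orbT.
have p0 : 0 < p by exact: lt_trans ltr01 hp.
have [K K0 HK] := @plane_wave_Lp R m p hp.
have [Cit Cit0 Hit] := @iteration R p q hp hq.
pose d := expR (- (4 * \int[lebesgue_measure]_(x in `[0, +oo[) b x)).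
have d0 : 0 < d by exact: expR_gt0.
pose om := 2 * (rho + 3); have om0 : 0 < om by rewrite /om; lra.
have pq0 : 0 < p * q - 1 by nra.
pose Cx := (Cit / d `^ p) `^ (p * q - 1)^-1 * om ^+ m.+1.
have Cx0 : 0 < Cx by rewrite mulr_gt0 ?exprn_gt0// powR_gt0// divr_gt0// powR_gt0.
pose G3 := (2 * p + 1) / (p * q - 1) - m.+1%:R.
pose k2 := om `^ (m.+1%:R * (1 - p)) * (d * m0 / 4) `^ p / 4.
have k20 : 0 < k2.
  have ? : 0 < d * m0 / 4 by rewrite divr_gt0// mulr_gt0.
  by rewrite divr_gt0// mulr_gt0 ?powR_gt0.
pose a2 := m.+1%:R * (1 - p) + p + 1.
pose th := m%:R * (2 - p) / 2.
pose k1 := K^-1 * (expR (- rho) * (d / 2 * m0)) `^ p *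
  Num.min (4^-1 `^ th) ((rho + 1) `^ th) / 4.
have k10 : 0 < k1.
  have ? : 0 < Num.min (4^-1 `^ th) ((rho + 1) `^ th) by rewrite lt_min !powR_gt0//; lra.
  have ? : 0 < expR (- rho) * (d / 2 * m0).
    by rewrite mulr_gt0 ?expR_gt0// mulr_gt0// divr_gt0.
  by rewrite divr_gt0// mulr_gt0// mulr_gt0 ?invr_gt0 ?powR_gt0.
pose a1 := th + 1.
pose C3 := Cx / m0; pose C2 := (Cx / k2) `^ p^-1; pose C1 := (Cx / k1) `^ p^-1.
have C30 : 0 < C3 by rewrite divr_gt0.
have C20 : 0 < C2 by rewrite powR_gt0// divr_gt0.
have C10 : 0 < C1 by rewrite powR_gt0// divr_gt0.
exists (C1 + C2 + C3); first by rewrite !addr_gt0.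
move=> eps T u v eps0 sol tau tau1 tT.
have tau0 : 0 < tau by exact: lt_le_trans ltr01 tau1.
have supp t : 0 <= t <= tau ->
    {ae lebesgue_rV R m.+1, forall x, ~ eball (rho + t) x -> u t x = 0} /\
    {ae lebesgue_rV R m.+1, forall x, ~ eball (rho + t) x -> v t x = 0}.
  move=> /andP[t0 tt]; have [_ _ su0] := au0; have [_ _ sv0] := av0.
  by apply: (solution_support su0 sv0 sol t0); apply: le_lt_trans tT; rewrite lee_fin.
have [du [dv [Du [Dv [[wu dwu Lu] [wv dwv Lv] _ [iu iv] [equ eqv]]]]]] := sol.
have i1 : lebesgue_measure.-integrable `[0, tau] (EFin \o (fun=> (1 : R))).
  by apply: within_integrable; exact: within_cst.
have ibt : lebesgue_measure.-integrable `[0, tau] (EFin \o b).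
  by apply: integrableS hbL1 => // s; rewrite /= !in_itv /= => /andP[->].
have comp1 : component T tau rho eps p (fun=> 1) u1 u du Du v.
  by split => // t tt; case: (supp t tt).
have comp2 : component T tau rho eps q b v1 v dv Dv u.
  by split => // t tt; case: (supp t tt).
pose M := rho + tau + 1.
have rM : rho <= M by rewrite /M -addrA lerDl addr_ge0// ltW.
have init (f0 : 'rV[R]_m.+1 -> R) (f : R -> 'rV[R]_m.+1 -> R) g c :
    L1loc f0 -> L1loc (f 0) -> cutoff c g ->
    {ae lebesgue_rV R m.+1, forall x, f 0 x = eps * f0 x} ->
    pairing (f 0) g = eps * pairing f0 g.
  move=> lf0 lf cg ff; have [mg [Cg gC]] := cutoff_bounded cg.
  have If0 := integrable_pairing mg gC (proj2 cg) (L1loc_cube c lf0).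
  have If := integrable_pairing mg gC (proj2 cg) (L1loc_cube c lf).
  rewrite /pairing -RintegralZl//; apply: ae_eq_Rintegral.
  - by have /measurable_EFinP := measurable_int _ If.
  - by apply: measurable_funM => //; have /measurable_EFinP := measurable_int _ If0.
  by apply: filterS ff => x ->; rewrite mulrA.
have z0 : time_itv T 0 by apply: (time_itvP tT); rewrite lexx ltW.
have lu : L1loc (u 0) by have [[lu _] _ _] := wu; exact: lu.
have lv : L1loc (v 0) by have [[lv _] _ _] := wv; exact: lv.
have zdir (x : 'rV[R]_m.+1) : eball rho x -> - rho <= dotr x 0.
  move=> _; rewrite /dotr big1 ?oppr_le0 ?(ltW hrho)// => i _.
  by rewrite mxE mulr0.
have bu0 : eps * m0 <= pairing (u 0) (wave_weight M 0).
  rewrite (init u0 u _ _ lu0 lu (wave_weight_cutoff M 0) iu).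
  apply: (ler_wpM2l (ltW eps0)); exact: le_trans l1 (Hu0 M 0 rM zdir).
have bu1 : m0 <= pairing u1 (wave_weight M 0) by exact: le_trans l2 (Hu1 M 0 rM zdir).
have bv0 w : (forall x, eball rho x -> - rho <= dotr x w) ->
    eps * m0 <= pairing (v 0) (wave_weight M w).
  move=> wd; rewrite (init v0 v _ _ lv0 lv (wave_weight_cutoff M w) iv).
  apply: (ler_wpM2l (ltW eps0)); exact: le_trans l3 (Hv0 M w rM wd).
have bv1 w : (forall x, eball rho x -> - rho <= dotr x w) ->
    m0 <= pairing v1 (wave_weight M w).
  by move=> wd; exact: le_trans l4 (Hv1 M w rM wd).
pose G := forcing tau rho eps p u1 u v.
pose W := (2 * (rho + tau + 1 + 1)) ^+ m.+1.
have /andP[W0 Wle] : 0 < W <= (om * tau) ^+ m.+1 by exact: window_le.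
pose X := G (tau / 2).
have Xdata : eps * m0 <= X by exact: forcing_ge_data.
have X0 : 0 <= X by apply: le_trans Xdata; rewrite mulr_ge0 ?ltW.
have Hstep a h : tau / 2 <= a -> 0 < h -> a + 4 * h <= tau ->
    d `^ p * W `^ (1 - p * q) * h `^ (1 + 2 * p) * (1 - expR (- h)) `^ (p * q) *
      G a `^ (p * q) <= G (a + 4 * h).
  move=> ta; have a0 : 0 <= a by apply: le_trans ta; rewrite divr_ge0// ltW.
  move=> h0 ah.
  exact: (forcing_step comp1 comp2 hbL1 hb0 eps0 m00 bu0 bu1 bv0 bv1 a0 h0 ah).
have ndG s t : 0 <= s -> s <= t -> t <= tau -> G s <= G t.
  exact: (forcing_nondecreasing comp1).
have D0 : 0 < d `^ p * W `^ (1 - p * q) by rewrite mulr_gt0 ?powR_gt0.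
have XC := Hit tau _ G tau1 D0 X0 ndG Hstep.
have Xup : X <= Cx * tau `^ (- G3).
  exact: (saturation_bound hp hq d0 W0 X0 om0 tau0 Wle XC).
(* Each lower bound on X is now set against [Xup]; the bound by the data yields the third term of
   Gamma. *)
have B3 : eps * tau `^ G3 <= C3.
  have t3 : 0 < tau `^ G3 by exact: powR_gt0.
  rewrite /C3 ler_pdivlMr// mulrAC -ler_pdivlMr// -powRN.
  exact: le_trans Xdata Xup.
have B2 : eps * tau `^ ((G3 + a2) / p) <= C2.
  apply: (amplitude_bound p0 k20 tau0 eps0).
  apply: le_trans Xup.
  have L : W `^ (1 - p) * (d * (eps * m0) * (tau / 4)) `^ p * (tau / 4) <= X.
    exact: (forcing_ge_linear comp1 comp2 hbL1 hb0 eps0 m00 bu0 bu1 bv0 bv1).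
  apply: le_trans L.
  (* As 1 - p is negative, the upper bound on the volume W becomes a lower bound on its power. *)
  have WW : om `^ (m.+1%:R * (1 - p)) * tau `^ (m.+1%:R * (1 - p)) <= W `^ (1 - p).
    have ot0 : 0 < om * tau by exact: mulr_gt0.
    have oW0 : 0 < (om * tau) ^+ m.+1 by exact: exprn_gt0.
    rewrite -powRM; [|exact: ltW|exact: ltW].
    rewrite powRrM powR_mulrn; last exact: ltW.
    rewrite (_ : 1 - p = - (p - 1)); last by ring.
    rewrite powRN [leRHS]powRN lef_pV2 ?posrE; [|exact: powR_gt0..].
    have p10 : 0 <= p - 1 by rewrite subr_ge0 ltW.
    by apply: (ge0_ler_powR p10) Wle; rewrite nnegrE ltW.
  have -> : d * (eps * m0) * (tau / 4) = eps * (d * m0 / 4) * tau by field.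
  rewrite [(_ * tau) `^ p]powRM ?mulr_ge0 ?divr_ge0 ?mulr_ge0 ?(ltW eps0) ?(ltW d0) ?(ltW m00) ?(ltW tau0)//.
  rewrite [(eps * _) `^ p]powRM ?divr_ge0 ?mulr_ge0 ?(ltW eps0) ?(ltW d0) ?(ltW m00)//.
  have -> : tau `^ a2 = tau `^ (m.+1%:R * (1 - p)) * tau `^ p * tau.
    rewrite /a2 powRD ?(gt_eqF tau0) ?implybT// powRr1 ?(ltW tau0)//.
    by rewrite powRD ?(gt_eqF tau0) ?implybT.
  rewrite /k2.
  set Y := eps `^ p * (d * m0 / 4) `^ p * tau `^ p.
  have Y0 : 0 <= Y * (tau / 4) by rewrite !mulr_ge0 ?powR_ge0 ?divr_ge0 ?(ltW tau0).
  have := ler_wpM2r Y0 WW; rewrite !mulrA; apply: le_trans.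
  by rewrite le_eqVlt; apply/orP; left; apply/eqP; rewrite /Y; field.
have B1 : eps * tau `^ ((G3 + a1) / p) <= C1.
  apply: (amplitude_bound p0 k10 tau0 eps0).
  apply: le_trans Xup.
  have L : K^-1 * (expR (- rho) * (d / 2 * (eps * m0))) `^ p *
      (Num.min (4^-1 `^ th) ((rho + 1) `^ th) * tau `^ th) * (tau / 4) <= X.
    exact: (forcing_ge_wave comp1 comp2 hbL1 hb0 eps0 m00 bu0 bu1 bv0 bv1 (erefl th) K0 HK).
  apply: le_trans L; rewrite /a1 /k1 powRD ?(gt_eqF tau0) ?implybT// powRr1 ?(ltW tau0)//.
  have -> : expR (- rho) * (d / 2 * (eps * m0)) = eps * (expR (- rho) * (d / 2 * m0)) by ring.
  rewrite [(eps * _) `^ p]powRM ?mulr_ge0 ?divr_ge0 ?mulr_ge0 ?expR_ge0 ?(ltW eps0) ?(ltW d0) ?(ltW m00)//.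
  by rewrite le_eqVlt; apply/orP; left; apply/eqP; ring.
rewrite /G3 /a1 /th wave_exponent// in B1.
rewrite /G3 /a2 linear_exponent// in B2.
apply: le_sum3 => //.
by case: (Gamma0_cases m.+1 p q) => [->|[->|->]]; [left|right; left|right; right].
Qed.

End main.

Theorem theorem2p2 (R : realType) (n : nat) (hn : (1 <= n)%N)
  (b : R -> R)
  (hbL1 : lebesgue_measure.-integrable `[0, +oo[ (EFin \o b))
  (hb0 : {ae lebesgue_measure, forall t : R, 0 <= t -> 0 <= b t})
  (rho : R) (hrho : 0 < rho)
  (u0 u1 v0 v1 : 'rV[R]_n -> R)
  (hu0 : W11loc u0) (hu1 : L1loc u1) (hv0 : W11loc v0) (hv1 : L1loc v1)
  (au0 : admissible_datum rho u0) (au1 : admissible_datum rho u1)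
  (av0 : admissible_datum rho v0) (av1 : admissible_datum rho v1)
  (p q : R) (hp : 1 < p) (hq : 1 < q)
  (hGamma : 0 < Gamma0 n p q) :
  exists eps0 C : R, [/\ 0 < eps0, 0 < C &
    forall eps : R, 0 < eps -> eps <= eps0 ->
    forall (T : \bar R) (u v : R -> 'rV[R]_n -> R),
      (0 < T)%E ->
      weak_solution b p q rho eps u0 u1 v0 v1 T u v ->
      (T < +oo)%E /\ (T <= (C * eps `^ (- (1 / Gamma0 n p q)))%:E)%E].
Proof.
case: n hn u0 u1 v0 v1 hu0 hu1 hv0 hv1 au0 au1 av0 av1 hGamma => // m _.
move=> u0 u1 v0 v1 hu0 hu1 hv0 hv1 au0 au1 av0 av1 hGamma.
have [C C0 HC] := lifespan_bound hbL1 hb0 hrho hu0 hu1 hv0 hv1 au0 au1 av0 av1 hp hq.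
set Ga := Gamma0 m.+1 p q in hGamma *.
(* With this choice L satisfies eps L^Ga = C + 1 > C, contradicting [lifespan_bound] at a time
   slightly beyond L if T were larger than L. Both eps <= 1 and C + 1 >= 1 serve to make L >= 1, as
   that lemma requires. *)
exists 1, ((C + 1) `^ Ga^-1); split => //; first by rewrite powR_gt0; lra.
move=> eps eps0 eps1 T u v _ sol.
set L := (C + 1) `^ Ga^-1 * _.
have L1 : 1 <= L.
  rewrite /L div1r powRN -powRN -[leLHS]mul1r ler_pM//.
  - rewrite -[leLHS](powRr0 (C + 1)) ler_powR//; first lra.
    by rewrite invr_ge0 ltW.
  rewrite powRN -[leLHS]invr1 lef_pV2 ?posrE ?powR_gt0//.
  rewrite -[leRHS](_ : 1 `^ Ga^-1 = 1); last by rewrite powR1.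
  by rewrite ge0_ler_powR ?nnegrE ?invr_ge0 ?(ltW hGamma) ?(ltW eps0).
suff TL : (T <= L%:E)%E by split => //; apply: le_lt_trans TL _; rewrite ltry.
rewrite leNgt; apply/negP => LT.
have [d d0 dT] := lt_ereal_room LT.
have := HC eps T u v eps0 sol (L + d) ltac:(lra) dT.
rewrite leNgt => /negP; apply.
apply: (@lt_le_trans _ _ (C + 1)); first lra.
have -> : C + 1 = eps * L `^ Ga.
  rewrite /L powRM ?powR_ge0// -!powRrM mulVf ?gt_eqF// powRr1; last lra.
  rewrite mulNr div1r mulVf ?gt_eqF// powR_inv1 ?(ltW eps0)//.
  by rewrite mulrCA divff ?mulr1 ?gt_eqF.
rewrite ler_wpM2l ?(ltW eps0)// ge0_ler_powR ?nnegrE ?(ltW hGamma)//; lra.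
Qed.
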